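(* Let $(X,T)$ be a minimal Cantor system. Let $\alpha\ge1$ and let $(g_n)_{n\in\mathbb{N}}$ be a sequence of positive real numbers such that $\lim_{n\to\infty}\frac{\log(g_n)}{n}=\log(\alpha)$. Then there exists a pseudo-Toeplitz subshift $(Y,S)$ such that (1) $(X,T)$ and $(Y,S)$ are strong orbit equivalent; (2) $\liminf_{n\to\infty}\frac{g_n}{p_Y(n)}=0$; (3) $h(Y,S)=\log(\alpha)$.
   Context: $\mathbb{N}=\{0,1,\dots\}$; logarithms are natural. A minimal Cantor system is a pair $(X,T)$ with $X$ a Cantor space and $T$ a homeomorphism of $X$ all of whose orbits are dense. A subshift $(Y,S)$ is a closed shift-invariant subset $Y\subseteq\mathcal{A}^{\mathbb{Z}}$ ($\mathcal{A}$ a finite alphabet) with the left shift $S$; $p_Y(n)$ is the number of words of length $n$ occurring in elements of $Y$, and $h(Y,S)=\lim_n \log(p_Y(n))/n$ is the topological entropy. Strong orbit equivalence of minimal Cantor systems $(X_1,T_1),(X_2,T_2)$: there is a homeomorphism $\phi\colon X_1\to X_2$ mapping each $T_1$-orbit onto a $T_2$-orbit, and such that the maps $n_1,n_2\colon X_1\to\mathbb{Z}$ determined by $\phi\circ T_1(x)=T_2^{n_1(x)}\circ\phi(x)$ and $\phi\circ T_1^{n_2(x)}(x)=T_2\circ\phi(x)$ each have at most one point of discontinuity. A Bratteli diagram $(V,E)$ is an infinite directed graph (multiple edges allowed) with $V=\bigsqcup_{i\ge0}V_i$, $E=\bigsqcup_{i\ge1}E_i$, all $V_i,E_i$ finite and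 non-empty, $V_0$ a single point (top vertex), with source and range maps $s,r$ such that $s(E_i)\subseteq V_{i-1}$, $r(E_i)\subseteq V_i$, $s^{-1}(v)\ne\emptyset$ for all $v\in V$, $r^{-1}(v)\ne\emptyset$ for all $v\in V\setminus V_0$. The incidence matrix $M_i$ has entry $M_i(v,u)$ equal to the number of edges from $u\in V_i$ to $v\in V_{i+1}$. The diagram is simple if there is a strictly increasing sequence $0=t_0<t_1<\cdots$ such that all products $M_{t_{i+1}-1}\cdots M_{t_i}$ have positive entries. An ordered Bratteli diagram $(V,E,\ge)$ carries a linear order on $r^{-1}(v)$ for each $v\in V\setminus V_0$. It is properly ordered if it is simple and there is exactly one infinite path $x_{\min}$ consisting of minimal edges and exactly one infinite path $x_{\max}$ consisting of maximal edges. Its Bratteli-Vershik system $(X_B,V_B)$: $X_B$ is the (assumed infinite) space of infinite paths $(e_1,e_2,\dots)$, $e_i\in E_i$, $r(e_i)=s(e_{i+1})$, with topology generated by cylinder sets; $V_B(x_{\max})=x_{\min}$, and for $x=(e_i)\ne x_{\max}$, with $k$ the least index such that $e_k$ is not maximal and $f_k$ the successor of $e_k$ in $r^{-1}(r(e_k))$, $V_B(x)=(f_1,\dots,f_{k-1},f_k,e_{k+1},\dots)$, where $(f_1,\dots,f_{k-1})$ is the path of minimal edges from $V_0$ to $s(f_k)$. A Bratteli-Vershik representation of a minimal Cantor system is a properly ordered Bratteli diagram whose Bratteli-Vershik system is conjugate to it. A simple Bratteli diagram is pseudo-ERS if $\lim_{i\to\infty}L_i/\ell_i=1$, where $L_i$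 and $\ell_i$ are the maximal and minimal number of paths from the top vertex to vertices of $V_i$. A minimal subshift is pseudo-Toeplitz if it admits a Bratteli-Vershik representation $(V,E,\ge)$ with $(V,E)$ pseudo-ERS. *)

(* Defs.v *)
From mathcomp Require Import all_boot all_order all_algebra.
From mathcomp Require Import all_classical all_reals.
From mathcomp Require Import topology normedtype sequences exp cantor.
Import Order.TTheory GRing.Theory Num.Theory.
Import numFieldNormedType.Exports.

Set Implicit Arguments.
Unset Strict Implicit.
Unset Printing Implicit Defensive.

Local Open Scope classical_set_scope.
Local Open Scope ring_scope.

Record homeomorphism (X Y : topologicalType) := Homeomorphism {
  homeo_fun :> X -> Y;
  homeo_inv : Y -> X;
  homeo_funK : cancel homeo_fun homeo_inv;
  homeo_invK : cancel homeo_inv homeo_fun;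
  homeo_fun_continuous : continuous homeo_fun;
  homeo_inv_continuous : continuous homeo_inv }.

Definition iterZ (X : topologicalType) (T : homeomorphism X X) (m : int)
    (x : X) : X :=
  match m with
  | Posz n => iter n T x
  | Negz n => iter n.+1 (homeo_inv T) x
  end.

Definition orbit (X : topologicalType) (T : homeomorphism X X) (x : X) :
  set X := range (fun m : int => iterZ T m x).

Definition is_cantor_space (X : topologicalType) : Prop :=
  inhabited (homeomorphism X cantor_space).

Definition minimal_cantor_system (X : topologicalType)
    (T : homeomorphism X X) : Prop :=
  is_cantor_space X /\ forall x : X, dense (orbit T x).

Definition at_most_one_discontinuity (X : topologicalType)
    (f : X -> discrete_topology int) : Prop :=
  forall x y : X, ~ {for x, continuous f} -> ~ {for y, continuous f} -> x = y.

(* On minimal Cantor systems there are no periodic points, so the cocycles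
   [n1] and [n2] are determined by [phi]. *)
Definition strong_orbit_equivalent (X1 X2 : topologicalType)
    (T1 : homeomorphism X1 X1) (T2 : homeomorphism X2 X2) : Prop :=
  exists phi : homeomorphism X1 X2,
    (forall x : X1, phi @` orbit T1 x = orbit T2 (phi x)) /\
    exists n1 n2 : X1 -> int,
      [/\ forall x : X1, phi (T1 x) = iterZ T2 (n1 x) (phi x),
          forall x : X1, phi (iterZ T1 (n2 x) x) = T2 (phi x),
          at_most_one_discontinuity n1 &
          at_most_one_discontinuity n2].

(* [V] is a bare map: the conjugating homeomorphism makes it a homeomorphism. *)
Definition conjugate (X Y : topologicalType) (V : X -> X) (T : Y -> Y) : Prop :=
  exists psi : homeomorphism X Y, forall x : X, psi (V x) = T (psi x).

Lemma reindex_continuous (I : eqType) (K : topologicalType) (u : I -> I) :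
  continuous ((fun x k => x (u k)) :
    prod_topology (fun _ : I => K) -> prod_topology (fun _ : I => K)).
Proof.
move=> x; apply/(@cvg_sup _ I (fun i => Topological.class
  (initial_topology (fun f : I -> K => f i)))).
  exact: (fmap_filter _ (nbhs_filter x)).
move=> k U [_ [[W oW <-]] /= Wx sWU].
have := @proj_continuous _ (fun _ : I => K) (u k) x W.
move=> /(_ (open_nbhs_nbhs (conj oW Wx))) xW.
have sub : (fun y : I -> K => W (y (u k))) `<=`
    (fun y => U (fun i => y (u i))) by move=> y Wy; apply: sWU.
exact (@filterS _ _ (nbhs_filter x) _ _ sub xW).
Qed.

Lemma set_type_continuous (X : topologicalType) (A : set X) (f : X -> X)
    (g : A -> A) :
  continuous f -> (forall x : A, set_val (g x) = f (set_val x)) -> continuous g.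
Proof.
move=> cf gf; apply: (@continuous_comp_initial _ A X set_val g).
have -> : set_val \o g = f \o set_val by apply/funext => x; exact: gf.
move=> x; apply: continuous_comp; last exact: cf.
exact: (@initial_continuous A X set_val).
Qed.

Definition full_shift (A : finType) :=
  prod_topology (fun _ : int => discrete_topology A).

Definition shift (A : finType) (x : full_shift A) : full_shift A :=
  fun k => x (k + 1).

Definition unshift (A : finType) (x : full_shift A) : full_shift A :=
  fun k => x (k - 1).

Lemma shiftK (A : finType) : cancel (@shift A) (@unshift A).
Proof. by move=> x; apply/funext => k; rewrite /unshift /shift subrK. Qed.

Lemma unshiftK (A : finType) : cancel (@unshift A) (@shift A).
Proof. by move=> x; apply/funext => k; rewrite /unshift /shift addrK. Qed.

Record subshift (A : finType) := Subshift {
  subshift_set :> set (full_shift A);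
  subshift_closed : closed subshift_set;
  subshift_invariant : @shift A @` subshift_set = subshift_set }.

Section SubshiftSystem.
Variables (A : finType) (Y : subshift A).

Lemma shift_mem (x : full_shift A) :
  subshift_set Y x -> subshift_set Y (shift x).
Proof. by move=> Yx; rewrite -(subshift_invariant Y); exists x. Qed.

Lemma unshift_mem (x : full_shift A) :
  subshift_set Y x -> subshift_set Y (unshift x).
Proof.
by rewrite -[X in X _ -> _](subshift_invariant Y) => -[y Yy <-]; rewrite shiftK.
Qed.

Definition subshift_map (x : Y) : Y :=
  SigSub (mem_set (shift_mem (set_mem (valP x)))).

Definition subshift_unmap (x : Y) : Y :=
  SigSub (mem_set (unshift_mem (set_mem (valP x)))).

Lemma subshift_mapK : cancel subshift_map subshift_unmap.
Proof. by move=> x; apply/val_inj; exact: shiftK. Qed.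

Lemma subshift_unmapK : cancel subshift_unmap subshift_map.
Proof. by move=> x; apply/val_inj; exact: unshiftK. Qed.

Lemma subshift_map_continuous : continuous subshift_map.
Proof.
apply: (@set_type_continuous _ _ (@shift A)) => //.
exact: (@reindex_continuous int (discrete_topology A) (fun k => k + 1)).
Qed.

Lemma subshift_unmap_continuous : continuous subshift_unmap.
Proof.
apply: (@set_type_continuous _ _ (@unshift A)) => //.
exact: (@reindex_continuous int (discrete_topology A) (fun k => k - 1)).
Qed.

Definition subshift_system : homeomorphism Y Y :=
  Homeomorphism subshift_mapK subshift_unmapK
    subshift_map_continuous subshift_unmap_continuous.

Definition occurs (n : nat) (w : n.-tuple A) : Prop :=
  exists x : full_shift A, subshift_set Y x /\
    exists k : int, forall i : 'I_n, x (k + (i : nat)%:Z) = tnth w i.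

Definition complexity (n : nat) : nat :=
  #|[set w : n.-tuple A | `[< occurs w >]]%SET|.

(* The limit defining the entropy always exists; asserting convergence instead
   of [lim _ = h] avoids the junk value of [lim]. *)
Definition has_entropy (R : realType) (h : R) : Prop :=
  ln ((complexity n)%:R : R) / n%:R @[n --> \oo] --> h.

End SubshiftSystem.

(* [bedge B i] is the set of edges between levels [i] and [i.+1]. The sets of
   vertices and edges are non-empty by [btop] and [bsrc_surj]. *)
Record bratteli_diagram := BratteliDiagram {
  bvert : nat -> finType;
  bedge : nat -> finType;
  bsrc : forall i, bedge i -> bvert i;
  brng : forall i, bedge i -> bvert i.+1;
  btop : #|bvert 0| = 1%N;
  bsrc_surj : forall i (v : bvert i), exists e : bedge i, bsrc e = v;
  brng_surj : forall i (v : bvert i.+1), exists e : bedge i, brng e = v }.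

Section Bratteli.
Variable B : bratteli_diagram.

Definition incidence (i : nat) : 'M[nat]_(#|bvert B i.+1|, #|bvert B i|) :=
  \matrix_(v, u) #|[set e : bedge B i | (bsrc e == enum_val u)
                                     && (brng e == enum_val v)]%SET|.

(* [incidence_prod i k] is $M_{i+k-1} \cdots M_i$. *)
Fixpoint incidence_prod (i k : nat) :
    'M[nat]_(#|bvert B (k + i)|, #|bvert B i|) :=
  match k with
  | 0%N => 1%:M
  | k'.+1 => incidence (k' + i) *m incidence_prod i k'
  end.

Definition simple_diagram : Prop :=
  exists t : nat -> nat,
    [/\ t 0%N = 0%N,
        forall i, (t i < t i.+1)%N &
        forall i v u, (0 < incidence_prod (t i) (t i.+1 - t i) v u)%N].

(* The finite paths from the top vertex to [v], as a finite type: the last edge,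
   together with a path to its source. *)
Fixpoint path_to (i : nat) : bvert B i -> finType :=
  match i with
  | 0%N => fun _ => unit : finType
  | i'.+1 => fun v =>
      {e : {e : bedge B i' | brng e == v} & path_to (bsrc (val e))} : finType
  end.

Definition max_paths (i : nat) : nat := \max_(v : bvert B i) #|path_to v|.

(* The start value [max_paths i] is an upper bound, so it never lowers the min. *)
Definition min_paths (i : nat) : nat :=
  \big[minn/max_paths i]_(v : bvert B i) #|path_to v|.

Definition pseudo_ERS (R : realType) : Prop :=
  simple_diagram /\
  (max_paths i)%:R / (min_paths i)%:R @[i --> \oo] --> (1 : R).

Definition path_set : set (prod_topology (fun i => discrete_topology (bedge B i))) :=
  [set x | forall i, brng (x i : bedge B i) = bsrc (x i.+1 : bedge B i.+1)].

(* The induced product topology is generated by the cylinder sets. *)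
Definition path_space : topologicalType := set_type path_set.

Definition path_edge (x : path_space) (i : nat) : bedge B i := set_val x i.

End Bratteli.

(* The linear orders on the fibres of [brng] are given as one relation, under
   which two edges are comparable exactly when they have the same range. *)
Record ordered_bratteli := OrderedBratteli {
  odiag :> bratteli_diagram;
  ble : forall i, rel (bedge odiag i);
  ble_refl : forall i, reflexive (@ble i);
  ble_anti : forall i, antisymmetric (@ble i);
  ble_trans : forall i, transitive (@ble i);
  ble_total : forall i (e f : bedge odiag i),
    (ble e f || ble f e) = (brng e == brng f) }.

Section Vershik.
Variable B : ordered_bratteli.

Definition minimal_edge i (e : bedge B i) : Prop :=
  forall f : bedge B i, brng f = brng e -> ble e f.

Definition maximal_edge i (e : bedge B i) : Prop :=
  forall f : bedge B i, brng f = brng e -> ble f e.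

Definition successor_edge i (e f : bedge B i) : Prop :=
  [/\ ble e f, f <> e &
      forall g : bedge B i, ble e g -> g <> e -> ble f g].

Definition minimal_path (x : path_space B) : Prop :=
  forall i, minimal_edge (path_edge x i).

Definition maximal_path (x : path_space B) : Prop :=
  forall i, maximal_edge (path_edge x i).

Definition properly_ordered : Prop :=
  [/\ simple_diagram B,
      exists! x : path_space B, minimal_path x &
      exists! x : path_space B, maximal_path x].

(* For a properly ordered diagram exactly one map satisfies this: a path of
   minimal edges is determined by its final vertex (see
   [vershik_map_unique]). *)
Definition is_vershik_map (V : path_space B -> path_space B) : Prop :=
  (forall x, maximal_path x -> minimal_path (V x)) /\
  forall x k,
    (forall j, (j < k)%N -> maximal_edge (path_edge x j)) ->
    ~ maximal_edge (path_edge x k) ->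
    [/\ forall j, (j < k)%N -> minimal_edge (path_edge (V x) j),
        successor_edge (path_edge x k) (path_edge (V x) k) &
        forall j, (k < j)%N -> path_edge (V x) j = path_edge x j].

Lemma vershik_map_unique (V W : path_space B -> path_space B) :
  properly_ordered -> is_vershik_map V -> is_vershik_map W -> V =1 W.
Proof.
case=> _ [xm [_ uxm]] _ [Vmax Vk] [Wmax Wk] x.
have [xmax|nxmax] := pselect (maximal_path x).
  by rewrite -(uxm _ (Vmax _ xmax)) -(uxm _ (Wmax _ xmax)).
have [k [xk kmin]] : exists k, ~ maximal_edge (path_edge x k) /\
    forall j, (j < k)%N -> maximal_edge (path_edge x j).
  have /existsNP ex : ~ forall k, maximal_edge (path_edge x k) by [].
  pose P k := ~~ `[< maximal_edge (path_edge x k) >].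
  have eP : exists k, P k by case: ex => k xk; exists k; apply/asboolPn.
  case: (ex_minnP eP) => k /asboolPn xk mk; exists k; split => // j jk.
  apply: contrapT => xj.
  by have := mk j (introT (asboolPn _) xj); rewrite leqNgt jk.
have [Vlt [V1 V2 V3] Vgt] := Vk x k kmin xk.
have [Wlt [W1 W2 W3] Wgt] := Wk x k kmin xk.
have eqk : path_edge (V x) k = path_edge (W x) k.
  by apply: (@ble_anti B k); rewrite V3 // W3.
have pathE (y : path_space B) i :
    brng (path_edge y i) = bsrc (path_edge y i.+1).
  by rewrite /path_edge; have := set_mem (valP y); exact.
have eqlt d : (d <= k)%N -> path_edge (V x) (k - d) = path_edge (W x) (k - d).
  elim: d => [|d IHd] dk; first by rewrite subn0.
  have jk : (k - d.+1 < k)%N by rewrite ltn_subrL (leq_ltn_trans _ dk).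
  have := IHd (ltnW dk); rewrite -subSS subSn // => eqS.
  have rngE : brng (path_edge (V x) (k - d.+1)) =
              brng (path_edge (W x) (k - d.+1)) by rewrite !pathE eqS.
  by apply: (@ble_anti B); rewrite (Vlt _ jk _ (esym rngE)) (Wlt _ jk _ rngE).
apply/val_inj/functional_extensionality_dep => j.
change (path_edge (V x) j = path_edge (W x) j).
have [jk|kj|->//] := ltngtP j k; last by rewrite Vgt // Wgt.
by rewrite -(subKn (ltnW jk)); apply: eqlt; rewrite leq_subr.
Qed.

Definition bratteli_vershik_representation (X : topologicalType)
    (T : homeomorphism X X) : Prop :=
  [/\ properly_ordered,
      infinite_set [set: path_space B] &
      exists V : path_space B -> path_space B,
        is_vershik_map V /\ conjugate V T].

End Vershik.

Definition pseudo_Toeplitz (R : realType) (A : finType) (Y : subshift A) : Prop :=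
  minimal_cantor_system (subshift_system Y) /\
  exists B : ordered_bratteli,
    bratteli_vershik_representation B (subshift_system Y) /\ pseudo_ERS B R.

(* Main.v *)
(* Take Kakutani-Rokhlin partitions of (X, T) refining each other and shrinking to
   a point x0, and cut every tower of level i + 1 into pieces that visit each tower
   of level i almost equally often and have height close to a prescribed N_i. A
   piece is labelled by its visit counts together with a residue j < K_i. The
   labels become the vertices of a new diagram; all path counts at a level lie in a
   short interval around N_i, so it is pseudo-ERS. Passing from towers to labels
   changes the order in which a tower is read, but neither the tail equivalence nor
   the minimal and maximal paths, hence it yields a strong orbit equivalence.

   The order of the edges into a vertex is ours to choose. The lower labels
   come in blocks of K_i residues; each block leaves (K_i - 2)! orders free, enough
   to give distinct labels distinct words, while the pattern 0, K_i - 1 is used only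
   at the beginning of a word. So words can be recognised locally and the system is
   a subshift, with about K_i words of length close to N_i. Choosing K_i slightly
   above both g_l and alpha^l for l near N_i, but below (alpha + o(1))^N_i, gives
   (2) and (3). *)

Require Import Defs.
From mathcomp Require Import all_boot all_order all_algebra.
From mathcomp Require Import all_classical all_reals.
From mathcomp Require Import topology ereal normedtype sequences exp cantor.
From mathcomp Require Import zify lra.
Import Order.TTheory GRing.Theory Num.Theory.
Import numFieldNormedType.Exports.

Set Implicit Arguments.
Unset Strict Implicit.
Unset Printing Implicit Defensive.

Local Open Scope classical_set_scope.
Local Open Scope ring_scope.

(** The pieces of a tower are not intervals of time: for each lower tower separately, the visits to
    it are dealt out over the pieces, as evenly as rounding permits. This is harmless, since strong
    orbit equivalence only sees which points share their later towers, and where [x0] and its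
    predecessor go.

    The obstacle is that exponentially many labels need distinct words. A word of level i + 1 has
    about N_{i+1} / (K_i N_i) blocks with (K_i - 2)! orders each, so the orders grow with N_{i+1} at
    rate log (K_i - 2)! / (K_i N_i), roughly log(K_i) / N_i. Hence a chain of rates, with a =
    log(alpha): the labels of level i grow at rate at most a + 1/(i+1), while K_i is so large that
    the orders reach rate a + 1/(i+2), which is what the labels of level i + 1 require. The gap
    between the two rates absorbs polynomial factors. Thus the size of K_i that raises the
    complexity also keeps the next level recognisable, and N_i, K_i are fixed after the partition of
    level i but before its refinement. *)

(** * Locally constant maps and compactness *)

(** Continuity for the discrete topology on [I], without giving [I] a topology; so [I] may be [nat],
    [bool] or a type of sequences. *)
Definition loc_const (X : topologicalType) (I : Type) (f : X -> I) : Prop :=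
  forall x : X, \forall y \near x, f y = f x.

Lemma loc_const_cst (X : topologicalType) (I : Type) (c : I) :
  loc_const (fun _ : X => c).
Proof. by move=> x; apply: nearW. Qed.

Lemma loc_const_comp (X : topologicalType) (I J : Type) (g : I -> J)
    (f : X -> I) : loc_const f -> loc_const (fun x => g (f x)).
Proof. by move=> lf x; move: (lf x); apply: filterS => y ->. Qed.

Lemma loc_const2 (X : topologicalType) (I J K : Type) (op : I -> J -> K)
    (f : X -> I) (g : X -> J) :
  loc_const f -> loc_const g -> loc_const (fun x => op (f x) (g x)).
Proof.
move=> lf lg x; move: (lf x) (lg x).
by apply: filterS2 => y -> ->.
Qed.

Lemma loc_const_dep (X : topologicalType) (I J : Type) (f : X -> I)
    (g : I -> X -> J) :
  loc_const f -> (forall i, loc_const (g i)) -> loc_const (fun x => g (f x) x).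
Proof.
move=> lf lg x; move: (lf x) (lg (f x) x).
by apply: filterS2 => y -> ->.
Qed.

Lemma loc_const_mkseq (X : topologicalType) (I : Type) (f : nat -> X -> I) n :
  (forall i, (i < n)%N -> loc_const (f i)) ->
  loc_const (fun x => mkseq (f^~ x) n).
Proof.
elim: n => [|n IHn] lf; first exact: loc_const_cst.
have -> : (fun x => mkseq (f^~ x) n.+1) =
    (fun x => rcons (mkseq (f^~ x) n) (f n x)).
  apply/funext => x; exact: mkseqS.
apply: loc_const2; last exact: lf.
by apply: IHn => i /ltnW; exact: lf.
Qed.

Lemma loc_const_precomp (X Y : topologicalType) (I : Type) (h : X -> Y)
    (f : Y -> I) : continuous h -> loc_const f -> loc_const (fun x => f (h x)).
Proof. by move=> ch lf x; exact: (ch x _ (lf (h x))). Qed.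

Lemma loc_const_clopen (X : topologicalType) (P : X -> bool) :
  loc_const P -> open [set x | P x] /\ closed [set x | P x].
Proof.
move=> lP; split; first by rewrite openE => x /= Px; move: (lP x); apply: filterS => y /= ->.
rewrite -[X in closed X]setCK; apply: open_closedC.
by rewrite openE => x /= Px; move: (lP x); apply: filterS => y /= ->.
Qed.

Lemma near_coord (I : choiceType) (K : I -> choiceType)
    (x : prod_topology (fun i => discrete_topology (K i))) (i : I) :
  \forall y \near x, y i = x i.
Proof.
exact: (@proj_continuous I (fun i => discrete_topology (K i)) i x
          _ (discrete_set1 (x i))).
Qed.

Lemma continuous_coords (X : topologicalType) (I : choiceType)
    (K : I -> choiceType)
    (f : X -> prod_topology (fun i => discrete_topology (K i))) :
  (forall i, loc_const (fun x => f x i)) -> continuous f.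
Proof.
move=> lf x; apply/(@cvg_sup _ I (fun i => Topological.class
  (initial_topology (fun g : forall i, discrete_topology (K i) => g i)))).
move=> k U [_ [[W oW <-]] /= Wx sWU].
move: (lf k x); apply: filterS => y fy; apply: sWU; rewrite /=.
by move: Wx; rewrite /= -fy.
Qed.

Lemma near_val_coord (I : choiceType) (K : I -> choiceType)
    (A : set (prod_topology (fun i => discrete_topology (K i))))
    (x : set_type A) (i : I) :
  \forall y \near x, set_val y i = set_val x i.
Proof.
exact: (@initial_continuous A _ set_val x _ (near_coord (set_val x) i)).
Qed.

Lemma loc_const_hausdorff (X : topologicalType) (I : Type) (K : I -> Type)
    (c : forall i, X -> K i) :
  (forall i, loc_const (c i)) ->
  (forall x y, (forall i, c i x = c i y) -> x = y) -> hausdorff_space X.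
Proof.
move=> lc sep x y xy; apply: sep => i.
by have [z [/= <- <-]] := xy _ _ (lc i x) (lc i y).
Qed.

Lemma loc_const_finite (X : topologicalType) (I : eqType) (f : X -> I) :
  compact [set: X] -> loc_const f -> exists s : seq I, forall x, f x \in s.
Proof.
move=> /compact_near_coveringP cX lf.
(* The filter of all finite lists that are large for inclusion: near-covering compactness along it
   merges the local values into one list. *)
pose F : set_system (seq I) :=
  [set A | exists s0 : seq I, forall s, {subset s0 <= s} -> A s].
have FF : Filter F.
  constructor.
  - by exists [::].
  - move=> A B [s0 s0A] [s1 s1B]; exists (s0 ++ s1) => s ss; split.
      by apply: s0A => i si; apply: ss; rewrite mem_cat si.
    by apply: s1B => i si; apply: ss; rewrite mem_cat si orbT.
  - by move=> A B AB [s0 s0A]; exists s0 => s /s0A /AB.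
have [x _|s0 cs0] := cX _ F (fun s x => f x \in s) FF.
  exists ([set y | f y = f x], [set s | f x \in s]).
    by split; [exact: lf|exists [:: f x] => s; apply; rewrite mem_head].
  by move=> [y s] /= [-> ].
by exists s0 => x; exact: (cs0 s0 (fun i h => h) x Logic.I).
Qed.

(** Cantor's intersection theorem: were the intersection empty, each point would have a
    neighbourhood outside [F n] from some index on, and compactness makes this index uniform. *)
Lemma compact_decreasing (X : topologicalType) (F : nat -> X -> bool) :
  compact [set: X] -> (forall n, loc_const (F n)) ->
  (forall m n x, (m <= n)%N -> F n x -> F m x) -> (forall n, exists x, F n x) ->
  exists x, forall n, F n x.
Proof.
move=> /compact_near_coveringP cX lF dF eF; apply: contrapT => nF.
have [x _|N _ cN] := cX _ \oo (fun n x => ~~ F n x) _.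
  have /existsNP [n /negP Fnx] : ~ forall n, F n x by move=> h; apply: nF; exists x.
  exists ([set y | F n y = F n x], [set m | (n <= m)%N]).
    by split; [exact: lF|exists n].
  move=> [y m] /= [Fy nm]; apply: contra Fnx => Fmy; rewrite -Fy.
  exact: dF Fmy.
have [x Fx] := eF N; have := cN N (leqnn N) x Logic.I.
by rewrite /= Fx.
Qed.

Lemma bij_inv_continuous (X Y : topologicalType) (f : X -> Y) (g : Y -> X) :
  compact [set: X] -> hausdorff_space Y -> continuous f ->
  cancel f g -> cancel g f -> continuous g.
Proof.
move=> cX hY cf fK gK; apply/continuous_closedP => A cA.
have -> : g @^-1` A = f @` A.
  rewrite eqEsubset; split => y /=.
    by move=> Agy; exists (g y); rewrite ?gK.
  by move=> [x Ax <-]; rewrite fK.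
apply: compact_closed => //; apply: continuous_compact.
  exact: continuous_subspaceT.
exact: (subclosed_compact cA cX).
Qed.

Lemma compact_bij_homeo (X Y : topologicalType) (f : X -> Y) :
  compact [set: X] -> hausdorff_space Y -> continuous f ->
  (forall x x', f x = f x' -> x = x') -> (forall y, exists x, f x = y) ->
  exists h : homeomorphism X Y, forall x, h x = f x.
Proof.
move=> cX hY cf injf surjf.
pose g y := projT1 (cid (surjf y)).
have gK : cancel g f by move=> y; rewrite /g; case: cid.
have fK : cancel f g by move=> x; apply: injf; rewrite gK.
by exists (Homeomorphism fK gK cf (bij_inv_continuous cX hY cf fK gK)).
Qed.

Definition homeo_comp (X Y Z : topologicalType) (f : homeomorphism X Y)
    (g : homeomorphism Y Z) : homeomorphism X Z.
Proof.
apply: (@Homeomorphism X Z (g \o f) (homeo_inv f \o homeo_inv g)).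
- by move=> x /=; rewrite !homeo_funK.
- by move=> x /=; rewrite !homeo_invK.
- move=> x; apply: continuous_comp; exact: homeo_fun_continuous.
- move=> x; apply: continuous_comp; exact: homeo_inv_continuous.
Defined.

Definition homeo_sym (X Y : topologicalType) (f : homeomorphism X Y) :
  homeomorphism Y X := Homeomorphism (homeo_invK f) (homeo_funK f)
    (homeo_inv_continuous (h:=f)) (homeo_fun_continuous (h:=f)).

Lemma homeo_inj (X Y : topologicalType) (f : homeomorphism X Y) (x y : X) :
  f x = f y -> x = y.
Proof. by move=> fxy; rewrite -(homeo_funK f x) fxy homeo_funK. Qed.

Lemma homeo_compact (X Y : topologicalType) (f : homeomorphism X Y) :
  compact [set: X] -> compact [set: Y].
Proof.
move=> cX; have -> : [set: Y] = f @` [set: X].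
  by rewrite eqEsubset; split => // y _; exists (homeo_inv f y); rewrite ?homeo_invK.
apply: continuous_compact => //; apply: continuous_subspaceT.
exact: (@homeo_fun_continuous _ _ f).
Qed.

(** * Integer iterates and conjugacies *)

Section IterZ.
Variables (X : topologicalType) (T : homeomorphism X X).

Lemma iterZS (m : int) x : iterZ T (m + 1) x = T (iterZ T m x).
Proof.
case: m => n; first by rewrite -PoszD addn1.
case: n => [|n]; first by rewrite /= homeo_invK.
have -> : Negz n.+1 + 1 = Negz n by lia.
by rewrite /= homeo_invK.
Qed.

Lemma iterZP (m : int) x : iterZ T (m - 1) x = homeo_inv T (iterZ T m x).
Proof. by rewrite -[in RHS](subrK 1 m) iterZS homeo_funK. Qed.

Lemma iterZD (m n : int) x : iterZ T (m + n) x = iterZ T m (iterZ T n x).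
Proof.
have iterZDn (k : nat) : iterZ T (k%:Z + n) x = iterZ T k (iterZ T n x).
  elim: k => [|k IHk]; first by rewrite add0r.
  by rewrite -addn1 PoszD addrAC iterZS IHk -iterZS.
have iterZBn (k : nat) : iterZ T (- k%:Z + n) x = iterZ T (- k%:Z) (iterZ T n x).
  elim: k => [|k IHk]; first by rewrite add0r.
  by rewrite -addn1 PoszD opprD addrAC iterZP IHk -iterZP.
by case: m => k //; rewrite NegzE; exact: iterZBn.
Qed.

Lemma iterZ_nat (n : nat) x : iterZ T n%:Z x = iter n T x.
Proof. by []. Qed.

Lemma iterZN (n : nat) x : iterZ T (- n%:Z) x = iter n (homeo_inv T) x.
Proof. by case: n => [|n] //; rewrite -NegzE. Qed.

Lemma iterZK m : cancel (iterZ T m) (iterZ T (- m)).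
Proof. by move=> x; rewrite -iterZD addNr. Qed.

Lemma iterK n : cancel (iter n T) (iter n (homeo_inv T)).
Proof. by move=> x; rewrite -iterZN -iterZ_nat iterZK. Qed.

Lemma iterKV n : cancel (iter n (homeo_inv T)) (iter n T).
Proof. by move=> x; rewrite -iterZN -iterZ_nat -iterZD subrr. Qed.

Lemma iter_continuous n : continuous (iter n T : X -> X).
Proof.
elim: n => [|n IHn] x /=; first exact: cvg_id.
apply: continuous_comp; [exact: IHn|exact: homeo_fun_continuous].
Qed.

End IterZ.

Lemma iter_inv_continuous (X : topologicalType) (T : homeomorphism X X) n :
  continuous (iter n (homeo_inv T) : X -> X).
Proof. exact: (@iter_continuous X (homeo_sym T) n). Qed.

Lemma iterZ_continuous (X : topologicalType) (T : homeomorphism X X) m :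
  continuous (iterZ T m).
Proof. by case: m => n; [exact: iter_continuous|exact: iter_inv_continuous]. Qed.

Lemma iterZ_conj (X Y : topologicalType) (T : homeomorphism X X)
    (S : homeomorphism Y Y) (f : X -> Y) :
  (forall x, f (T x) = S (f x)) -> forall m x, f (iterZ T m x) = iterZ S m (f x).
Proof.
move=> fT; have fTV x : f (homeo_inv T x) = homeo_inv S (f x).
  by rewrite -{2}(homeo_invK T x) fT homeo_funK.
case=> n x; elim: n => [|n IHn] //.
- by rewrite /= fT; congr (S _); exact: IHn.
- exact: fTV.
- by rewrite /= fTV; congr (homeo_inv S _); exact: IHn.
Qed.

Lemma orbit_conj (X Y : topologicalType) (T : homeomorphism X X)
    (S : homeomorphism Y Y) (f : X -> Y) :
  (forall x, f (T x) = S (f x)) -> forall x : X, f @` Defs.orbit T x = Defs.orbit S (f x).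
Proof.
move=> fT x; rewrite eqEsubset; split.
  by move=> _ [_ [m _ <-] <-]; exists m => //=; rewrite (iterZ_conj fT).
move=> _ [m _ <-]; exists (iterZ T m x); first by exists m.
by rewrite (iterZ_conj fT).
Qed.

(** * Strong orbit equivalence from matching tail relations *)

(* [R n x y] reads: [x] and [y] lie in the same level-[n] tower of a refining
   sequence of tower partitions of [(X, T)], at heights [tau n x], [tau n y], and
   stay together in all later towers; [up n x] reads: [x] is not at the top of its
   level-[n] tower. The orbit of [xm] is the only one broken by the towers. *)
Record tail_structure (X : topologicalType) (T : homeomorphism X X)
    (R : nat -> X -> X -> Prop) (tau : nat -> X -> nat)
    (up : nat -> X -> bool) (xm : X) : Prop := TailStructure {
  tail_tau : forall n, loc_const (tau n);
  tail_up : forall n, loc_const (up n);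
  tail_iter : forall n x y, R n x y ->
    y = iterZ T ((tau n y)%:Z - (tau n x)%:Z) x;
  tail_step : forall n x, up n x -> R n x (T x);
  tail_top : forall n, up n xm = false;
  tail_break : forall x, x <> xm -> exists n, up n x }.

Section TailEquivalence.
Variables (X Y : topologicalType).
Variables (T : homeomorphism X X) (S : homeomorphism Y Y).
Variables (R : nat -> X -> X -> Prop) (tau : nat -> X -> nat).
Variables (up : nat -> X -> bool) (xm : X).
Variables (R' : nat -> Y -> Y -> Prop) (tau' : nat -> Y -> nat).
Variables (up' : nat -> Y -> bool) (ym : Y).
Hypothesis tT : tail_structure T R tau up xm.
Hypothesis tS : tail_structure S R' tau' up' ym.
Variable phi : homeomorphism X Y.

(** Away from [xm] the least level [n] with [up n x] is locally constant. There [x] and [T x] are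
    related, so the cocycle is the difference of the heights [tau'] of their images at level [k n].
    Only at [xm], where no level works, can it jump; there its value is 1. *)
Lemma tail_cocycle (k : nat -> nat) :
  (forall n x y, R n x y -> R' (k n) (phi x) (phi y)) ->
  phi (T xm) = S (phi xm) ->
  exists n1 : X -> int,
    (forall x, phi (T x) = iterZ S (n1 x) (phi x)) /\
    (forall x, x <> xm -> \forall y \near x, n1 y = n1 x).
Proof.
move=> RR' phim.
have hup x : x <> xm -> exists n, up n x by exact: (tail_break tT).
pose lev x := if pselect (x <> xm) is left h then ex_minn (hup x h) else 0%N.
pose c n x := (tau' (k n) (phi (T x)))%:Z - (tau' (k n) (phi x))%:Z.
have lc n : loc_const (c n).
  have l1 : loc_const (fun x => tau' (k n) (phi (T x))).
    apply: (@loc_const_precomp _ _ _ (phi \o T)); last exact: (tail_tau tS).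
    by move=> x; apply: continuous_comp; exact: homeo_fun_continuous.
  have l2 : loc_const (fun x => tau' (k n) (phi x)).
    apply: loc_const_precomp; last exact: (tail_tau tS).
    exact: homeo_fun_continuous.
  exact: (loc_const2 (fun a b : nat => a%:Z - b%:Z) l1 l2).
exists (fun x => if x == xm then 1 else c (lev x) x); split => [x|x xxm].
  case: eqP => [->|xxm]; first exact: phim.
  rewrite /lev; case: pselect => // h; case: ex_minnP => n nx _.
  exact: (tail_iter tS (RR' _ _ _ (tail_step tT nx))).
have [n nx nmin] : exists2 n, up n x & forall m, up m x -> (n <= m)%N.
  by case: (ex_minnP (hup x xxm)) => n nx nmin; exists n.
have upx : \forall y \near x, forall m, (m < n.+1)%N -> up m y = up m x.
  have := @loc_const_mkseq X bool up n.+1 (fun i _ => tail_up tT i) x.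
  apply: filterS => y e m mn.
  by have := congr1 (fun s => nth false s m) e; rewrite !nth_mkseq.
move: upx (lc n x); apply: filterS2 => y uy cy.
have uny : up n y by rewrite uy.
have yxm : y <> xm by move=> yE; move: uny; rewrite yE (tail_top tT).
have levE z : z <> xm -> up n z -> (forall m, (m < n)%N -> up m z = false) ->
    lev z = n.
  move=> zxm unz um; rewrite /lev; case: pselect => // h.
  case: ex_minnP => m mz /(_ _ unz) mn; apply/eqP; rewrite eqn_leq mn /=.
  by rewrite leqNgt; apply/negP => /um; rewrite mz.
have ux m : (m < n)%N -> up m x = false.
  by move=> mn; apply: contraTF mn => /nmin; rewrite leqNgt.
rewrite !ifF ?(levE x) ?(levE y) //; try by apply/eqP.
by move=> m mn; rewrite uy ?ux // ltnS ltnW.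
Qed.

End TailEquivalence.

(** The forward cocycle suffices: a backward step at [z] undoes a forward step at the preimage of
    [z]. *)
Lemma tail_orbit (X Y : topologicalType) (T : homeomorphism X X)
    (S : homeomorphism Y Y) (phi : X -> Y) (n1 : X -> int) :
  (forall x, phi (T x) = iterZ S (n1 x) (phi x)) ->
  forall x : X, phi @` Defs.orbit T x `<=` Defs.orbit S (phi x).
Proof.
move=> phiT x _ [_ [m _ <-] <-].
have aux z : Defs.orbit S (phi x) (phi z) ->
    Defs.orbit S (phi x) (phi (T z)) /\ Defs.orbit S (phi x) (phi (homeo_inv T z)).
  move=> [a _ az]; split.
    by exists (n1 z + a) => //; rewrite phiT -az; exact: iterZD.
  exists (- n1 (homeo_inv T z) + a) => //; rewrite iterZD az.
  by have := phiT (homeo_inv T z); rewrite homeo_invK => ->; exact: iterZK.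
have o0 : Defs.orbit S (phi x) (phi x) by exists 0.
case: m => n; elim: n => [|n IHn] //.
- exact: (aux _ IHn).1.
- exact: (aux _ o0).2.
- exact: (aux _ IHn).2.
Qed.

(** Relabelling mixes adjacent levels, so the two relations match only up to a shift of the level by
    one. The second cocycle is that of the inverse of [phi], evaluated at [phi x]; its only bad
    point [ym] is [phi xm]. *)
Lemma tail_strong_orbit_equivalent (X Y : topologicalType)
    (T : homeomorphism X X) (S : homeomorphism Y Y) R tau up xm R' tau' up' ym
    (phi : homeomorphism X Y) :
  tail_structure T R tau up xm -> tail_structure S R' tau' up' ym ->
  (forall n x y, R n x y -> R' n.+1 (phi x) (phi y)) ->
  (forall n x y, R' n.+1 (phi x) (phi y) -> R n.+1 x y) ->
  (forall n x y, R' n x y -> R' n.+1 x y) ->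
  phi xm = ym -> phi (T xm) = S ym ->
  strong_orbit_equivalent T S.
Proof.
move=> tT tS RR' R'R R'S phim phiTm.
have [|n1 [n1E n1c]] := tail_cocycle tT tS (phi := phi) RR'.
  by rewrite phim.
have R'R1 n x y : R' n x y -> R n.+1 (homeo_sym phi x) (homeo_sym phi y).
  by move=> Rxy; apply: R'R; rewrite /= !homeo_invK; exact: R'S.
have [|n2 [n2E n2c]] := tail_cocycle tS tT (phi := homeo_sym phi) R'R1.
  by rewrite /= -phiTm -phim !homeo_funK.
exists phi; split.
  move=> x; rewrite eqEsubset; split; first exact: tail_orbit n1E x.
  move=> y oy; exists (homeo_inv phi y); last by rewrite homeo_invK.
  have := tail_orbit n2E (x := phi x); rewrite /= homeo_funK; apply.
  by exists y.
exists n1, (n2 \o phi); split => //.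
- move=> x /=; have := n2E (phi x); rewrite /= homeo_funK => <-.
  by rewrite homeo_invK.
- have aux x : ~ {for x, continuous (n1 : X -> discrete_topology int)} -> x = xm.
    by apply: contra_notP => xxm; apply/discrete_cvg; exact: n1c.
  by move=> x y /aux -> /aux ->.
- have aux x : ~ {for x, continuous (n2 \o phi : X -> discrete_topology int)} ->
      x = xm.
    apply: contra_notP => xxm; apply/discrete_cvg.
    have pxm : phi x <> ym by rewrite -phim => /homeo_inj.
    exact: (@homeo_fun_continuous _ _ phi x _ (n2c _ pxm)).
  by move=> x y /aux -> /aux ->.
Qed.

(** * Refining sequences of Kakutani-Rokhlin partitions *)

Lemma loc_const_first (X : topologicalType) (P : nat -> X -> bool)
    (ex : forall x, exists n, P n x) :
  (forall n, loc_const (P n)) -> loc_const (fun x => ex_minn (ex x)).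
Proof.
move=> lP x; case: (ex_minnP (ex x)) => n nx nmin.
have := @loc_const_mkseq X bool P n.+1 (fun i _ => lP i) x.
apply: filterS => y e.
have Py m : (m <= n)%N -> P m y = P m x.
  by move=> mn; have := congr1 (nth false ^~ m) e; rewrite !nth_mkseq.
case: ex_minnP => m my mmin; apply/eqP; rewrite eqn_leq mmin ?Py //=.
rewrite leqNgt; apply/negP => mn; have := nmin m.
by rewrite -(Py m (ltnW mn)) my leqNgt mn => /(_ isT).
Qed.

Section TowerPartitions.
Variables (X : topologicalType) (T : homeomorphism X X).
Variable hX : homeomorphism X cantor_space.
Hypothesis minT : forall x : X, dense (Defs.orbit T x).
Variable x0 : X.
Local Notation TV := (homeo_inv T).

Definition coord (i : nat) (x : X) : bool := hX x i.

Lemma loc_const_coord i : loc_const (coord i).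
Proof.
apply: (@loc_const_precomp X cantor_space bool hX (fun y => y i)).
  exact: homeo_fun_continuous.
by move=> y; exact: (@proj_continuous nat (fun=> bool) i y _ (discrete_set1 (y i))).
Qed.

Lemma coord_inj x y : (forall i, coord i x = coord i y) -> x = y.
Proof. by move=> e; apply: (homeo_inj (f := hX)); apply/funext. Qed.

Lemma cantor_compact : compact [set: X].
Proof. exact: (homeo_compact (homeo_sym hX) cantor_space_compact). Qed.

Lemma loc_const_iter (I : Type) (f : X -> I) n : loc_const f ->
  loc_const (fun x => f (iter n T x)).
Proof. apply: loc_const_precomp; exact: iter_continuous. Qed.

Lemma loc_const_iterV (I : Type) (f : X -> I) n : loc_const f ->
  loc_const (fun x => f (iter n TV x)).
Proof. apply: loc_const_precomp; exact: iter_inv_continuous. Qed.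

Lemma loc_const_all (Y : topologicalType) (P : nat -> Y -> bool) (s : seq nat) :
  (forall n, loc_const (P n)) -> loc_const (fun x => all (P ^~ x) s).
Proof.
move=> lP; elim: s => [|n s IHs]; first exact: loc_const_cst.
exact: (loc_const2 andb (lP n) IHs).
Qed.

Lemma orbit_meets (P : X -> bool) : loc_const P -> (exists x, P x) ->
  forall x, exists m, P (iterZ T m x).
Proof.
move=> lP [y Py] x; have [oP _] := loc_const_clopen lP.
have [|z [/= Pz [m _ zE]]] := minT x _ oP; first by exists y.
by exists m; rewrite zE.
Qed.

(** Otherwise [P] is avoided on arbitrarily long orbit segments, hence by compactness on a full
    orbit, against density. The segments are centred because density concerns full orbits; starting
    at [iter n T x] makes them forward. *)
Lemma syndetic (P : X -> bool) : loc_const P -> (exists x, P x) ->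
  exists G, forall x, exists2 j, (j < G)%N & P (iter j T x).
Proof.
move=> lP exP.
pose F n x := all (fun j => ~~ P (iterZ T (j%:Z - n%:Z) x)) (iota 0 (2 * n).+1).
have [n nF] : exists n, forall x, ~~ F n x.
  apply: contrapT => nF.
  have [|||x Fx] := @compact_decreasing X F cantor_compact.
  - move=> n; apply: (@loc_const_all X (fun j x => ~~ P (iterZ T (j%:Z - n%:Z) x))).
    move=> j; apply: (@loc_const_precomp X X bool (iterZ T (j%:Z - n%:Z))
      (fun x => ~~ P x)); first exact: iterZ_continuous.
    exact: (loc_const_comp negb lP).
  - move=> m n x mn /allP Fx; apply/allP => j; rewrite mem_iota => /andP[_ hj].
    have := Fx (j + (n - m))%N; rewrite mem_iota.
    have -> : ((j + (n - m))%N%:Z - n%:Z = j%:Z - m%:Z :> int)%R by lia.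
    by apply; lia.
  - move=> n; apply: contrapT => h; apply: nF; exists n => x.
    by apply/negP => Fx; apply: h; exists x.
  - have [m Pm] := orbit_meets lP exP x.
    have /allP /(_ (absz (m + (absz m)%:Z)%R)) := Fx (absz m).
    rewrite mem_iota => /(_ ltac:(lia)).
    have -> : ((absz (m + (absz m)%:Z)%R)%:Z - (absz m)%:Z = m :> int)%R by lia.
    by rewrite Pm.
exists (2 * n).+1 => x; have /allPn[j] := nF (iterZ T n x).
rewrite mem_iota negbK -iterZD subrK => /andP[_ jn] Pj.
by exists j.
Qed.

(** A periodic orbit is finite and dense, hence the whole space, which has too many points. *)
Lemma aperiodic n x : (0 < n)%N -> iter n T x <> x.
Proof.
move=> n0 per.
have perZ (m : int) : exists2 j, (j < n)%N & iterZ T m x = iter j T x.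
  have perk k : iterZ T (k * n%:Z) x = x.
    have pn (a : nat) : iterZ T (a%:Z * n%:Z) x = x.
      elim: a => [|a IHa]; first by rewrite mul0r.
      by rewrite -addn1 PoszD mulrDl mul1r iterZD iterZ_nat per.
    case: k => a; first exact: pn.
    rewrite NegzE mulNr -{1}(pn a.+1) -iterZD; by rewrite addNr.
  exists (absz (m %% n)%Z); first by lia.
  rewrite {1}(divz_eq m n) addrC iterZD perk -iterZ_nat; congr iterZ; lia.
have all_orbit y : exists j : 'I_n, iter j T x = y.
  apply: contrapT => ny.
  have /choice[d dP] : forall j, exists i, (j < n)%N ->
      coord i (iter j T x) <> coord i y.
    move=> j; apply: contrapT => h; have [jn|nj] := ltnP j n; last first.
      by apply: h; exists 0%N; rewrite ltnNge nj.
    apply: ny; exists (Ordinal jn); apply: coord_inj => i.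
    by apply: contrapT => hi; apply: h; exists i.
  (* One separating coordinate per orbit point gives a clopen neighbourhood of [y] that misses the
     finite orbit. *)
  pose P z := all (fun j => coord (d j) z == coord (d j) y) (iota 0 n).
  have lP : loc_const P.
    apply: (@loc_const_all X (fun j z => coord (d j) z == coord (d j) y)) => j.
    exact: (loc_const_comp (fun b => b == _) (@loc_const_coord (d j))).
  have [|m] := orbit_meets lP _ x; first by exists y; apply/allP => j.
  have [j jn ->] := perZ m => /allP /(_ j); rewrite mem_iota /= => /(_ jn) /eqP.
  exact: dP.
(* Pigeonhole on the [n.+1] indicator sequences of single indices. *)
have /choice[f fP] := fun k : 'I_n.+1 =>
  all_orbit (homeo_inv hX (fun i => i == k :> nat)).
have finj : injective f.
  move=> k k' e; have := fP k; rewrite e fP => /(congr1 hX).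
  rewrite !homeo_invK => /(congr1 (fun g : cantor_space => g k)) /=.
  by rewrite eqxx => /eqP/val_inj.
by have := leq_card f finj; rewrite !card_ord ltnn.
Qed.

(** A partition is given by the tower number and the height of each point instead of by its cells,
    so that clopenness of the cells becomes local constancy of two functions. *)
Record towers := Towers {
  tw_ix : X -> nat; tw_pos : X -> nat; tw_num : nat; tw_ht : nat -> nat }.

Record tower_partition (p : towers) : Prop := TowerPartition {
  tp_ix_lc : loc_const (tw_ix p);
  tp_pos_lc : loc_const (tw_pos p);
  tp_ix_lt : forall x, (tw_ix p x < tw_num p)%N;
  tp_pos_lt : forall x, (tw_pos p x < tw_ht p (tw_ix p x))%N;
  tp_up : forall x, ((tw_pos p x).+1 < tw_ht p (tw_ix p x))%N ->
    tw_ix p (T x) = tw_ix p x /\ tw_pos p (T x) = (tw_pos p x).+1;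
  tp_top : forall x, (tw_pos p x).+1 = tw_ht p (tw_ix p x) -> tw_pos p (T x) = 0%N;
  tp_base : forall u, (u < tw_num p)%N -> exists x, tw_ix p x = u /\ tw_pos p x = 0%N;
  tp_x0 : tw_pos p x0 = 0%N }.

(* All bases of the finer partition lie in the base of the tower of [x0], and all
   its tops in the tower of [T^-1 x0]: this makes the minimal and maximal paths
   unique. *)
Record refines (i H : nat) (p q : towers) : Prop := Refines {
  rf_cell : forall x y, tw_ix q x = tw_ix q y -> tw_pos q x = tw_pos q y ->
    [/\ tw_ix p x = tw_ix p y, tw_pos p x = tw_pos p y & coord i x = coord i y];
  rf_base : forall x, tw_pos q x = 0%N ->
    tw_pos p x = 0%N /\ tw_ix p x = tw_ix p x0;
  rf_top : forall x, (tw_pos q x).+1 = tw_ht q (tw_ix q x) ->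
    (tw_pos p x).+1 = tw_ht p (tw_ix p x) /\ tw_ix p x = tw_ix p (TV x0);
  rf_large : forall u, (u < tw_num q)%N -> (H <= tw_ht q u)%N }.

Lemma top_before_x0 p : tower_partition p ->
  (tw_pos p (TV x0)).+1 = tw_ht p (tw_ix p (TV x0)).
Proof.
move=> tp; apply/eqP; rewrite eqn_leq (tp_pos_lt tp) leqNgt /=.
by apply/negP => /(tp_up tp)[_]; rewrite homeo_invK (tp_x0 tp).
Qed.

Section Refinement.
Local Open Scope nat_scope.
Variables (i H : nat) (p : towers).
Hypothesis tp : tower_partition p.

Lemma new_base_ex : exists C : X -> bool, [/\ loc_const C, C x0,
  forall x, C x -> tw_pos p x = 0 /\ tw_ix p x = tw_ix p x0,
  forall x, C x -> (tw_pos p (TV x)).+1 = tw_ht p (tw_ix p (TV x)) /\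
    tw_ix p (TV x) = tw_ix p (TV x0) &
  forall x j, C x -> 0 < j <= H -> ~~ C (iter j T x)].
Proof.
have /choice[d dP] : forall j, exists k,
    0 < j -> coord k x0 <> coord k (iter j T x0).
  move=> j; apply: contrapT => h; have [j0|j0] := posnP j.
    by apply: h; exists 0; rewrite j0.
  apply: (aperiodic j0 (x := x0)); apply: coord_inj => k.
  by apply: contrapT => hk; apply: h; exists k => _ /esym.
(* If [x] and [iter j T x] were both in [C], then [coord (d j)] at [iter j T x] would agree with its
   values at [iter j T x0] and at [x0], which differ. This excludes returns within [H] steps. *)
pose Q j x := (coord (d j) x == coord (d j) x0) &&
  (coord (d j) (iter j T x) == coord (d j) (iter j T x0)).
pose C x := [&& tw_pos p x == 0, tw_ix p x == tw_ix p x0,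
  (tw_pos p (TV x)).+1 == tw_ht p (tw_ix p (TV x)),
  tw_ix p (TV x) == tw_ix p (TV x0) & all (Q ^~ x) (iota 1 H)].
have lTV (I : Type) (f : X -> I) : loc_const f -> loc_const (fun x => f (TV x)).
  exact: (@loc_const_iterV I f 1).
exists C; split.
- apply: (loc_const2 andb); first exact: (loc_const_comp (eq_op^~ 0) (tp_pos_lc tp)).
  apply: (loc_const2 andb).
    exact: (loc_const_comp (eq_op^~ (tw_ix p x0)) (tp_ix_lc tp)).
  apply: (loc_const2 andb).
    apply: (lTV _ (fun x => (tw_pos p x).+1 == tw_ht p (tw_ix p x))).
    exact: (loc_const2 (fun a b => a.+1 == tw_ht p b) (tp_pos_lc tp) (tp_ix_lc tp)).
  apply: (loc_const2 andb).
    apply: (lTV _ (fun x => tw_ix p x == tw_ix p (TV x0))).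
    exact: (loc_const_comp (eq_op^~ _) (tp_ix_lc tp)).
  apply: loc_const_all => j; apply: (loc_const2 andb).
    exact: (loc_const_comp (eq_op^~ _) (@loc_const_coord (d j))).
  apply: (@loc_const_iter _ (fun x => coord (d j) x == coord (d j) (iter j T x0))).
  exact: (loc_const_comp (eq_op^~ _) (@loc_const_coord (d j))).
- rewrite /C (tp_x0 tp) (top_before_x0 tp) !eqxx /=.
  by apply/allP => j _; rewrite /Q !eqxx.
- by move=> x /and5P[/eqP ? /eqP ?].
- by move=> x /and5P[_ _ /eqP ? /eqP ?].
- move=> x j /and5P[_ _ _ _ /allP hx] /andP[j0 jH]; apply/negP.
  move=> /and5P[_ _ _ _ /allP hj].
  have jm : j \in iota 1 H by rewrite mem_iota j0 add1n ltnS.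
  have /andP[_ /eqP e1] := hx j jm; have /andP[/eqP e2 _] := hj j jm.
  by apply: (dP j j0); rewrite -e1 -e2.
Qed.

(** The new towers are the first-return towers over [C], split by the sequence of cells of [p] and
    values of coordinate [i] met before the return. This name numbers the tower, and its length is
    the height. *)
Lemma refine_ex : exists q, tower_partition q /\ refines i H p q.
Proof.
have [C [lC C0 Cb Ct CH]] := new_base_ex.
have [G Gs] := syndetic lC (ex_intro _ x0 C0).
have bex x : exists n, C (iter n TV x).
  have [j jG Cj] := Gs (iter G TV x); exists (G - j).
  by move: Cj; rewrite -{1}(subnKC (ltnW jG)) iterD iterKV.
have fex x : exists n, C (iter n.+1 T x).
  by have [j _ Cj] := Gs (T x); exists j; rewrite iterSr.
pose bk x := ex_minn (bex x); pose rt x := (ex_minn (fex x)).+1.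
have bkC x : C (iter (bk x) TV x) by rewrite /bk; case: ex_minnP.
have bk_min x j : C (iter j TV x) -> bk x <= j.
  by rewrite /bk; case: ex_minnP => n _ h /h.
have rtC x : C (iter (rt x) T x) by rewrite /rt; case: ex_minnP.
have rt_min x j : 0 < j -> C (iter j T x) -> rt x <= j.
  by case: j => // j _; rewrite /rt ltnS; case: ex_minnP => n _ h /h.
have lbk : loc_const bk.
  apply: (loc_const_first (P := fun n x => C (iter n TV x))) => n.
  exact: loc_const_iterV.
have lrt : loc_const rt.
  apply: (loc_const_comp succn); apply: (loc_const_first (P := fun n x => C (iter n.+1 T x))) => n.
  exact: (@loc_const_iter _ C n.+1 lC).
pose base x := iter (bk x) TV x.
pose cell x := (tw_ix p x, tw_pos p x, coord i x).
pose psi b := mkseq (fun j => cell (iter j T b)) (rt b).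
have lcell : loc_const cell.
  apply: (loc_const2 pair); last exact: loc_const_coord.
  exact: (loc_const2 pair (tp_ix_lc tp) (tp_pos_lc tp)).
have lpsi : loc_const psi.
  apply: (loc_const_dep (g := fun n b => mkseq (fun j => cell (iter j T b)) n)) lrt _ => n.
  by apply: (loc_const_mkseq (f := fun j b => cell (iter j T b))) => j _; exact: loc_const_iter.
have lpb : loc_const (fun x => psi (base x)).
  by apply: (loc_const_dep (g := fun n x => psi (iter n TV x))) lbk _ => n; exact: loc_const_iterV.
have [ss sP] := loc_const_finite cantor_compact lpsi.
(* Only names realised on [C] are kept, so that no tower is empty; without repetitions, [index]
   inverts [nth]. *)
pose L := [seq y <- undup ss | `[< exists2 b, C b & psi b = y >]].
have inL x : psi (base x) \in L.
  rewrite mem_filter mem_undup sP andbT; apply/asboolP.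
  by exists (base x) => //; exact: bkC.
have nthL x : nth [::] L (index (psi (base x)) L) = psi (base x) by rewrite nth_index.
have szL x : size (nth [::] L (index (psi (base x)) L)) = rt (base x).
  by rewrite nthL size_mkseq.
have baseK x : iter (bk x) T (base x) = x by rewrite iterKV.
have bk_rt x : bk x < rt (base x).
  rewrite ltnNge; apply/negP => h.
  have r0 : 0 < rt (base x) by [].
  have := rtC (base x); set m := rt (base x) in h r0 *.
  have -> : iter m T (base x) = iter (bk x - m) TV x.
    by rewrite /base -[in LHS](subnKC h) iterD iterKV.
  by move/bk_min; lia.
have bk_C x : C x -> bk x = 0 by move=> Cx; have := @bk_min x 0 Cx; lia.
have bk_up x : (bk x).+1 < rt (base x) -> bk (T x) = (bk x).+1.
  move=> h; apply/eqP; rewrite eqn_leq bk_min ?iterSr ?homeo_funK //=.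
  case E : (bk (T x)) => [|n].
    have := bkC (T x); rewrite E /= -{1}(baseK x) -iterS.
    by move/(rt_min _ _ (ltn0Sn _)); lia.
  by rewrite ltnS; apply: bk_min; have := bkC (T x); rewrite E iterSr homeo_funK.
have base_up x : (bk x).+1 < rt (base x) -> base (T x) = base x.
  by move=> h; rewrite /base bk_up // iterSr homeo_funK.
pose q := Towers (fun x => index (psi (base x)) L) bk (size L)
  (fun u => size (nth [::] L u)).
have qht x : tw_ht q (tw_ix q x) = rt (base x) by exact: szL.
exists q; split; split.
- exact: (loc_const_comp (index ^~ L) lpb).
- exact: lbk.
- by move=> x /=; rewrite index_mem.
- by move=> x; rewrite qht; exact: bk_rt.
- by move=> x; rewrite qht => h /=; rewrite base_up // bk_up.
- move=> x; rewrite qht /= => h; apply: bk_C.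
  by rewrite -(baseK x) -iterS h; exact: rtC.
- move=> u hu; have := mem_nth [::] hu; rewrite mem_filter => /andP[/asboolP[b Cb' e] _].
  exists b; have b0 := bk_C b Cb'; split=> //=.
  by rewrite /base b0 /= e index_uniq // filter_uniq // undup_uniq.
- exact: bk_C.
- move=> x y /= hix hbk; have e : psi (base x) = psi (base y) by rewrite -nthL hix nthL.
  have := congr1 (nth (0, 0, true) ^~ (bk x)) e.
  by rewrite nth_mkseq // hbk nth_mkseq // baseK -hbk baseK => -[].
- by move=> x /= b0; apply: Cb; have := bkC x; rewrite b0.
- move=> x; rewrite qht /= => h.
  have CT : C (T x) by rewrite -(baseK x) -iterS h; exact: rtC.
  by have := Ct _ CT; rewrite homeo_funK.
- move=> u hu /=; have := mem_nth [::] hu; rewrite mem_filter => /andP[/asboolP[b Cb' <-] _].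
  rewrite size_mkseq leqNgt; apply/negP => h.
  have := CH b (rt b) Cb'; rewrite (ltnW h) /= => /(_ isT).
  by rewrite rtC.
Qed.

End Refinement.

Definition trivial_towers := Towers (fun=> 0%N) (fun=> 0%N) 1%N (fun=> 1%N).

Lemma trivial_tower_partition : tower_partition trivial_towers.
Proof.
split=> //; try by move=> *; exact: loc_const_cst.
by move=> u; rewrite ltnS leqn0 => /eqP ->; exists x0.
Qed.

Lemma tower_gap p : tower_partition p -> exists G, forall u x,
  (u < tw_num p)%N -> exists2 j, (j < G)%N &
    (tw_pos p (iter j T x) == 0%N) && (tw_ix p (iter j T x) == u).
Proof.
move=> tp.
have gu u : exists G, (u < tw_num p)%N -> forall x, exists2 j, (j < G)%N &
    (tw_pos p (iter j T x) == 0%N) && (tw_ix p (iter j T x) == u).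
  have [hu|] := boolP (u < tw_num p)%N; last by exists 0%N.
  have lP : loc_const (fun x => (tw_pos p x == 0%N) && (tw_ix p x == u)).
    exact: (loc_const2 (fun a b => (a == 0%N) && (b == u)) (tp_pos_lc tp) (tp_ix_lc tp)).
  have [|G GP] := syndetic lP; last by exists G.
  by have [x [xu x0']] := tp_base tp hu; exists x; rewrite xu x0' !eqxx.
have /choice[g gP] := gu; exists (\max_(u < tw_num p) g u)%N => u x hu.
have [j jg Pj] := gP u hu x; exists j => //; apply: leq_trans jg _.
exact: (leq_bigmax (F := fun u : 'I_(tw_num p) => g u) (Ordinal hu)).
Qed.

(** The height demanded of the next partition may depend on the partition just built, so the
    parameters of a level can be chosen between two refinements. *)
Lemma tower_sequence_ex (H : nat -> towers -> nat) : exists p : nat -> towers,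
  [/\ p 0%N = trivial_towers, forall i, tower_partition (p i) &
    forall i, refines i (H i (p i)) (p i) (p i.+1)].
Proof.
pose nxt i (p : {p | tower_partition p}) : {q | tower_partition q} :=
  exist _ (projT1 (cid (refine_ex i (H i (sval p)) (svalP p))))
    (projT2 (cid (refine_ex i (H i (sval p)) (svalP p)))).1.
pose P := fix P i := if i is i'.+1 then nxt i' (P i')
  else exist tower_partition _ trivial_tower_partition.
exists (fun i => sval (P i)); split=> // i; first exact: svalP.
exact: (projT2 (cid (refine_ex i (H i (sval (P i))) (svalP (P i))))).2.
Qed.

End TowerPartitions.

(** * Itineraries of a tower through a coarser partition *)

Lemma nth_filter_count (A : Type) (d : A) (a : pred A) (l : seq A) i :
  (i < size l)%N -> a (nth d l i) ->
  nth d (seq.filter a l) (count a (take i l)) = nth d l i.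
Proof.
elim: l i => // x l IHl [|i] /= hi ai; first by rewrite ai.
by case: (a x); rewrite /= ?add1n ?add0n IHl.
Qed.

Lemma filter_index (A : Type) (d : A) (a : pred A) (l : seq A) q :
  (q < size (seq.filter a l))%N ->
  exists i, [/\ (i < size l)%N, a (nth d l i) & count a (take i l) = q].
Proof.
elim: l q => // x l IHl q /=; have [ax|nax] := boolP (a x).
  case: q => [_|q /IHl[i [hi ai <-]]]; first by exists 0%N.
  by exists i.+1; rewrite /= ax add1n.
by move=> /IHl[i [hi ai <-]]; exists i.+1; rewrite /= (negbTE nax).
Qed.

Section Itineraries.
Local Open Scope nat_scope.
Variables (X : topologicalType) (T : homeomorphism X X).
Variable hX : homeomorphism X cantor_space.
Variable x0 : X.
Local Notation TV := (homeo_inv T).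
Local Notation tower_partition := (tower_partition T x0).
Local Notation refines := (refines T hX x0).

Section OnePartition.
Variable p : towers X.
Hypothesis tp : tower_partition p.

Lemma tower_iter j x : tw_pos p x + j < tw_ht p (tw_ix p x) ->
  tw_ix p (iter j T x) = tw_ix p x /\ tw_pos p (iter j T x) = tw_pos p x + j.
Proof.
elim: j => [|j IHj] h; first by rewrite addn0.
have [|ej pj] := IHj; first by apply: leq_ltn_trans h; rewrite leq_add2l.
have [|eS pS] := tp_up tp (x := iter j T x).
  by rewrite ej pj -addnS.
by rewrite iterS eS pS ej pj addnS.
Qed.

Lemma tower_down x : 0 < tw_pos p x ->
  tw_ix p (TV x) = tw_ix p x /\ (tw_pos p (TV x)).+1 = tw_pos p x.
Proof.
move=> px; have := tp_pos_lt tp (TV x); rewrite leq_eqVlt => /orP[/eqP h|h].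
  by have := tp_top tp h; rewrite homeo_invK => e; rewrite e in px.
by have := tp_up tp h; rewrite homeo_invK => -[-> ->].
Qed.

Lemma tower_back j x : j <= tw_pos p x ->
  tw_ix p (iter j TV x) = tw_ix p x /\ tw_pos p (iter j TV x) = tw_pos p x - j.
Proof.
elim: j => [|j IHj] h; first by rewrite subn0.
have [ej pj] := IHj (ltnW h).
have [|eS pS] := @tower_down (iter j TV x); first by rewrite pj subn_gt0.
by rewrite iterS eS ej; split=> //; apply: succn_inj; rewrite pS pj -subSn // subSS.
Qed.

Lemma tower_end x : tw_pos p x = 0 -> tw_pos p (iter (tw_ht p (tw_ix p x)) T x) = 0.
Proof.
move=> px; have h0 : 0 < tw_ht p (tw_ix p x) by exact: leq_ltn_trans (tp_pos_lt tp x).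
have [|e pe] := @tower_iter (tw_ht p (tw_ix p x)).-1 x.
  by rewrite px ltn_predL.
by rewrite -[X in iter X](prednK h0) iterS; apply: (tp_top tp); rewrite pe e px prednK.
Qed.

(** Between two visits to bases the orbit crosses whole towers; strong induction on the time removes
    the first crossing. *)
Lemma tower_visits_sum n x : tw_pos p x = 0 -> tw_pos p (iter n T x) = 0 ->
  \sum_(u <- [seq tw_ix p (iter j T x) | j <- iota 0 n &
    tw_pos p (iter j T x) == 0]) tw_ht p u = n.
Proof.
elim/ltn_ind: n x => n IHn x px pn.
have [->|n0] := posnP n; first by rewrite big_nil.
set u := tw_ix p x.
have h0 : 0 < tw_ht p u by exact: leq_ltn_trans (tp_pos_lt tp x).
have inside j : j < tw_ht p u -> tw_pos p (iter j T x) = j.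
  by move=> hj; have [|_ ->] := @tower_iter j x; rewrite px.
have un : tw_ht p u <= n.
  by rewrite leqNgt; apply/negP => /inside; rewrite pn => n00; rewrite -n00 in n0.
rewrite -(subnKC un) iotaD filter_cat map_cat big_cat /=.
congr (_ + _).
  rewrite -[in iota _ _](prednK h0) /= px eqxx /= big_cons -[RHS]addn0; congr (_ + _).
  rewrite (_ : seq.filter _ _ = [::]) ?big_nil //.
  apply/eqP; rewrite -size_eq0 size_filter -leqn0 leqNgt -has_count.
  apply/hasPn => j; rewrite mem_iota add1n prednK // => /andP[j0 /inside ->].
  by rewrite -lt0n.
rewrite add0n -[X in iota X _]addn0 iotaDl filter_map -map_comp.
have := IHn (n - tw_ht p u) _ (iter (tw_ht p u) T x).
rewrite -iterD subnK // ltn_subrL h0 n0 => /(_ isT (tower_end px) pn) e.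
rewrite -[RHS]e; congr (\sum_(u <- _) _); have it j : iter (tw_ht p u + j) T x = iter j T (iter (tw_ht p u) T x).
  by rewrite addnC iterD.
rewrite (eq_filter (a2 := fun j => tw_pos p (iter j T (iter (tw_ht p u) T x)) == 0)).
  by apply: eq_map => j /=; rewrite it.
by move=> j /=; rewrite it.
Qed.

End OnePartition.

Section TwoPartitions.
Variables (i H : nat) (p q : towers X).
Hypothesis tp : tower_partition p.
Hypothesis tq : tower_partition q.
Hypothesis rpq : refines i H p q.

Definition tbase x := iter (tw_pos q x) TV x.

Lemma tbase_ix x : tw_ix q (tbase x) = tw_ix q x.
Proof. exact: (tower_back tq (leqnn _)).1. Qed.

Lemma tbase_pos x : tw_pos q (tbase x) = 0.
Proof. by rewrite (tower_back tq (leqnn _)).2 subnn. Qed.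

Lemma tbaseK x : iter (tw_pos q x) T (tbase x) = x.
Proof. exact: iterKV. Qed.

Definition is_start (b : X) (j : nat) := tw_pos p (iter j T b) == 0.

Definition itinerary (b : X) : seq nat :=
  [seq tw_ix p (iter j T b) | j <- iota 0 (tw_ht q (tw_ix q b)) & is_start b j].

(** Time 0 always starts a block and is left out of the count, so the first block has index 0. *)
Definition block_index (x : X) : nat :=
  count (is_start (tbase x)) (iota 1 (tw_pos q x)).

Lemma tower_cell b b' j : tw_pos q b = 0 -> tw_pos q b' = 0 ->
  tw_ix q b = tw_ix q b' -> j < tw_ht q (tw_ix q b) ->
  tw_ix p (iter j T b) = tw_ix p (iter j T b') /\
  tw_pos p (iter j T b) = tw_pos p (iter j T b').
Proof.
move=> pb pb' bb' hj; have [|e1 e2] := tower_iter tq (x := b) (j := j).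
  by rewrite pb.
have [|e1' e2'] := tower_iter tq (x := b') (j := j); first by rewrite pb' -bb'.
have [||-> -> _] // := rf_cell rpq (x := iter j T b) (y := iter j T b').
  by rewrite e1 e1'.
by rewrite e2 e2' pb pb'.
Qed.

Lemma itinerary_eq b b' : tw_pos q b = 0 -> tw_pos q b' = 0 ->
  tw_ix q b = tw_ix q b' -> itinerary b = itinerary b'.
Proof.
move=> pb pb' bb'; rewrite /itinerary -bb'.
have hs j : j \in iota 0 (tw_ht q (tw_ix q b)) -> is_start b j = is_start b' j.
  by rewrite mem_iota /is_start => hj; rewrite (tower_cell pb pb' bb' hj).2.
rewrite (eq_in_filter hs); apply/eq_in_map => j; rewrite mem_filter mem_iota.
by move=> /andP[_ hj]; exact: (tower_cell pb pb' bb' hj).1.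
Qed.

Lemma pos_le x : tw_pos p x <= tw_pos q x.
Proof.
rewrite leqNgt; apply/negP => h.
have [_ e] := tower_back tp (ltnW h).
have := (rf_base rpq (tbase_pos x)).1; rewrite e; lia.
Qed.

Lemma base_start x : is_start (tbase x) 0.
Proof. by rewrite /is_start /= (rf_base rpq (tbase_pos x)).1. Qed.

Lemma tbase_iter x j : j <= tw_pos q x ->
  iter j T (tbase x) = iter (tw_pos q x - j) TV x.
Proof. by move=> h; rewrite /tbase -{1}(subnKC h) iterD iterKV. Qed.

Lemma start_ix x : tw_ix p (iter (tw_pos q x - tw_pos p x) T (tbase x)) = tw_ix p x /\
  is_start (tbase x) (tw_pos q x - tw_pos p x).
Proof.
rewrite /is_start tbase_iter ?leq_subr // subKn ?pos_le //.
by have [-> ->] := tower_back tp (leqnn (tw_pos p x)); rewrite subnn.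
Qed.

Lemma block_index_start x :
  block_index x = count (is_start (tbase x)) (iota 1 (tw_pos q x - tw_pos p x)).
Proof.
rewrite /block_index -{1}(subnK (pos_le x)) iotaD count_cat -[RHS]addn0; congr (_ + _).
apply/eqP; rewrite -leqn0 leqNgt -has_count; apply/hasPn => j; rewrite mem_iota.
move=> /andP[h1 h2]; rewrite /is_start tbase_iter; last by have := pos_le x; lia.
have [|_ ->] := @tower_back p tp (tw_pos q x - j) x; have := pos_le x; lia.
Qed.

Lemma count_start_take x : block_index x =
  count (is_start (tbase x)) (iota 0 (tw_pos q x - tw_pos p x)).
Proof.
rewrite block_index_start; set m := tw_pos q x - tw_pos p x.
have e1 : count (is_start (tbase x)) (iota 0 m.+1) =
    (count (is_start (tbase x)) (iota 1 m)).+1 by rewrite /= base_start.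
apply: succn_inj; rewrite -e1 -[in LHS]addn1 iotaD count_cat /=.
by rewrite (start_ix x).2 addn1.
Qed.

Lemma pos_lt_ht x : tw_pos q x - tw_pos p x < tw_ht q (tw_ix q (tbase x)).
Proof.
by rewrite tbase_ix; apply: leq_ltn_trans (tp_pos_lt tq x); exact: leq_subr.
Qed.

Lemma nth_itinerary x :
  block_index x < size (itinerary (tbase x)) /\
  nth 0 (itinerary (tbase x)) (block_index x) = tw_ix p x.
Proof.
set l := iota 0 (tw_ht q (tw_ix q (tbase x))); set m := tw_pos q x - tw_pos p x.
have hm : m < size l by rewrite size_iota pos_lt_ht.
have nm : nth 0 l m = m by rewrite nth_iota // -[ltnRHS](size_iota 0).
have bE : block_index x = count (is_start (tbase x)) (take m l).
  by rewrite count_start_take take_iota (minn_idPl _) // ltnW // pos_lt_ht.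
have am : is_start (tbase x) (nth 0 l m) by rewrite nm; exact: (start_ix x).2.
have bs : block_index x < size (seq.filter (is_start (tbase x)) l).
  rewrite bE size_filter -[in ltnRHS](cat_take_drop m l) count_cat.
  by rewrite (drop_nth 0 hm) /= am -addn1 leq_add2l.
split; first by rewrite size_map.
rewrite (nth_map 0) // bE nth_filter_count // nm.
exact: (start_ix x).1.
Qed.

(** If the block of [b] started later than that of [a], its start would be one more in the count for
    [b], since both bases see the same starts. *)
Lemma block_index_inj x y : tw_ix q x = tw_ix q y -> block_index x = block_index y ->
  tw_pos p x = tw_pos p y -> tw_pos q x = tw_pos q y.
Proof.
have aux a b : tw_ix q a = tw_ix q b -> block_index a = block_index b ->
    tw_pos p a = tw_pos p b -> tw_pos q b <= tw_pos q a.
  move=> ix bi ps; rewrite leqNgt; apply/negP => lt.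
  have hs j : j < tw_ht q (tw_ix q a) -> is_start (tbase a) j = is_start (tbase b) j.
    move=> hj; rewrite /is_start (tower_cell (tbase_pos a) (tbase_pos b) _ _).2 //.
      by rewrite !tbase_ix.
    by rewrite tbase_ix.
  have := bi; rewrite !block_index_start.
  set m := tw_pos q a - tw_pos p a; set m' := tw_pos q b - tw_pos p b.
  have hm : m < m' by rewrite /m /m'; have := pos_le a; have := pos_le b; lia.
  have m'h : m' < tw_ht q (tw_ix q a).
    by rewrite ix -tbase_ix; exact: pos_lt_ht.
  have -> : count (is_start (tbase a)) (iota 1 m) =
      count (is_start (tbase b)) (iota 1 m).
    apply: eq_in_count => j; rewrite mem_iota => /andP[_ hj]; apply: hs.
    by apply: leq_trans m'h; lia.
  have -> : m' = (m + (m' - m).-1) + 1 by lia.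
  rewrite iotaD [in X in _ = X -> _]iotaD !count_cat /= addn0 !add1n.
  have -> : (m + (m' - m).-1).+1 = m' by lia.
  rewrite (start_ix b).2; lia.
by move=> ix bi ps; apply/eqP; rewrite eqn_leq !aux.
Qed.

Lemma block_step x : (tw_pos p x).+1 < tw_ht p (tw_ix p x) ->
  [/\ tw_ix q (T x) = tw_ix q x, tw_pos q (T x) = (tw_pos q x).+1 &
    block_index (T x) = block_index x].
Proof.
move=> h; have h' : (tw_pos q x).+1 < tw_ht q (tw_ix q x).
  rewrite ltn_neqAle (tp_pos_lt tq) andbT; apply/eqP => /(rf_top rpq)[e _].
  by rewrite e ltnn in h.
have [ix ps] := tp_up tq h'; have [_ pp] := tp_up tp h.
have bE : tbase (T x) = tbase x by rewrite /tbase ps iterSr homeo_funK.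
split=> //; rewrite /block_index bE ps -[(tw_pos q x).+1]addn1 iotaD count_cat /=.
by rewrite /is_start add1n iterS tbaseK pp !addn0.
Qed.

Lemma block_ex z k : tw_pos q z = 0 -> k < size (itinerary z) ->
  exists2 j, j < tw_ht q (tw_ix q z) & let y := iter j T z in
    tw_pos p y = 0 /\ block_index y = k.
Proof.
move=> pz; rewrite size_map => /(@filter_index _ 0)[j []].
rewrite size_iota => hj; rewrite nth_iota // add0n => sj ck; exists j => // y.
have [|ey py] := tower_iter tq (x := z) (j := j); first by rewrite pz.
have pyj : tw_pos q y = j by rewrite py pz.
have by_ : tbase y = z by rewrite /tbase pyj iterK.
have p0 : tw_pos p y = 0 by exact/eqP.
split=> //; rewrite count_start_take by_ pyj p0 subn0 -ck.
by rewrite take_iota (minn_idPl _) // ltnW.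
Qed.

Lemma itinerary_sum z : tw_pos q z = 0 ->
  \sum_(u <- itinerary z) tw_ht p u = tw_ht q (tw_ix q z).
Proof.
move=> pz; apply: (tower_visits_sum tp); first exact: (rf_base rpq pz).1.
exact: (rf_base rpq (tower_end tq pz)).1.
Qed.

Lemma itinerary_lt z u : u \in itinerary z -> u < tw_num p.
Proof. by case/mapP => j _ ->; exact: tp_ix_lt tp _. Qed.

Lemma itinerary_head z : tw_pos q z = 0 -> head 0 (itinerary z) = tw_ix p x0.
Proof.
move=> pz; have h0 : 0 < tw_ht q (tw_ix q z) by exact: leq_ltn_trans (tp_pos_lt tq z).
have [p0 p1] := rf_base rpq pz.
by rewrite /itinerary -(prednK h0) /= /is_start /= p0 eqxx /= p1.
Qed.

Lemma block_index_top x : (tw_pos q x).+1 = tw_ht q (tw_ix q x) ->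
  (block_index x).+1 = size (itinerary (tbase x)).
Proof.
move=> h; rewrite size_map size_filter tbase_ix -h /= base_start add1n.
by [].
Qed.

Lemma itinerary_last z : tw_pos q z = 0 -> last 0 (itinerary z) = tw_ix p (TV x0).
Proof.
move=> pz; have h0 : 0 < tw_ht q (tw_ix q z) by exact: leq_ltn_trans (tp_pos_lt tq z).
have [|ex px] := tower_iter tq (x := z) (j := (tw_ht q (tw_ix q z)).-1).
  by rewrite pz ltn_predL.
set x := iter _ T z in ex px.
have ht_ : (tw_pos q x).+1 = tw_ht q (tw_ix q x) by rewrite px pz ex prednK.
have bx : tbase x = z by rewrite /tbase px pz iterK.
have := (nth_itinerary x).2; have := block_index_top ht_; rewrite bx => bE.
by rewrite -[block_index x]/(block_index x).+1.-1 bE nth_last (rf_top rpq ht_).2.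
Qed.

(** Each of the disjoint time windows of length [G] that fit into the tower contains an entry into
    the tower [u]. *)
Lemma itinerary_count G z u : tw_pos q z = 0 ->
  (forall x, exists2 j, j < G & (tw_pos p (iter j T x) == 0) && (tw_ix p (iter j T x) == u)) ->
  tw_ht q (tw_ix q z) %/ G <= count_mem u (itinerary z).
Proof.
move=> pz hG; rewrite /itinerary count_map count_filter.
set a := predI _ _; set h := tw_ht _ _.
have aux n : n <= count a (iota 0 (n * G)).
  elim: n => // n IHn; rewrite mulSn addnC iotaD count_cat -addn1 leq_add //.
  have [j jG /andP[s1 s2]] := hG (iter (n * G) T z).
  rewrite -has_count; apply/hasP; exists (n * G + j).
    by rewrite mem_iota leq_addr /= ltn_add2l.
  by rewrite /a /= /is_start addnC iterD s1 s2.
apply: leq_trans (aux _) _.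
by rewrite -{2}(subnKC (leq_trunc_div h G)) iotaD count_cat leq_addr.
Qed.

End TwoPartitions.
End Itineraries.

(** * The tower sequence as a tail structure *)

Section TowerSequence.
Local Open Scope nat_scope.
Variables (X : topologicalType) (T : homeomorphism X X).
Variable hX : homeomorphism X cantor_space.
Variable x0 : X.
Local Notation TV := (homeo_inv T).
Variables (pt : nat -> towers X) (H : nat -> nat).
Hypothesis pt0 : pt 0 = trivial_towers X.
Hypothesis tpt : forall i, tower_partition T x0 (pt i).
Hypothesis rpt : forall i, refines T hX x0 i (H i) (pt i) (pt i.+1).

Definition tnum i := tw_num (pt i).
Definition tht i := tw_ht (pt i).
Definition tpos i (x : X) := tw_pos (pt i) x.
Definition tix i (x : X) := tw_ix (pt i) x.
Definition tblock i (x : X) := block_index T (pt i) (pt i.+1) x.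
(** The base point is an arbitrary choice: by [itinerary_eq] the itinerary depends on the tower
    only. *)
Definition titin i v : seq nat :=
  if pselect (v < tnum i.+1) is left h then
    itinerary T (pt i) (pt i.+1) (projT1 (cid (tp_base (tpt i.+1) h)))
  else [::].

Lemma tix_lt i x : tix i x < tnum i. Proof. exact: tp_ix_lt (tpt i) x. Qed.

Lemma tpos0 x : tpos 0 x = 0. Proof. by rewrite /tpos pt0. Qed.
Lemma tix0 x : tix 0 x = 0. Proof. by rewrite /tix pt0. Qed.

Lemma titinE i b : tpos i.+1 b = 0 ->
  titin i (tix i.+1 b) = itinerary T (pt i) (pt i.+1) b.
Proof.
move=> pb; rewrite /titin; case: pselect => [h|]; last by rewrite tix_lt.
case: cid => b' /= [eb pb'].
exact: (itinerary_eq (tpt i.+1) (rpt i)).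
Qed.

Lemma titin_tbase i x :
  titin i (tix i.+1 x) = itinerary T (pt i) (pt i.+1) (tbase T (pt i.+1) x).
Proof.
rewrite -(titinE (tbase_pos (tpt i.+1) x)).
by congr titin; rewrite /tix (tbase_ix (tpt i.+1)).
Qed.

Lemma titin_ex i v : v < tnum i.+1 -> exists b, [/\ tpos i.+1 b = 0,
  tix i.+1 b = v & titin i v = itinerary T (pt i) (pt i.+1) b].
Proof.
move=> hv; have [b [<- pb]] := tp_base (tpt i.+1) hv.
by exists b; split=> //; exact: titinE.
Qed.

Lemma tblock_lt i x : tblock i x < size (titin i (tix i.+1 x)).
Proof.
by rewrite titin_tbase; exact: (nth_itinerary (tpt i) (tpt i.+1) (rpt i) x).1.
Qed.

Lemma nth_titin i x : nth 0 (titin i (tix i.+1 x)) (tblock i x) = tix i x.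
Proof.
by rewrite titin_tbase; exact: (nth_itinerary (tpt i) (tpt i.+1) (rpt i) x).2.
Qed.

Lemma loc_const_tix i : loc_const (tix i). Proof. exact: tp_ix_lc (tpt i). Qed.

Lemma loc_const_tblock i : loc_const (tblock i).
Proof.
have lcount (P : nat -> X -> bool) s : (forall j, loc_const (P j)) ->
    loc_const (fun x => count (P ^~ x) s).
  move=> lP; elim: s => [|j s IHs]; first exact: loc_const_cst.
  exact: (loc_const2 (fun (b : bool) m => b + m) (lP j) IHs).
apply: (loc_const_dep (g := fun n x => count (fun j =>
  tw_pos (pt i) (iter j T (iter n TV x)) == 0) (iota 1 n)) (tp_pos_lc (tpt i.+1))) => n.
apply: (lcount (fun j x => tw_pos (pt i) (iter j T (iter n TV x)) == 0)) => j.
apply: (@loc_const_iterV X T _ (fun x => tw_pos (pt i) (iter j T x) == 0)).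
apply: (@loc_const_iter X T _ (fun x => tw_pos (pt i) x == 0)).
exact: (loc_const_comp (eq_op^~ 0) (tp_pos_lc (tpt i))).
Qed.

(** Tail equivalence in the Bratteli diagram of the towers themselves, where an edge is a tower
    together with a block of it. *)
Definition same_later n (x y : X) : Prop :=
  forall i, n <= i -> tix i.+1 x = tix i.+1 y /\ tblock i x = tblock i y.

Lemma same_later_tix n x y : same_later n x y -> tix n x = tix n y.
Proof. by move=> /(_ n (leqnn n))[e1 e2]; rewrite -(nth_titin n x) -(nth_titin n y) e1 e2. Qed.

Lemma same_later_trans n x y z : same_later n x y -> same_later n y z ->
  same_later n x z.
Proof. by move=> xy yz i ni; rewrite (xy i ni).1 (xy i ni).2; exact: yz. Qed.

Lemma same_later_sym n x y : same_later n x y -> same_later n y x.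
Proof. by move=> xy i ni; rewrite (xy i ni).1 (xy i ni).2. Qed.

(** Refinement passes agreement downwards, so infinitely many levels suffice, and the cell of level
    i + 1 fixes coordinate i. *)
Lemma cells_eq x y : (forall n, exists2 m, n <= m & tix m x = tix m y /\ tpos m x = tpos m y) ->
  x = y.
Proof.
move=> h.
have hc n : tix n x = tix n y /\ tpos n x = tpos n y.
  have [m nm [ex px]] := h n; move: ex px; rewrite -(subnKC nm).
  elim: (m - n) => [|d IHd]; first by rewrite addn0.
  rewrite addnS => ex px; have [e1 e2 _] := rf_cell (rpt (n + d)) ex px.
  exact: IHd.
apply: (@coord_inj X hX) => i.
by have [] := rf_cell (rpt i) (hc i.+1).1 (hc i.+1).2.
Qed.

Lemma same_later_eq n x y : same_later n x y -> tpos n x = tpos n y -> x = y.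
Proof.
move=> xy pxy; apply: cells_eq => m; exists (m + n); first exact: leq_addr.
elim: m => [|m [IH1 IH2]]; first by rewrite (same_later_tix xy).
have [e1 e2] := xy (m + n) (leq_addl _ _).
split=> //; rewrite addSn.
exact: (block_index_inj (tpt _) (tpt _) (rpt _)).
Qed.

Definition tup n x : bool := (tpos n x).+1 < tht n (tix n x).

Lemma tup_later n x : tup n x -> forall m, n <= m ->
  [/\ tup m x, tix m (T x) = tix m x & tpos m (T x) = (tpos m x).+1].
Proof.
move=> ux m; elim: m => [|m IHm].
  by rewrite leqn0 => /eqP n0; rewrite -n0; have [] := tp_up (tpt n) ux.
rewrite leq_eqVlt => /orP[/eqP <-|].
  by have [] := tp_up (tpt n) ux.
rewrite ltnS => /IHm[um _ _].
have uS : tup m.+1 x.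
  rewrite /tup ltn_neqAle (tp_pos_lt (tpt m.+1)) andbT.
  apply/eqP => /(rf_top (rpt m))[e _].
  by move: um; rewrite /tup /tpos e ltnn.
by have [e p] := tp_up (tpt m.+1) uS.
Qed.

Lemma tup_same n x : tup n x -> same_later n x (T x).
Proof.
move=> ux m nm; have [um _ _] := tup_later ux nm.
have [e1 _ e2] := block_step (tpt m) (tpt m.+1) (rpt m) um.
by split; apply/esym.
Qed.

Lemma iter_same n j x : tpos n x + j < tht n (tix n x) ->
  same_later n x (iter j T x) /\ tpos n (iter j T x) = tpos n x + j.
Proof.
elim: j => [|j IHj] hj; first by rewrite addn0.
have [|xy pj] := IHj; first by apply: leq_ltn_trans hj; rewrite leq_add2l.
have uj : tup n (iter j T x).
  by rewrite /tup pj -(same_later_tix xy) -addnS.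
have [_ _ pS] := tup_later uj (leqnn n).
split; first exact: same_later_trans xy (tup_same uj).
by rewrite iterS pS pj addnS.
Qed.

Lemma tower_tail_structure : tail_structure T same_later tpos tup (TV x0).
Proof.
split.
- by move=> n; exact: tp_pos_lc (tpt n).
- move=> n; apply: (loc_const2 (fun a b => a.+1 < tht n b)).
    exact: tp_pos_lc (tpt n).
  exact: loc_const_tix.
- move=> n x y xy.
  have hb z : exists b, [/\ tpos n b = 0, same_later n b z & z = iter (tpos n z) T b].
    exists (tbase T (pt n) z); have pb := tbase_pos (tpt n) z.
    have zE : z = iter (tpos n z) T (tbase T (pt n) z) by rewrite tbaseK.
    have [|sz _] := @iter_same n (tpos n z) (tbase T (pt n) z).
      by rewrite {1}/tpos pb /tix (tbase_ix (tpt n)); exact: tp_pos_lt (tpt n) z.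
    by split=> //; rewrite {2}zE.
  have [b [pb bx xE]] := hb x; have [c [pc cy yE]] := hb y.
  have bc : b = c.
    apply: (@same_later_eq n); last by rewrite pb pc.
    exact: same_later_trans bx (same_later_trans xy (same_later_sym cy)).
  rewrite {1}yE -bc -iterZ_nat.
  transitivity (iterZ T ((tpos n y)%:Z - (tpos n x)%:Z)%R (iterZ T (tpos n x) b)).
    by rewrite -iterZD subrK.
  by congr (iterZ T _ _); rewrite iterZ_nat -xE.
- exact: tup_same.
- by move=> n; rewrite /tup /tpos (top_before_x0 (tpt n)) ltnn.
(* A point on top of all its towers has [T x] in every base; refinement then puts [T x] into the
   cell of [x0] at every level. *)
- move=> x xx0; apply: contrapT => nu; apply: xx0.
  rewrite -[x](homeo_funK T); congr (TV _); apply: cells_eq => n; exists n => //.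
  have Tx m : tpos m (T x) = 0.
    apply: (tp_top (tpt m)); apply/eqP; rewrite eqn_leq (tp_pos_lt (tpt m)) leqNgt.
    by apply/negP => um; apply: nu; exists m.
  rewrite Tx; have [_ e] := rf_base (rpt n) (Tx n.+1).
  by split; [exact: e|rewrite /tpos (tp_x0 (tpt n))].
Qed.

(** A finite prefix is realised from its highest level downwards: inside the tower [v n.+1], block
    [k n] starts at a base point of the tower [v n]. Compactness gives the infinite path. *)
Lemma tower_path_ex (v k : nat -> nat) : (forall i, v i.+1 < tnum i.+1) ->
  (forall i, k i < size (titin i (v i.+1))) ->
  (forall i, nth 0 (titin i (v i.+1)) (k i) = v i) ->
  exists x, forall i, tix i.+1 x = v i.+1 /\ tblock i x = k i.
Proof.
move=> vlt klt vE.
have step n z : tpos n z = 0 -> tix n z = v n -> exists x, same_later n z x /\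
    forall i, i < n -> tix i.+1 x = v i.+1 /\ tblock i x = k i.
  elim: n z => [|n IHn] z pz vz; first by exists z.
  have := klt n; rewrite -vz titinE // => hk.
  have [j jh [py ky]] := block_ex (tpt n) (tpt n.+1) (rpt n) pz hk.
  set y := iter j T z in py ky.
  have [|zy _] := @iter_same n.+1 j z; first by rewrite pz.
  have vy : tix n.+1 y = v n.+1 by rewrite -(same_later_tix zy).
  have ky' : tblock n y = k n by exact: ky.
  have [|x [yx xi]] := IHn y py.
    by rewrite -nth_titin vy ky' vE.
  exists x; split.
    apply: same_later_trans zy _ => i ni; apply: yx; exact: ltnW.
  move=> i; rewrite ltnS leq_eqVlt => /orP[/eqP ->|]; last exact: xi.
  by have [<- <-] := yx n (leqnn n).
pose F n x := all (fun i => (tix i.+1 x == v i.+1) && (tblock i x == k i)) (iota 0 n).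
have [||n|x Fx] := @compact_decreasing X F (cantor_compact hX).
- move=> n; apply: (@loc_const_all X (fun i x => (tix i.+1 x == v i.+1) && (tblock i x == k i))) => i.
  exact: (loc_const2 (fun a b => (a == v i.+1) && (b == k i))
    (@loc_const_tix i.+1) (@loc_const_tblock i)).
- move=> m n x mn /allP h; apply/allP => i; rewrite mem_iota => hi.
  by apply: h; rewrite mem_iota; lia.
- have [z [vz pz]] := tp_base (tpt n.+1) (vlt n).
  have [x [_ xi]] := step n.+1 z pz vz; exists x; apply/allP => i.
  by rewrite mem_iota /= => hi; have [-> ->] := xi i (ltnW hi); rewrite !eqxx.
- exists x => i; have /allP /(_ i) := Fx i.+1.
  by rewrite mem_iota /= ltnSn => /(_ isT) /andP[/eqP -> /eqP ->].
Qed.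

Lemma tblock_x0 i : tblock i x0 = 0.
Proof. by rewrite /tblock /block_index (tp_x0 (tpt i.+1)). Qed.

Lemma tblock_top i :
  (tblock i (TV x0)).+1 = size (titin i (tix i.+1 (TV x0))).
Proof.
rewrite titin_tbase; apply: (block_index_top (tpt i.+1) (rpt i)).
exact: top_before_x0 (tpt i.+1).
Qed.

Lemma titin_sum i v : v < tnum i.+1 -> \sum_(u <- titin i v) tht i u = tht i.+1 v.
Proof.
by case/titin_ex => b [pb <- ->]; exact: (itinerary_sum (tpt i) (tpt i.+1) (rpt i)).
Qed.

Lemma titin_lt i v u : v < tnum i.+1 -> u \in titin i v -> u < tnum i.
Proof. by case/titin_ex => b [pb <- ->]; exact: (itinerary_lt (tpt i)). Qed.

Lemma titin_head i v : v < tnum i.+1 -> head 0 (titin i v) = tix i x0.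
Proof.
by case/titin_ex => b [pb <- ->]; exact: (itinerary_head (tpt i.+1) (rpt i)).
Qed.

Lemma titin_last i v : v < tnum i.+1 -> last 0 (titin i v) = tix i (TV x0).
Proof.
by case/titin_ex => b [pb <- ->]; exact: (itinerary_last (tpt i) (tpt i.+1) (rpt i)).
Qed.

Lemma titin_count i v u G : v < tnum i.+1 ->
  (forall x, exists2 j, j < G &
    (tw_pos (pt i) (iter j T x) == 0) && (tw_ix (pt i) (iter j T x) == u)) ->
  tht i.+1 v %/ G <= count_mem u (titin i v).
Proof.
by case/titin_ex => b [pb <- ->]; exact: itinerary_count.
Qed.

End TowerSequence.

(** * Ordered Bratteli diagrams from directive words *)

(* [dword D i w] is the word over the letters [u < dnum D i] of level [i] that
   describes, in order, the sources of the edges into the vertex [w] of level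
   [i.+1]. *)
Record directive := Directive {
  dnum : nat -> nat;
  dword : nat -> nat -> seq nat;
  dnum0 : dnum 0 = 1%N;
  dnum_gt0 : forall i, (0 < dnum i)%N;
  dword_letter : forall i w u,
    (w < dnum i.+1)%N -> u \in dword i w -> (u < dnum i)%N;
  dword_full : forall i w u,
    (w < dnum i.+1)%N -> (u < dnum i)%N -> u \in dword i w;
  dword_head : forall i w w', (w < dnum i.+1)%N -> (w' < dnum i.+1)%N ->
    head 0%N (dword i w) = head 0%N (dword i w');
  dword_last : forall i w w', (w < dnum i.+1)%N -> (w' < dnum i.+1)%N ->
    last 0%N (dword i w) = last 0%N (dword i w') }.

Section Directive.
Local Open Scope nat_scope.
Variable D : directive.

(** An edge is a position in the word of its range: repeated letters give parallel edges, and the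
    positions order them. *)
Definition dedge (i : nat) : finType :=
  {w : 'I_(dnum D i.+1) & 'I_(size (dword D i w))}.

Definition edge_rng i (e : dedge i) : 'I_(dnum D i.+1) := tag e.
Definition edge_pos i (e : dedge i) : nat := tagged e.

Definition edge_src i (e : dedge i) : 'I_(dnum D i) :=
  Ordinal (dword_letter (ltn_ord (tag e)) (mem_nth 0 (ltn_ord (tagged e)))).

Lemma edge_src_nth i (e : dedge i) :
  edge_src e = nth 0 (dword D i (edge_rng e)) (edge_pos e) :> nat.
Proof. by []. Qed.

Lemma edge_pos_lt i (e : dedge i) : edge_pos e < size (dword D i (edge_rng e)).
Proof. exact: ltn_ord. Qed.

Lemma edge_inj i (e f : dedge i) :
  edge_rng e = edge_rng f :> nat -> edge_pos e = edge_pos f -> e = f.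
Proof.
case: e f => [w k] [w' k']; rewrite /edge_rng /edge_pos /= => ww'.
have {}ww' : w = w' by apply/val_inj.
by subst w' => kk'; congr existT; apply/val_inj.
Qed.

Lemma edge_ex i (w k : nat) : w < dnum D i.+1 -> k < size (dword D i w) ->
  exists e : dedge i, edge_rng e = w :> nat /\ edge_pos e = k.
Proof.
move=> hw hk; exists (existT (fun w : 'I_(dnum D i.+1) => 'I_(size (dword D i w)))
  (Ordinal hw) (Ordinal hk)); by [].
Qed.

Lemma dtop : #|('I_(dnum D 0) : finType)| = 1.
Proof. by rewrite card_ord dnum0. Qed.

Lemma edge_src_surj i (v : 'I_(dnum D i)) : exists e : dedge i, edge_src e = v.
Proof.
have vin : nat_of_ord v \in dword D i 0 by apply: dword_full; rewrite ?dnum_gt0.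
have [|e [ew ek]] := @edge_ex i 0 (index (nat_of_ord v) (dword D i 0)) (dnum_gt0 D i.+1).
  by rewrite index_mem.
by exists e; apply/val_inj; rewrite [val _]edge_src_nth ew ek nth_index.
Qed.

Lemma dword_size i w : w < dnum D i.+1 -> 0 < size (dword D i w).
Proof.
move=> hw; have := dword_full hw (dnum_gt0 D i).
by case: (dword D i w).
Qed.

Lemma edge_rng_surj i (v : 'I_(dnum D i.+1)) :
  exists e : dedge i, edge_rng e = v.
Proof.
have [e [ew _]] := edge_ex (ltn_ord v) (dword_size (ltn_ord v)).
by exists e; apply/val_inj.
Qed.

Definition ddiag : bratteli_diagram :=
  @BratteliDiagram (fun i => 'I_(dnum D i)) dedge edge_src edge_rng dtop
    edge_src_surj edge_rng_surj.

Definition edge_le i : rel (dedge i) :=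
  fun e f => (edge_rng e == edge_rng f) && (edge_pos e <= edge_pos f).

Lemma edge_le_refl i : reflexive (@edge_le i).
Proof. by move=> e; rewrite /edge_le eqxx leqnn. Qed.

Lemma edge_le_anti i : antisymmetric (@edge_le i).
Proof.
move=> e f /andP[/andP[/eqP ef pef] /andP[_ pfe]]; apply: edge_inj.
  by rewrite ef.
by apply/eqP; rewrite eqn_leq pef.
Qed.

Lemma edge_le_trans i : transitive (@edge_le i).
Proof.
move=> f e g /andP[/eqP ef pef] /andP[/eqP fg pfg].
by rewrite /edge_le ef fg eqxx (leq_trans pef).
Qed.

Lemma edge_le_total i (e f : dedge i) :
  edge_le e f || edge_le f e = (edge_rng e == edge_rng f).
Proof.
rewrite /edge_le [edge_rng f == _]eq_sym -andb_orr.
by rewrite leq_total andbT.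
Qed.

Definition dorder : ordered_bratteli :=
  @OrderedBratteli ddiag edge_le edge_le_refl edge_le_anti edge_le_trans
    edge_le_total.

Lemma minimal_edgeP i (e : dedge i) :
  @minimal_edge dorder i e <-> edge_pos e = 0.
Proof.
split=> [mine|e0 f /= fe]; last by rewrite /edge_le e0 fe eqxx.
have [f [fw fk]] := edge_ex (ltn_ord (edge_rng e)) (dword_size (ltn_ord (edge_rng e))).
have /mine : @brng dorder i f = @brng dorder i e by apply/val_inj.
by rewrite /= /edge_le fk leqn0 => /andP[_ /eqP].
Qed.

Lemma maximal_edgeP i (e : dedge i) :
  @maximal_edge dorder i e <->
  (edge_pos e).+1 = size (dword D i (edge_rng e)).
Proof.
split=> [maxe|eS f /= fe]; last first.
  by rewrite /edge_le fe eqxx /= -ltnS eS -fe edge_pos_lt.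
have s0 := dword_size (ltn_ord (edge_rng e)).
have [|f [fw fk]] := @edge_ex i (edge_rng e)
  (size (dword D i (edge_rng e))).-1 (ltn_ord (edge_rng e)).
  by rewrite prednK.
have /maxe : @brng dorder i f = @brng dorder i e by apply/val_inj.
rewrite /= /edge_le fk => /andP[_]; rewrite -ltnS prednK // => h.
by apply/eqP; rewrite eqn_leq h edge_pos_lt.
Qed.

Lemma successor_edgeP i (e f : dedge i) :
  edge_rng e = edge_rng f :> nat -> edge_pos f = (edge_pos e).+1 ->
  @successor_edge dorder i e f.
Proof.
move=> ef pf; have efo : edge_rng e = edge_rng f by apply/val_inj.
split.
- by rewrite /= /edge_le efo eqxx pf leqnSn.
- by move=> fe; move: pf; rewrite fe => /n_Sn.
- move=> g /= /andP[/eqP eg peg] ge; rewrite /edge_le -efo eg eqxx pf /=.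
  rewrite ltn_neqAle peg andbT; apply/eqP => pge; apply: ge.
  by apply: edge_inj; rewrite ?eg.
Qed.

Local Notation P := (path_space dorder).

Definition vtx (x : P) (n : nat) : nat := edge_src (path_edge x n).
Definition pos (x : P) (n : nat) : nat := edge_pos (path_edge x n).

Lemma vtx_rng (x : P) n : edge_rng (path_edge x n) = vtx x n.+1 :> nat.
Proof.
have := set_mem (valP x) n => /(congr1 (@nat_of_ord _)).
exact.
Qed.

Lemma vtx_lt (x : P) n : vtx x n < dnum D n. Proof. exact: ltn_ord. Qed.

Lemma pos_lt (x : P) n : pos x n < size (dword D n (vtx x n.+1)).
Proof. by rewrite -vtx_rng edge_pos_lt. Qed.

Lemma vtxE (x : P) n : vtx x n = nth 0 (dword D n (vtx x n.+1)) (pos x n).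
Proof. by rewrite -vtx_rng -edge_src_nth. Qed.

Lemma path_edge_eq (x y : P) n : vtx x n.+1 = vtx y n.+1 -> pos x n = pos y n ->
  path_edge x n = path_edge y n.
Proof. by rewrite -!vtx_rng => *; apply: edge_inj. Qed.

Lemma path_eq (x y : P) : (forall n, vtx x n.+1 = vtx y n.+1) ->
  (forall n, pos x n = pos y n) -> x = y.
Proof.
move=> vxy pxy; apply/val_inj/functional_extensionality_dep => n.
exact: path_edge_eq.
Qed.

Lemma path_ex (v p : nat -> nat) :
  (forall n, v n.+1 < dnum D n.+1) ->
  (forall n, p n < size (dword D n (v n.+1))) ->
  (forall n, v n = nth 0 (dword D n (v n.+1)) (p n)) ->
  exists x : P, (forall n, vtx x n = v n) /\ (forall n, pos x n = p n).
Proof.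
move=> vlt plt vE.
pose e n : dedge n := projT1 (cid (edge_ex (vlt n) (plt n))).
have eE n : edge_rng (e n) = v n.+1 :> nat /\ edge_pos (e n) = p n.
  by rewrite /e; case: cid.
have vS n : edge_src (e n) = v n :> nat.
  by rewrite edge_src_nth (eE n).1 (eE n).2 -vE.
have ep : path_set (B := dorder) e.
  by move=> n; apply/val_inj; exact: etrans (eE n).1 (esym (vS n.+1)).
by exists (SigSub (mem_set ep)); split=> n; [exact: vS|exact: (eE n).2].
Qed.

Lemma near_edge (x : P) n : \forall y \near x, path_edge y n = path_edge x n.
Proof. exact: (near_val_coord x n). Qed.

Lemma loc_const_vtx n : loc_const (vtx ^~ n).
Proof. by move=> x; move: (near_edge x n); apply: filterS => y; rewrite /vtx => ->. Qed.

Lemma loc_const_pos n : loc_const (pos ^~ n).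
Proof. by move=> x; move: (near_edge x n); apply: filterS => y; rewrite /pos => ->. Qed.

(** The number of paths from the top vertex to [w], by [card_path_to], and the height of the Vershik
    tower of [w]. *)
Fixpoint ht (n w : nat) : nat :=
  if n is n'.+1 then \sum_(u <- dword D n' w) ht n' u else 1.

Definition off (n w k : nat) : nat := \sum_(u <- take k (dword D n w)) ht n u.

Lemma off0 n w : off n w 0 = 0. Proof. by rewrite /off take0 big_nil. Qed.

Lemma offS n w k : k < size (dword D n w) ->
  off n w k.+1 = off n w k + ht n (nth 0 (dword D n w) k).
Proof.
by move=> hk; rewrite /off (take_nth 0) // -cats1 big_cat big_seq1.
Qed.

Lemma off_size n w : off n w (size (dword D n w)) = ht n.+1 w.
Proof. by rewrite /off take_size. Qed.

Lemma off_homo n w j k : j <= k -> off n w j <= off n w k.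
Proof.
move=> jk; rewrite /off -[take k _](cat_take_drop j) take_takel //.
by rewrite big_cat /= leq_addr.
Qed.

Lemma ht_gt0 n w : w < dnum D n -> 0 < ht n w.
Proof.
elim: n w => [|n IHn] w hw //; rewrite -off_size.
have s0 := dword_size hw.
apply: leq_trans (off_homo _ _ s0); rewrite offS // off0.
by apply: IHn; apply: (dword_letter hw); rewrite mem_nth.
Qed.

Lemma off_inj n w j k s t : j < size (dword D n w) -> k < size (dword D n w) ->
  s < ht n (nth 0 (dword D n w) j) -> t < ht n (nth 0 (dword D n w) k) ->
  s + off n w j = t + off n w k -> j = k.
Proof.
have aux a b u v : a < b -> b < size (dword D n w) ->
    u < ht n (nth 0 (dword D n w) a) -> u + off n w a = v + off n w b -> False.
  move=> ab bs ua e; have := off_homo n w ab.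
  rewrite offS ?(ltn_trans ab) //; lia.
move=> js ks sj tk e; have [jk|kj|//] := ltngtP j k.
- by case: (aux _ _ _ _ jk ks sj e).
- by case: (aux _ _ _ _ kj js tk (esym e)).
Qed.

(** The height of [x] in its level-[n] tower: the number of Vershik steps that lead to [x] from the
    path with the same later edges and minimal first [n] edges. *)
Definition tau (n : nat) (x : P) : nat :=
  \sum_(i < n) off i (vtx x i.+1) (pos x i).

Lemma tauS n x : tau n.+1 x = tau n x + off n (vtx x n.+1) (pos x n).
Proof. by rewrite /tau big_ord_recr. Qed.

Lemma tau0 x : tau 0 x = 0. Proof. by rewrite /tau big_ord0. Qed.

Lemma tau_lt n x : tau n x < ht n (vtx x n).
Proof.
elim: n => [|n IHn]; first by rewrite tau0.
rewrite tauS -off_size; have := off_homo n (vtx x n.+1) (pos_lt x n).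
rewrite offS ?pos_lt // -vtxE; lia.
Qed.

Lemma loc_const_tau n : loc_const (tau n).
Proof.
elim: n => [|n IHn].
  have -> : tau 0 = fun=> 0 by apply/funext => x; rewrite tau0.
  exact: loc_const_cst.
have -> : tau n.+1 = fun x => tau n x + off n (vtx x n.+1) (pos x n).
  by apply/funext => x; rewrite tauS.
apply: loc_const2 IHn _; apply: loc_const2 (loc_const_pos n).
exact: loc_const_vtx.
Qed.

Lemma tau_inj n x y : vtx x n = vtx y n -> tau n x = tau n y ->
  forall i, i < n -> vtx x i = vtx y i /\ pos x i = pos y i.
Proof.
elim: n => // n IHn vn; rewrite !tauS => tn.
have pn : pos x n = pos y n.
  apply: (@off_inj n (vtx x n.+1) _ _ (tau n x) (tau n y)).
  - exact: pos_lt.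
  - by rewrite vn pos_lt.
  - by rewrite -vtxE tau_lt.
  - by rewrite vn -vtxE tau_lt.
  - by rewrite tn vn.
have vn' : vtx x n = vtx y n by rewrite (vtxE x) (vtxE y) vn pn.
have tn' : tau n x = tau n y by move: tn; rewrite vn pn => /addIn.
by move=> i; rewrite ltnS leq_eqVlt => /orP[/eqP ->|]; last exact: IHn.
Qed.

Lemma tau_eq0 n x : tau n x = 0 <-> forall i, i < n -> pos x i = 0.
Proof.
elim: n => [|n IHn]; first by rewrite tau0.
rewrite tauS; split=> [t0 i|p0]; last first.
  rewrite (p0 n) // off0 addn0; apply/IHn => i ilt; apply: p0; exact: ltnW.
have [/IHn p0 o0] : tau n x = 0 /\ off n (vtx x n.+1) (pos x n) = 0 by lia.
rewrite ltnS leq_eqVlt => /orP[/eqP ->|]; last exact: p0.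
have [//|pn] := posnP (pos x n).
have := off_homo n (vtx x n.+1) pn; rewrite offS; last first.
  exact: leq_trans pn (ltnW (pos_lt x n)).
have : 0 < ht n (nth 0 (dword D n (vtx x n.+1)) 0).
  apply: ht_gt0; apply: (dword_letter (vtx_lt x n.+1)); apply: mem_nth.
  exact: dword_size (vtx_lt x n.+1).
lia.
Qed.

Definition edge_top (x : P) i : bool :=
  (pos x i).+1 == size (dword D i (vtx x i.+1)).

Lemma tau_top n x : (forall i, i < n -> edge_top x i) ->
  (tau n x).+1 = ht n (vtx x n).
Proof.
elim: n => [|n IHn] tx; first by rewrite tau0.
have := IHn (fun i h => tx i (ltnW h)); rewrite tauS -off_size => e.
rewrite -(eqP (tx n (ltnSn n))) offS ?pos_lt // -vtxE -e; lia.
Qed.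

Definition same_tail n (x y : P) : Prop :=
  forall i, n <= i -> vtx x i.+1 = vtx y i.+1 /\ pos x i = pos y i.

Lemma same_tail_vtx n x y : same_tail n x y -> vtx x n = vtx y n.
Proof. by move=> /(_ n (leqnn n)) [v p]; rewrite (vtxE x) (vtxE y) v p. Qed.

Lemma same_tail_eq n x y : same_tail n x y -> tau n x = tau n y -> x = y.
Proof.
move=> xy txy; have h := tau_inj (same_tail_vtx xy) txy.
apply: path_eq => i; have [lin|lni] := leqP n i.
- exact: (xy i lin).1.
- have [lin'|lin'] := leqP n i.+1; last exact: (h _ lin').1.
  have -> : i.+1 = n by apply/eqP; rewrite eqn_leq lin' andbT.
  exact: same_tail_vtx.
- exact: (xy i lin).2.
- exact: (h i lni).2.
Qed.

Lemma same_tailW m n x y : m <= n -> same_tail m x y -> same_tail n x y.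
Proof. by move=> mn xy i ni; apply: xy; exact: leq_trans ni. Qed.

Lemma same_tail_trans n x y z : same_tail n x y -> same_tail n y z ->
  same_tail n x z.
Proof.
by move=> xy yz i ni; rewrite (xy i ni).1 (xy i ni).2; exact: yz.
Qed.

Lemma same_tail_sym n x y : same_tail n x y -> same_tail n y x.
Proof. by move=> xy i ni; rewrite (xy i ni).1 (xy i ni).2. Qed.

(** Read off word 0, but common to all words of the level by [dword_head]. *)
Definition fst_letter i := head 0 (dword D i 0).

Lemma vtx_bottom (x : P) i : pos x i = 0 -> vtx x i = fst_letter i.
Proof.
move=> p0; rewrite vtxE p0 nth0; apply: dword_head (vtx_lt x i.+1) _.
exact: dnum_gt0.
Qed.

Definition lst_letter i := last 0 (dword D i 0).

Lemma vtx_top (x : P) i : edge_top x i -> vtx x i = lst_letter i.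
Proof.
move=> /eqP pS; rewrite vtxE -[pos x i]/(pos x i).+1.-1 pS nth_last.
by apply: dword_last (vtx_lt x i.+1) _; exact: dnum_gt0.
Qed.

Lemma bottom_path_eq (x y : P) : (forall i, pos x i = 0) ->
  (forall i, pos y i = 0) -> x = y.
Proof.
move=> px py; apply: path_eq => i; last by rewrite px py.
by rewrite !vtx_bottom.
Qed.

Lemma top_path_eq (x y : P) : (forall i, edge_top x i) ->
  (forall i, edge_top y i) -> x = y.
Proof.
move=> tx ty; apply: path_eq => i; first by rewrite !vtx_top.
by apply: succn_inj; rewrite (eqP (tx i)) (eqP (ty i)) !vtx_top.
Qed.

Lemma fst_letter_lt i : fst_letter i < dnum D i.
Proof.
apply: (dword_letter (dnum_gt0 D i.+1)); rewrite /fst_letter -nth0.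
by apply: mem_nth; exact: dword_size (dnum_gt0 D i.+1).
Qed.

Lemma lst_letter_lt i : lst_letter i < dnum D i.
Proof.
apply: (dword_letter (dnum_gt0 D i.+1)); rewrite /lst_letter -nth_last.
apply: mem_nth; rewrite ltn_predL; exact: dword_size (dnum_gt0 D i.+1).
Qed.

Lemma bottom_path_ex : exists x : P, forall i, pos x i = 0.
Proof.
have [|||x [_ px]] := @path_ex fst_letter (fun=> 0); last by exists x.
- by move=> n; exact: fst_letter_lt.
- by move=> n; apply: dword_size; exact: fst_letter_lt.
- move=> n; rewrite nth0; apply: dword_head; rewrite ?dnum_gt0 //.
  exact: fst_letter_lt.
Qed.

Lemma top_path_ex : exists x : P, forall i, edge_top x i.
Proof.
have s0 n : 0 < size (dword D n (lst_letter n.+1)).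
  by apply: dword_size; exact: lst_letter_lt.
have [|||x [vx px]] := @path_ex lst_letter
    (fun n => (size (dword D n (lst_letter n.+1))).-1).
- by move=> n; exact: lst_letter_lt.
- by move=> n; rewrite ltn_predL.
- move=> n; rewrite nth_last; apply: dword_last; rewrite ?dnum_gt0 //.
  exact: lst_letter_lt.
- by exists x => i; rewrite /edge_top vx px prednK.
Qed.

Lemma base_path_ex n (x : P) : exists y : P, same_tail n y x /\ tau n y = 0.
Proof.
have [|||y [vy py]] := @path_ex
    (fun i => if i < n then fst_letter i else vtx x i)
    (fun i => if i < n then 0 else pos x i).
- by move=> i; case: ifP => _; rewrite ?fst_letter_lt ?vtx_lt.
- move=> i; have [lin|lni] := ltnP i n.
    by apply: dword_size; case: ifP => _; rewrite ?fst_letter_lt ?vtx_lt.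
  by rewrite (leq_gtF (leqW lni)) pos_lt.
- move=> i; have [lin|lni] := ltnP i n.
    rewrite nth0; apply: dword_head; rewrite ?dnum_gt0 //.
    by case: ifP => _; rewrite ?fst_letter_lt ?vtx_lt.
  by rewrite (leq_gtF (leqW lni)) -vtxE.
exists y; split; last by apply/tau_eq0 => i lin; rewrite py lin.
by move=> i ni; rewrite vy py (leq_gtF ni) (leq_gtF (leqW ni)).
Qed.

End Directive.

(** * The Vershik map as a homeomorphism *)

Section Vershik.
Local Open Scope nat_scope.
Variable D : directive.
Local Notation P := (path_space (dorder D)).
Implicit Types x y z : P.

Lemma path_hausdorff : hausdorff_space P.
Proof.
apply: (@loc_const_hausdorff P nat (bedge (dorder D))
  (fun n (x : P) => path_edge x n)); first by move=> n x; exact: near_edge.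
move=> x y xy; apply: path_eq => n; rewrite /pos ?xy //.
by rewrite -!vtx_rng xy.
Qed.

Lemma vershik_ex x : exists y,
  ((forall i, edge_top x i) /\ forall i, pos y i = 0) \/
  exists m, [/\ forall i, i < m -> edge_top x i, ~~ edge_top x m,
    forall i, i < m -> pos y i = 0, pos y m = (pos x m).+1 &
    same_tail m.+1 x y].
Proof.
have [tx|/existsNP ntx] := pselect (forall i, edge_top x i).
  by have [y py] := bottom_path_ex D; exists y; left.
have {ntx} ntx : exists m, ~~ edge_top x m by case: ntx => m /negP; exists m.
case: (ex_minnP ntx) => m xm mmin.
have pm : (pos x m).+1 < size (dword D m (vtx x m.+1)).
  by rewrite ltn_neqAle pos_lt andbT.
have tx i : i < m -> edge_top x i.
  by apply: contraTT => /mmin; rewrite leqNgt.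
have ml : nth 0 (dword D m (vtx x m.+1)) (pos x m).+1 < dnum D m.
  by apply: (dword_letter (vtx_lt x m.+1)); rewrite mem_nth.
have [|||y [vy py]] := @path_ex D
  (fun i => if m < i then vtx x i else
    if i == m then nth 0 (dword D m (vtx x m.+1)) (pos x m).+1
    else fst_letter D i)
  (fun i => if m < i then pos x i else if i == m then (pos x m).+1 else 0).
- move=> i; case: ifP => _; first exact: vtx_lt.
  by case: eqP => [->|_]; [exact: ml|exact: fst_letter_lt].
- move=> i; case: (ltngtP m i) => [mi|im|<-]; last by rewrite ltnSn.
    by rewrite (ltn_trans mi) // pos_lt.
  apply: dword_size; case: ifP => [|_]; first by rewrite vtx_lt.
  by case: eqP => [->|_]; [exact: ml|exact: fst_letter_lt].
- move=> i; case: (ltngtP m i) => [mi|im|<-]; last by rewrite ltnSn.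
    by rewrite (ltn_trans mi) // -vtxE.
  rewrite nth0; apply: dword_head; rewrite ?dnum_gt0 //.
  case: ifP => [|_]; first by rewrite vtx_lt.
  by case: eqP => [->|_]; [exact: ml|exact: fst_letter_lt].
exists y; right; exists m; split => //.
- by move=> i im; rewrite py (leq_gtF (ltnW im)) (ltn_eqF im).
- by rewrite py ltnn eqxx.
- by move=> i mi; rewrite vy py mi (leqW mi).
Qed.

Definition vmap x : P := projT1 (cid (vershik_ex x)).

Lemma vmap_top x : (forall i, edge_top x i) -> forall i, pos (vmap x) i = 0.
Proof.
rewrite /vmap; case: cid => y /= [[]//|[m [_ ntx _ _ _]]] tx.
by rewrite tx in ntx.
Qed.

Lemma vmap_ntop x m : (forall i, i < m -> edge_top x i) -> ~~ edge_top x m ->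
  [/\ forall i, i < m -> pos (vmap x) i = 0, pos (vmap x) m = (pos x m).+1 &
    same_tail m.+1 x (vmap x)].
Proof.
rewrite /vmap; case: cid => y /= [[tx _] _ /negP|]; first by case.
move=> [m' [tx' nx' py pm xy]] tx nx.
suff -> : m = m' by [].
case: (ltngtP m m') => // [/tx'|/tx] h; first by rewrite h in nx.
by rewrite h in nx'.
Qed.

Lemma vmap_cases n x :
  ((forall i, i < n -> edge_top x i) /\ forall i, i < n -> pos (vmap x) i = 0) \/
  (same_tail n x (vmap x) /\ tau n (vmap x) = (tau n x).+1).
Proof.
have [tx|/existsNP ntx] := pselect (forall i, edge_top x i).
  by left; split=> i _; [exact: tx|exact: vmap_top].
have {ntx} ntx : exists m, ~~ edge_top x m by case: ntx => m /negP; exists m.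
case: (ex_minnP ntx) => m xm mmin.
have tx i : i < m -> edge_top x i.
  by apply: contraTT => /mmin; rewrite leqNgt.
have [p0 pm xy] := vmap_ntop tx xm.
have [nm|mn] := leqP n m.
  by left; split=> i im; [apply: tx|apply: p0]; exact: leq_trans nm.
right; split; first exact: same_tailW xy.
(* The carry: the maximal initial segment has height one less than its tower, so one more step is
   exactly the offset of the next block. *)
have tm : tau m.+1 (vmap x) = (tau m.+1 x).+1.
  have vm : vtx (vmap x) m.+1 = vtx x m.+1 by rewrite (same_tail_vtx xy).
  have pmx : pos x m < size (dword D m (vtx x m.+1)) by exact: pos_lt.
  rewrite !tauS (tau_eq0 m _).2 // vm pm offS // -vtxE -tau_top //; lia.
elim: n mn => // n IHn; rewrite ltnS leq_eqVlt => /orP[/eqP <- //|mn].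
by rewrite !tauS IHn // (xy n mn).1 (xy n mn).2 addSn.
Qed.

Definition below_top n x : bool := (tau n x).+1 < ht D n (vtx x n).

Lemma vmap_below n x : below_top n x ->
  same_tail n x (vmap x) /\ tau n (vmap x) = (tau n x).+1.
Proof.
rewrite /below_top; case: (vmap_cases n x) => // -[tx _].
by rewrite tau_top // ltnn.
Qed.

Lemma vmap_above n x : ~~ below_top n x -> tau n (vmap x) = 0.
Proof.
rewrite /below_top; case: (vmap_cases n x) => [[_ p0] _|[xy <-]].
  exact/tau_eq0.
by rewrite (same_tail_vtx xy) tau_lt.
Qed.

Lemma edge_topP n x : (forall i, i < n -> edge_top x i) <-> ~~ below_top n x.
Proof.
split=> [tx|nb]; first by rewrite /below_top tau_top // ltnn.
case: (vmap_cases n x) => [[]//|[xy txy]].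
by have := vmap_above nb; rewrite txy.
Qed.

Lemma vmap_vershik : is_vershik_map vmap.
Proof.
split=> [x mx i|x k mx nk].
  apply/minimal_edgeP; apply: vmap_top => j.
  by have /maximal_edgeP := mx j; rewrite vtx_rng => /eqP.
have [||p0 pk xy] := @vmap_ntop x k.
- by move=> i /mx /maximal_edgeP; rewrite vtx_rng => /eqP.
- by apply/eqP => tk; apply: nk; apply/maximal_edgeP; rewrite vtx_rng.
split.
- by move=> j /p0 pj; apply/minimal_edgeP.
- by apply: successor_edgeP pk; rewrite !vtx_rng (same_tail_vtx xy).
- move=> j kj; apply/esym/path_edge_eq; [exact: (xy j kj).1|exact: (xy j kj).2].
Qed.

Lemma iter_vmap n t x : tau n x + t < ht D n (vtx x n) ->
  same_tail n x (iter t vmap x) /\ tau n (iter t vmap x) = tau n x + t.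
Proof.
elim: t => [|t IHt] h; first by rewrite addn0.
have [|xy txy] := IHt; first by rewrite -addnS ltnW // addnS.
have [|xy' txy'] := @vmap_below n (iter t vmap x).
  by rewrite /below_top txy -(same_tail_vtx xy) -addnS.
by split; [exact: same_tail_trans xy xy'|rewrite iterS txy' txy addnS].
Qed.

Lemma vmap_inj x y : vmap x = vmap y -> x = y.
Proof.
move=> e; have top z z' : (forall i, edge_top z i) -> vmap z = vmap z' ->
    forall i, edge_top z' i.
  move=> tz zz'; apply: contrapT => /existsNP /= ntx.
  have {ntx} ntx : exists m, ~~ edge_top z' m by case: ntx => m /negP; exists m.
  case: (ex_minnP ntx) => m xm mmin.
  have [|//|_ pm _] := @vmap_ntop z' m.
    by move=> i; apply: contraTT => /mmin; rewrite leqNgt.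
  by have := vmap_top tz m; rewrite zz' pm.
have [tx|/existsNP [n /negP nx]] := pselect (forall i, edge_top x i).
  exact: top_path_eq tx (top _ _ tx e).
have [ty|/existsNP [m /negP my]] := pselect (forall i, edge_top y i).
  exact: top_path_eq (top _ _ ty (esym e)) ty.
(* Two paths that are not maximal lie below the top at a common level, where the map keeps the tail
   and raises the height by one. *)
pose k := (maxn n m).+1.
have bx : below_top k x.
  by apply: contraNT nx => /edge_topP; apply; rewrite ltnS leq_maxl.
have by_ : below_top k y.
  by apply: contraNT my => /edge_topP; apply; rewrite ltnS leq_maxr.
have [xx tx] := vmap_below bx; have [yy ty] := vmap_below by_.
apply: (@same_tail_eq D k).
  by apply: same_tail_trans xx _; rewrite e; exact: same_tail_sym.
by apply: succn_inj; rewrite -tx -ty e.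
Qed.

Lemma vmap_surj y : exists x, vmap x = y.
Proof.
have [p0|/existsNP [n pn]] := pselect (forall i, pos y i = 0).
  have [x tx] := top_path_ex D; exists x.
  exact: bottom_path_eq (vmap_top tx) p0.
have t0 : 0 < tau n.+1 y.
  rewrite lt0n; apply/eqP => /tau_eq0 h; apply: pn; exact: h.
have [z [zy tz]] := base_path_ex n.+1 y.
have hy : tau n.+1 z + (tau n.+1 y).-1.+1 < ht D n.+1 (vtx z n.+1).
  by rewrite tz prednK // (same_tail_vtx zy) tau_lt.
have [zw tw] := iter_vmap hy.
exists (iter (tau n.+1 y).-1 vmap z); apply: (@same_tail_eq D n.+1).
  exact: same_tail_trans (same_tail_sym zw) zy.
by rewrite -iterS tw tz prednK.
Qed.

(** Vertex and height at level [i.+2] decide edge [i] of the image. Level [i.+1] would be too low,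
    because on a carry the range of the edge, a vertex of level [i.+1], changes as well. *)
Lemma loc_const_vmap_edge i : loc_const (fun x => path_edge (vmap x) i).
Proof.
move=> x.
have [nb|/negbNE bx] := boolP (~~ below_top i.+2 x).
  move: (@loc_const_tau D i.+2 x) (@loc_const_vtx D i.+2 x).
  apply: filterS2 => y ty vy.
  have nby : ~~ below_top i.+2 y by rewrite /below_top ty vy.
  have pz z : ~~ below_top i.+2 z -> forall j, j < i.+2 -> pos (vmap z) j = 0.
    by move=> /vmap_above /tau_eq0.
  by apply: path_edge_eq; rewrite ?pz // !vtx_bottom ?pz.
move: (@loc_const_tau D i.+2 x) (@loc_const_vtx D i.+2 x).
apply: filterS2 => y ty vy.
have by_ : below_top i.+2 y by rewrite /below_top ty vy.
have [xx tx] := vmap_below bx; have [yy ty'] := vmap_below by_.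
have vv : vtx (vmap y) i.+2 = vtx (vmap x) i.+2.
  by rewrite -(same_tail_vtx xx) -(same_tail_vtx yy).
have tt : tau i.+2 (vmap y) = tau i.+2 (vmap x) by rewrite ty' tx ty.
have h := tau_inj vv tt.
by apply: path_edge_eq; [exact: (h i.+1 _).1|exact: (h i (leqnSn _)).2].
Qed.

Lemma vmap_continuous : continuous vmap.
Proof.
apply: (@continuous_comp_initial _ P _ set_val vmap).
exact: continuous_coords (fun i => loc_const_vmap_edge i).
Qed.

Lemma vmap_homeo : compact [set: P] ->
  exists V : homeomorphism P P, forall x, V x = vmap x.
Proof.
move=> cP; exact: (compact_bij_homeo cP path_hausdorff vmap_continuous
  vmap_inj vmap_surj).
Qed.

End Vershik.

Section Tails.
Local Open Scope nat_scope.
Variable D : directive.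
Local Notation P := (path_space (dorder D)).
Implicit Types x y z : P.
Variable V : homeomorphism P P.
Hypothesis VE : forall x, V x = vmap x.

Lemma iter_VE n x : iter n V x = iter n (@vmap D) x.
Proof. by elim: n => // n IHn; rewrite !iterS IHn VE. Qed.

(** Both points are forward iterates of the base path that shares their tail. *)
Lemma same_tail_iterZ n x y : same_tail n x y ->
  y = iterZ V ((tau n y)%:Z - (tau n x)%:Z)%R x.
Proof.
move=> xy; have [z [zx tz]] := base_path_ex n x.
have zE w : same_tail n z w -> w = iterZ V (tau n w) z.
  move=> zw; have hw : tau n z + tau n w < ht D n (vtx z n).
    by rewrite tz (same_tail_vtx zw) tau_lt.
  have [zw' tw'] := iter_vmap hw.
  rewrite iterZ_nat iter_VE; apply: (same_tail_eq (n := n)).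
    exact: same_tail_trans (same_tail_sym zw) zw'.
  by rewrite tw' tz.
transitivity (iterZ V ((tau n y)%:Z - (tau n x)%:Z)%R (iterZ V (tau n x) z)).
  by rewrite -iterZD subrK; exact: zE (same_tail_trans zx xy).
by congr (iterZ V _ _); apply/esym; exact: zE.
Qed.

Lemma path_tail_structure (xm : P) : (forall i, edge_top xm i) ->
  tail_structure V (@same_tail D) (@tau D) (@below_top D) xm.
Proof.
move=> tm; split.
- exact: loc_const_tau.
- move=> n; apply: (loc_const2 (fun t v => t.+1 < ht D n v)).
    exact: loc_const_tau.
  exact: loc_const_vtx.
- exact: same_tail_iterZ.
- by move=> n x /vmap_below [xx _]; rewrite VE.
- by move=> n; apply/negbTE/edge_topP => i _.
- move=> x xm_; have [tx|/existsNP [n /negP nx]] := pselect (forall i, edge_top x i).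
    by case: xm_; exact: top_path_eq.
  exists n.+1; apply: contraNT nx => /edge_topP; apply; exact: ltnSn.
Qed.

End Tails.

(** * Recognizability of the coding by first edges *)

Section Coding.
Local Open Scope nat_scope.
Variable D : directive.
Local Notation P := (path_space (dorder D)).
Implicit Types x y z b : P.
Variable V : homeomorphism P P.
Hypothesis VE : forall x, V x = vmap x.

Lemma iter_V n t x : tau n x + t < ht D n (vtx x n) ->
  same_tail n x (iter t V x) /\ tau n (iter t V x) = tau n x + t.
Proof. by move=> h; rewrite (iter_VE VE); exact: iter_vmap. Qed.

Lemma iter_V_back n t x : t <= tau n x ->
  same_tail n x (iterZ V (- t%:Z)%R x) /\
  tau n (iterZ V (- t%:Z)%R x) = tau n x - t.
Proof.
move=> tx; have [z [zx tz]] := base_path_ex n x.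
have := same_tail_iterZ VE zx; rewrite tz subr0 => xE.
have -> : iterZ V (- t%:Z)%R x = iter (tau n x - t) V z.
  by rewrite xE -iterZD -iterZ_nat; congr iterZ; rewrite -xE; lia.
have [|zz' tz'] := @iter_V n (tau n x - t) z.
  by rewrite tz (same_tail_vtx zx) (leq_ltn_trans (leq_subr _ _)) // tau_lt.
by split; [exact: same_tail_trans (same_tail_sym zx) zz'|rewrite tz' tz].
Qed.

Lemma iter_V_end n x : tau n x = 0 -> tau n (iter (ht D n (vtx x n)) V x) = 0.
Proof.
move=> tx; have h0 := ht_gt0 (vtx_lt x n).
rewrite -(prednK h0) iterS VE; apply: vmap_above.
have [|xx' tx'] := @iter_V n (ht D n (vtx x n)).-1 x.
  by rewrite tx prednK.
by rewrite /below_top tx' tx -(same_tail_vtx xx') add0n prednK // ltnn.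
Qed.

Lemma cell_pos n z q t : q < size (dword D n (vtx z n.+1)) ->
  t < ht D n (nth 0 (dword D n (vtx z n.+1)) q) ->
  tau n.+1 z = off D n (vtx z n.+1) q + t ->
  [/\ pos z n = q, tau n z = t & vtx z n = nth 0 (dword D n (vtx z n.+1)) q].
Proof.
move=> hq ht_; rewrite tauS => e.
have pq : pos z n = q.
  apply: (@off_inj D n (vtx z n.+1) _ _ (tau n z) t) => //.
  - exact: pos_lt.
  - by rewrite -vtxE tau_lt.
  - by rewrite e addnC.
split=> //; last by rewrite -pq -vtxE.
by apply/(@addIn (off D n (vtx z n.+1) q)); rewrite -[in LHS]pq e addnC.
Qed.

Lemma cell_iter n b q t : tau n.+1 b = 0 ->
  q < size (dword D n (vtx b n.+1)) ->
  t < ht D n (nth 0 (dword D n (vtx b n.+1)) q) ->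
  let z := iter (off D n (vtx b n.+1) q + t) V b in
  [/\ same_tail n.+1 b z, pos z n = q, tau n z = t &
    vtx z n = nth 0 (dword D n (vtx b n.+1)) q].
Proof.
move=> tb hq ht_ z.
have hz : tau n.+1 b + (off D n (vtx b n.+1) q + t) < ht D n.+1 (vtx b n.+1).
  rewrite tb add0n; apply: leq_trans (_ : off D n (vtx b n.+1) q.+1 <= _).
    by rewrite offS // ltn_add2l.
  by rewrite -off_size; exact: off_homo.
have [bz tz] := iter_V hz.
have vz : vtx z n.+1 = vtx b n.+1 by rewrite (same_tail_vtx bz).
have [|||pz tz' vz'] := @cell_pos n z q t; rewrite ?vz //.
  by rewrite tz tb.
by split=> //; rewrite vz' vz.
Qed.

Lemma tower_itinerary (I : Type) (f : P -> I) n b : tau n.+1 b = 0 ->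
  [seq f (iter s V b) | s <- iota 0 (ht D n.+1 (vtx b n.+1))] =
  flatten [seq [seq f (iter (off D n (vtx b n.+1) q + t) V b) |
      t <- iota 0 (ht D n (nth 0 (dword D n (vtx b n.+1)) q))]
    | q <- iota 0 (size (dword D n (vtx b n.+1)))].
Proof.
move=> tb; rewrite -off_size; set w := vtx b n.+1.
have : size (dword D n w) <= size (dword D n w) by [].
elim: {1 3 4}(size (dword D n w)) => [|q IHq] hq; first by rewrite off0.
rewrite offS // iotaD map_cat IHq 1?ltnW // -addn1 iotaD map_cat flatten_cat /=.
rewrite cats0 add0n; congr cat; rewrite [X in iota X _]add0n -[X in iota X _]addn0.
by rewrite iotaDl -map_comp.
Qed.

(** Recovers the word of a vertex from vertices and heights one level below, along the orbit of a
    base point; recognition then identifies the vertex by [marked_inj]. *)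
Lemma dword_itinerary n b : tau n.+1 b = 0 ->
  flatten [seq if tau n (iter s V b) == 0 then [:: vtx (iter s V b) n] else [::]
    | s <- iota 0 (ht D n.+1 (vtx b n.+1))] = dword D n (vtx b n.+1).
Proof.
move=> tb; rewrite (tower_itinerary (fun z => if tau n z == 0 then [:: vtx z n] else [::])) //.
set w := vtx b n.+1.
have key q : q \in iota 0 (size (dword D n w)) ->
    flatten [seq (fun z => if tau n z == 0 then [:: vtx z n] else [::])
        (iter (off D n w q + t) V b)
      | t <- iota 0 (ht D n (nth 0 (dword D n w) q))] =
    [:: nth 0 (dword D n w) q].
  rewrite mem_iota /= add0n => hq.
  have h0 : 0 < ht D n (nth 0 (dword D n w) q).
    apply: ht_gt0; apply: (dword_letter (vtx_lt b n.+1)); exact: mem_nth.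
  rewrite -[in iota _ _](prednK h0) /=.
  have [_ _ -> ->] := cell_iter tb hq h0; rewrite eqxx /=; congr cons.
  have : forall t, t \in iota 1 (ht D n (nth 0 (dword D n w) q)).-1 ->
      tau n (iter (off D n w q + t) V b) != 0.
    move=> t; rewrite mem_iota add1n prednK // => /andP[t0 tlt].
    by have [_ _ -> _] := cell_iter tb hq tlt; rewrite -lt0n.
  elim: (iota _ _) => //= t s IHs hs; rewrite ifN ?hs ?mem_head //.
  by apply: IHs => u us; apply: hs; rewrite inE us orbT.
rewrite -[RHS](mkseq_nth 0) /mkseq.
elim: (iota _ _) key => //= q s IHs key.
rewrite flatten_cat key ?mem_head //= IHs // => u us.
by apply: key; rewrite inE us orbT.
Qed.

End Coding.

(* The two-letter pattern [Z O] occurs exactly at the beginning of each word, so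
   that the cutting points into words can be read off locally. *)
Record marked_words (D : directive) (Z O : nat -> nat -> bool) : Prop :=
  MarkedWords {
  marked_size : forall n w, (w < dnum D n.+2)%N -> (1 < size (dword D n.+1 w))%N;
  marked_start : forall n w q, (w < dnum D n.+2)%N ->
    (q.+1 < size (dword D n.+1 w))%N ->
    Z n (nth 0%N (dword D n.+1 w) q) && O n (nth 0%N (dword D n.+1 w) q.+1) =
      (q == 0%N);
  marked_last : forall n w, (w < dnum D n.+2)%N ->
    ~~ Z n (last 0%N (dword D n.+1 w));
  marked_inj : forall n w w', (w < dnum D n.+2)%N -> (w' < dnum D n.+2)%N ->
    dword D n.+1 w = dword D n.+1 w' -> w = w' }.

Section Recognizability.
Local Open Scope nat_scope.
Variables (D : directive) (Z O : nat -> nat -> bool).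
Hypothesis DM : marked_words D Z O.
Local Notation P := (path_space (dorder D)).
Implicit Types x y z b : P.
Variable V : homeomorphism P P.
Hypothesis VE : forall x, V x = vmap x.

(** The next letter is seen after crossing the current tower. If it belongs to the same word,
    [marked_start] decides. If the current letter ends its word, it is not of type [Z] by
    [marked_last], and it is not first because the word has at least two letters. *)
Lemma base_marker n z : (tau n.+2 z == 0) =
  [&& tau n.+1 z == 0, Z n (vtx z n.+1) &
    O n (vtx (iter (ht D n.+1 (vtx z n.+1)) V z) n.+1)].
Proof.
have hw := vtx_lt z n.+2; set w := vtx z n.+2.
have [t0|tn0] := eqVneq (tau n.+1 z) 0; last first.
  by apply: contraNF tn0 => /eqP; rewrite tauS; lia.
have -> : (tau n.+2 z == 0) = (pos z n.+1 == 0).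
  apply/eqP/eqP => [/tau_eq0 -> //|p0]; by rewrite tauS t0 p0 off0.
rewrite /= [X in Z n X]vtxE -/w.
have pz := pos_lt z n.+1; rewrite -/w in pz.
have [pS|] := ltnP (pos z n.+1).+1 (size (dword D n.+1 w)).
  rewrite -(marked_start DM hw pS) -/w; congr (_ && O n _).
  have t2 : tau n.+2 z = off D n.+1 w (pos z n.+1) by rewrite tauS t0.
  have h2 : 0 < ht D n.+1 (nth 0 (dword D n.+1 w) (pos z n.+1).+1).
    by apply: ht_gt0; apply: (dword_letter hw); apply: mem_nth.
  have [|zz' tz'] := @iter_V D V VE n.+2 (ht D n.+1 (vtx z n.+1)) z.
    rewrite t2 [X in ht _ _ X]vtxE -/w -offS // -off_size.
    apply: leq_trans (off_homo D n.+1 w pS); rewrite [X in _ < X]offS //.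
    by rewrite -[X in X < _]addn0 ltn_add2l.
  set z' := iter _ V z in zz' tz' *.
  have vz' : vtx z' n.+2 = w by rewrite -(same_tail_vtx zz').
  have [|||_ _ ->] := @cell_pos D n.+1 z' (pos z n.+1).+1 0; rewrite ?vz' //.
  by rewrite tz' t2 [X in ht _ _ X]vtxE -/w -offS // addn0.
move=> h; have eS : size (dword D n.+1 w) = (pos z n.+1).+1.
  by apply/eqP; rewrite eqn_leq h pz.
have := marked_last DM hw; rewrite -nth_last eS /= => /negbTE ->.
rewrite andFb; apply/negbTE; rewrite -lt0n -ltnS -eS; exact: (marked_size DM hw).
Qed.

(** Induction on the level, along the whole orbit: lower data give the base times by [base_marker],
    these give heights and tower lengths, and the word read over one tower gives the vertex. *)
Lemma path_edge_recognizable x y :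
  (forall k, path_edge (iterZ V k x) 0 = path_edge (iterZ V k y) 0) ->
  forall n k, vtx (iterZ V k x) n.+1 = vtx (iterZ V k y) n.+1 /\
              tau n.+1 (iterZ V k x) = tau n.+1 (iterZ V k y).
Proof.
move=> e0; elim=> [|n IHn] k.
  (* Level 1 is visible in the symbols: an edge of level 0 carries its range and its position. *)
  by rewrite !tauS !tau0 /pos -!vtx_rng e0.
have base j : (tau n.+2 (iterZ V j x) == 0) = (tau n.+2 (iterZ V j y) == 0).
  rewrite !base_marker (IHn j).1 (IHn j).2; congr [&& _, _ & O n _].
  by rewrite -!iterZ_nat -!iterZD; exact: (IHn _).1.
(* The height is the time elapsed since the last base. *)
have back u v : (forall j, (tau n.+2 (iterZ V j u) == 0) =
    (tau n.+2 (iterZ V j v) == 0)) -> tau n.+2 v <= tau n.+2 u.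
  move=> buv; have [_ tu] := iter_V_back VE (leqnn (tau n.+2 u)).
  rewrite leqNgt; apply/negP => uv.
  have [_ tv] := iter_V_back VE (ltnW uv).
  have := buv (- (tau n.+2 u)%:Z)%R; rewrite tu tv subnn eqxx.
  by move/esym; rewrite subn_eq0 leqNgt uv.
have basek j : (tau n.+2 (iterZ V j (iterZ V k x)) == 0) =
               (tau n.+2 (iterZ V j (iterZ V k y)) == 0).
  by rewrite -!iterZD base.
have tk : tau n.+2 (iterZ V k x) = tau n.+2 (iterZ V k y).
  by apply/eqP; rewrite eqn_leq !back.
split=> //; set t := tau n.+2 (iterZ V k x) in tk.
have [sx tx] := iter_V_back VE (leqnn (tau n.+2 (iterZ V k x))).
have [sy ty] := iter_V_back VE (leqnn (tau n.+2 (iterZ V k y))).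
rewrite (same_tail_vtx sx) (same_tail_vtx sy) -tk -/t.
rewrite -/t subnn in tx; rewrite -tk subnn in ty.
rewrite -!iterZD in tx ty *; set j := (- t%:Z + k)%R in tx ty *.
set x' := iterZ V j x in tx *; set y' := iterZ V j y in ty *.
have it m : vtx (iter m V x') n.+1 = vtx (iter m V y') n.+1 /\
            tau n.+1 (iter m V x') = tau n.+1 (iter m V y').
  by rewrite -!iterZ_nat -!iterZD; exact: IHn.
(* The height of the whole tower is the time from one base to the next. *)
have hle u v : tau n.+2 u = 0 -> tau n.+2 v = 0 ->
    (forall m, (tau n.+2 (iter m V u) == 0) = (tau n.+2 (iter m V v) == 0)) ->
    ht D n.+2 (vtx v n.+2) <= ht D n.+2 (vtx u n.+2).
  move=> tu tv buv; rewrite leqNgt; apply/negP => uv.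
  have := buv (ht D n.+2 (vtx u n.+2)); rewrite iter_V_end // eqxx => /esym.
  have [|_ ->] := @iter_V D V VE n.+2 (ht D n.+2 (vtx u n.+2)) v.
    by rewrite tv.
  by rewrite tv add0n gtn_eqF // ht_gt0 // vtx_lt.
have bit m : (tau n.+2 (iter m V x') == 0) = (tau n.+2 (iter m V y') == 0).
  by rewrite -!iterZ_nat -!iterZD base.
apply: (marked_inj DM) (vtx_lt _ _) (vtx_lt _ _) _.
rewrite -(dword_itinerary VE tx) -(dword_itinerary VE ty).
have -> : ht D n.+2 (vtx x' n.+2) = ht D n.+2 (vtx y' n.+2).
  by apply/eqP; rewrite eqn_leq !hle.
by congr flatten; apply: eq_map => m; rewrite (it m).1 (it m).2.
Qed.

Lemma code_inj x y :
  (forall k, path_edge (iterZ V k x) 0 = path_edge (iterZ V k y) 0) -> x = y.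
Proof.
move=> /path_edge_recognizable h.
apply: path_eq => n; first exact: (h n 0%R).1.
have [vn tn] := h n.+1 0%R.
exact: (tau_inj vn tn (leqnSn n.+1)).2.
Qed.

End Recognizability.

(** * The coding subshift and its tower words *)

Section CodingSubshift.
Variable D : directive.
Local Notation P := (path_space (dorder D)).
Local Notation A := (dedge D 0).
Implicit Types x y z b : P.
Variable V : homeomorphism P P.
Hypothesis VE : forall x, V x = vmap x.
Hypothesis cP : compact [set: P].

Definition code (x : P) : full_shift A := fun k => path_edge (iterZ V k x) 0.

Lemma code_continuous : continuous code.
Proof.
apply: (@continuous_coords P int (fun=> A) code) => k.
apply: (@loc_const_precomp P P A (iterZ V k) (fun x => path_edge x 0%N)).
  exact: iterZ_continuous.
by move=> x; exact: near_edge.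
Qed.

Lemma code_shift x : Defs.shift (code x) = code (V x).
Proof.
apply/funext => k; rewrite /Defs.shift /code iterZD.
by rewrite -[V x]/(iterZ V 1 x).
Qed.

Lemma full_shift_hausdorff : hausdorff_space (full_shift A).
Proof.
apply: (@loc_const_hausdorff _ int (fun=> A) (fun k (x : full_shift A) => x k)).
  by move=> k x; exact: (near_coord (K := fun=> A)).
by move=> x y xy; apply/funext.
Qed.

Lemma code_closed : closed (range code).
Proof.
apply: compact_closed; first exact: full_shift_hausdorff.
apply: continuous_compact cP; apply: continuous_subspaceT.
exact: code_continuous.
Qed.

Lemma code_invariant : @Defs.shift A @` range code = range code.
Proof.
rewrite eqEsubset; split.
  by move=> _ [_ [x _ <-] <-]; exists (V x) => //; rewrite code_shift.
move=> _ [x _ <-]; exists (code (homeo_inv V x)); first by exists (homeo_inv V x).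
by rewrite code_shift homeo_invK.
Qed.

Definition code_subshift : subshift A := Subshift code_closed code_invariant.

Lemma code_conj : (forall x y, code x = code y -> x = y) ->
  exists psi : homeomorphism P code_subshift,
    forall x, psi (V x) = subshift_system code_subshift (psi x).
Proof.
move=> cinj.
have cY x : subshift_set code_subshift (code x) by exists x.
have hY : hausdorff_space code_subshift.
  apply: (@loc_const_hausdorff _ int (fun=> A)
    (fun k (y : code_subshift) => set_val y k)).
    by move=> k y; exact: (near_val_coord (K := fun=> A)).
  by move=> x y xy; apply/val_inj/funext.
have [|||psi psiE] := @compact_bij_homeo P code_subshift
  (fun x => SigSub (mem_set (cY x))) cP hY.
- apply: (@continuous_comp_initial _ P _ set_val).
  exact: code_continuous.
- by move=> x y /(congr1 set_val) /cinj.
- move=> [y yY]; have [x _ xy] := set_mem yY; exists x.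
  by apply/val_inj.
- exists psi => x; rewrite !psiE; apply/val_inj; exact/esym/code_shift.
Qed.

Local Open Scope nat_scope.

Definition window (x : P) (n : nat) : seq A :=
  [seq path_edge (iter s V x) 0 | s <- iota 0 n].

Lemma size_window x n : size (window x n) = n.
Proof. by rewrite size_map size_iota. Qed.

Lemma nth_window e x n i : i < n -> nth e (window x n) i = path_edge (iter i V x) 0.
Proof. by move=> hi; rewrite (nth_map 0) ?size_iota // nth_iota. Qed.

Lemma windowD x m n : window x (m + n) = window x m ++ window (iter m V x) n.
Proof.
rewrite /window iotaD map_cat add0n; congr cat.
rewrite -[X in iota X _]addn0 iotaDl -map_comp.
by apply: eq_map => s /=; rewrite addnC iterD.
Qed.

Lemma occursP n (w : n.-tuple A) :
  occurs code_subshift w <-> exists x, tval w = window x n.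
Proof.
split=> [[_ [[x _ <-] [k kw]]]|[x wx]].
  exists (iterZ V k x); have e0 := path_edge x 0.
  apply: (@eq_from_nth _ e0); first by rewrite size_tuple size_window.
  move=> i; rewrite size_tuple => hi; rewrite nth_window //.
  by rewrite -(tnth_nth e0 w (Ordinal hi)) -kw /code addrC iterZD.
exists (code x); split; first by exists x.
exists 0%R => i; rewrite add0r /code (tnth_nth (path_edge x 0)) wx nth_window //.
Qed.

Lemma vertex_path_ex n w : w < dnum D n ->
  exists b, vtx b n = w /\ tau n b = 0.
Proof.
move=> hw; pose v m := if m < n then fst_letter D m else if m == n then w else 0.
have vlt m : v m < dnum D m.
  rewrite /v; case: ifP => _; first exact: fst_letter_lt.
  by case: eqP => [->|_] //; exact: dnum_gt0.
pose p m := if m < n then 0 else index (v m) (dword D m (v m.+1)).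
have [//|m|m|b [vb pb]] := @path_ex D v p.
- rewrite /p; case: ifP => _; first exact: dword_size.
  by rewrite index_mem; exact: dword_full.
- rewrite /p; case: ifP => hm; last by rewrite nth_index //; exact: dword_full.
  rewrite {1}/v hm nth0; exact: dword_head (dnum_gt0 _ _) _.
- exists b; rewrite vb /v ltnn eqxx; split=> //.
  by apply/tau_eq0 => i hi; rewrite pb /p hi.
Qed.

Lemma window_tower n b b' : vtx b n.+1 = vtx b' n.+1 ->
  tau n.+1 b = 0 -> tau n.+1 b' = 0 ->
  window b (ht D n.+1 (vtx b n.+1)) = window b' (ht D n.+1 (vtx b' n.+1)).
Proof.
move=> bb' tb tb'; rewrite -bb'; apply/eq_in_map => s; rewrite mem_iota /= => hs.
have [|bs ts] := @iter_V D V VE n.+1 s b; first by rewrite tb.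
have [|bs' ts'] := @iter_V D V VE n.+1 s b'; first by rewrite tb' -bb'.
have vs : vtx (iter s V b) n.+1 = vtx (iter s V b') n.+1.
  by rewrite -(same_tail_vtx bs) -(same_tail_vtx bs').
have tt : tau n.+1 (iter s V b) = tau n.+1 (iter s V b') by rewrite ts ts' tb tb'.
apply: path_edge_eq; last exact: (tau_inj vs tt (ltn0Sn n)).2.
case: n {tb tb' ts ts' bs bs' bb' hs} vs tt => [//|n] vs tt.
exact: (tau_inj vs tt (isT : 1 < n.+2)).1.
Qed.

Definition tower_word n w : seq A :=
  if pselect (w < dnum D n) is left h then
    window (projT1 (cid (vertex_path_ex h))) (ht D n w) else [::].

Lemma tower_wordE n b : tau n.+1 b = 0 ->
  window b (ht D n.+1 (vtx b n.+1)) = tower_word n.+1 (vtx b n.+1).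
Proof.
move=> tb; rewrite /tower_word; case: pselect => [h|]; last by rewrite vtx_lt.
by case: cid => b' /= [vb' tb']; rewrite (window_tower (esym vb') tb tb') vb'.
Qed.

Lemma size_tower_word n w : w < dnum D n -> size (tower_word n w) = ht D n w.
Proof.
by move=> hw; rewrite /tower_word; case: pselect => // h; rewrite size_window.
Qed.

Lemma tower_word_flatten n w : w < dnum D n.+2 ->
  tower_word n.+2 w = flatten [seq tower_word n.+1 u | u <- dword D n.+1 w].
Proof.
move=> hw; have [b [<- tb]] := vertex_path_ex hw.
rewrite -tower_wordE // /window.
rewrite (@tower_itinerary D V _ (fun z => path_edge z 0) _ _ tb).
rewrite -[in RHS](mkseq_nth 0 (dword _ _ _)) /mkseq -map_comp.
congr flatten; apply/eq_in_map => q; rewrite mem_iota /= add0n => hq.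
have h0 : 0 < ht D n.+1 (nth 0 (dword D n.+1 (vtx b n.+2)) q).
  by apply: ht_gt0; apply: (dword_letter (vtx_lt b n.+2)); exact: mem_nth.
have [_ _] := cell_iter VE tb hq h0; rewrite addn0 => tz vz.
rewrite -vz -tower_wordE // /window; apply: eq_map => t.
by rewrite addnC iterD.
Qed.

End CodingSubshift.

(** * Complexity bounds from suffix-free tower words *)

Lemma suffix_cat_le (A : eqType) (r u v : seq A) :
  (size u <= size v)%N -> suffix u (r ++ v) -> suffix u v.
Proof.
move=> uv; rewrite !suffixE size_cat drop_cat.
have -> : (size r + size v - size u < size r)%N = false by lia.
by rewrite (_ : (size r + size v - size u - size r = size v - size u)%N) //; lia.
Qed.

(** Parsing from the right: the last two images are suffix-comparable, so they come from the same
    letter and cancel. *)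
Lemma suffix_flatten (I A : eqType) (f : I -> seq A) (s s' : seq I) :
  (forall u, u \in s -> f u != [::]) ->
  (forall u u', u \in s -> u' \in s' ->
    suffix (f u) (f u') || suffix (f u') (f u) -> u = u') ->
  suffix (flatten (map f s)) (flatten (map f s')) -> suffix s s'.
Proof.
elim/last_ind: s s' => [|s a IHs] s'; first by rewrite suffix0s.
have am : a \in rcons s a by rewrite mem_rcons mem_head.
move=> f0; rewrite map_rcons flatten_rcons.
elim/last_ind: s' => [|s' a' _] ss.
  move=> /size_suffix; rewrite size_cat leqn0 addn_eq0 size_eq0.
  by rewrite (size_eq0 (f a)) (negbTE (f0 a am)) andbF.
rewrite map_rcons flatten_rcons => h.
have am' : a' \in rcons s' a' by rewrite mem_rcons mem_head.
have aa' : a = a'.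
  apply: ss => //; have fah : suffix (f a) (flatten (map f s') ++ f a').
    by apply: suffix_trans h; exact: suffix_suffix.
  have [le|/ltnW le] := leqP (size (f a)) (size (f a')).
    by rewrite (suffix_cat_le le fah).
  case/suffixP: fah => r e; rewrite (@suffix_cat_le _ r (f a')) ?orbT //.
  by rewrite -e suffix_suffix.
subst a'; rewrite suffix_rcons eqxx /=; apply: IHs.
- by move=> u us; apply: f0; rewrite mem_rcons inE us orbT.
- by move=> u u' us us'; apply: ss; rewrite mem_rcons inE ?us ?us' orbT.
- by move: h; rewrite suffix_catl // eqxx.
Qed.

Section Complexity.
Local Open Scope nat_scope.
Variables (D : directive) (Z O : nat -> nat -> bool).
Hypothesis DM : marked_words D Z O.
Local Notation P := (path_space (dorder D)).
Local Notation A := (dedge D 0).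
Implicit Types x y z b : P.
Variable V : homeomorphism P P.
Hypothesis VE : forall x, V x = vmap x.
Hypothesis cP : compact [set: P].
Local Notation Y := (code_subshift V cP).
Local Notation tword := (tower_word V).

(** A proper suffix would put the marker at the start of [w] into the interior of the word of [w'].
    This is why suffixes, and not prefixes, are compared. *)
Lemma dword_suffix n w w' : w < dnum D n.+2 -> w' < dnum D n.+2 ->
  suffix (dword D n.+1 w) (dword D n.+1 w') -> w = w'.
Proof.
move=> hw hw' /suffixP[s e]; apply: (marked_inj DM hw hw').
case: (posnP (size s)) => [/size0nil s0|s0]; first by rewrite e s0.
have sz := marked_size DM hw.
have hq : (size s).+1 < size (dword D n.+1 w') by rewrite e size_cat -addn1 ltn_add2l.
have := marked_start DM hw' hq.
rewrite e !nth_cat ltnn subnn ltnNge leqnSn subSnn /= -e.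
by rewrite (marked_start DM hw sz) eqxx eqn0Ngt s0.
Qed.

(** Mere injectivity would not pass through the induction, as a concatenation of words of different
    lengths must be parsed; suffix-freeness does. At level 1 the last symbol of a tower word already
    names the vertex. *)
Lemma tower_word_suffix n w w' : w < dnum D n.+1 -> w' < dnum D n.+1 ->
  suffix (tword n.+1 w) (tword n.+1 w') -> w = w'.
Proof.
elim: n w w' => [|n IHn] w w' hw hw'.
  have [b [<- tb]] := vertex_path_ex hw; have [b' [<- tb']] := vertex_path_ex hw'.
  rewrite -!tower_wordE //.
  have last_rng c : tau 1 c = 0 -> forall e,
      edge_rng (last e (window V c (ht D 1 (vtx c 1)))) = vtx c 1 :> nat.
    move=> tc e; rewrite -nth_last size_window nth_window; last first.
      by rewrite ltn_predL ht_gt0 // vtx_lt.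
    have [|cc _] := @iter_V D V VE 1 (ht D 1 (vtx c 1)).-1 c.
      by rewrite tc add0n ltn_predL ht_gt0 // vtx_lt.
    by rewrite vtx_rng -(same_tail_vtx cc).
  case/suffixP => s e; have e0 := path_edge b 0.
  rewrite -(last_rng b tb (last e0 s)) -(last_rng b' tb' e0).
  by rewrite e last_cat.
rewrite !(tower_word_flatten VE) // => h; apply: (dword_suffix hw hw').
apply: suffix_flatten h => [u us|u u' us us'].
  have hu : u < dnum D n.+1 by exact: dword_letter us.
  by rewrite -size_eq0 size_tower_word // -lt0n ht_gt0.
have hu : u < dnum D n.+1 by exact: dword_letter us.
have hu' : u' < dnum D n.+1 by exact: dword_letter us'.
by case/orP => /IHn h; [exact: h|apply/esym; exact: h].
Qed.

(** Distinct vertices of the same height [L] have distinct tower words, all of length [L]. *)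
Lemma complexity_lower n L :
  #|[set w : 'I_(dnum D n.+1) | ht D n.+1 w == L]%SET| <= complexity Y L.
Proof.
have [b bP] : exists b : 'I_(dnum D n.+1) -> P,
    forall w, vtx (b w) n.+1 = w /\ tau n.+1 (b w) = 0.
  exists (fun w => projT1 (cid (vertex_path_ex (ltn_ord w)))) => w.
  by case: cid.
pose f w : L.-tuple A := [tuple path_edge (iter i V (b w)) 0 | i < L].
have fE w : tval (f w) = window V (b w) L.
  have e0 := path_edge (b w) 0.
  apply: (@eq_from_nth _ e0); first by rewrite size_tuple size_window.
  move=> i; rewrite size_tuple => hi; rewrite nth_window //.
  by rewrite -(tnth_nth e0 (f w) (Ordinal hi)) tnth_mktuple.
rewrite -(@card_in_imset _ _ f).
  apply: subset_leq_card; apply/fintype.subsetP => _ /imsetP[w _ ->].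
  by rewrite inE; apply/asboolP/occursP; exists (b w).
move=> w w'; rewrite !inE => /eqP hw /eqP hw' /(congr1 (@tval _ _)).
rewrite !fE -{1}hw -hw' -(bP w).1 -(bP w').1.
rewrite (tower_wordE VE (bP w).2) (tower_wordE VE (bP w').2) => e.
apply/val_inj => /=; rewrite -(bP w).1 -(bP w').1.
by apply: (@tower_word_suffix n); rewrite ?vtx_lt // e suffix_refl.
Qed.

Lemma tower_cover n M a b : tau n.+1 b = 0 ->
  (forall w, w < dnum D n.+1 -> a <= ht D n.+1 w) ->
  exists ws : M.-tuple 'I_(dnum D n.+1), exists2 L, M * a <= L &
    window V b L = flatten [seq tword n.+1 w | w : 'I_(dnum D n.+1) <- ws].
Proof.
move=> tb ha; elim: M b tb => [|M IHM] b tb.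
  by exists [tuple], 0.
have [ws [L hL wsE]] := IHM _ (iter_V_end VE tb).
exists [tuple of Ordinal (vtx_lt b n.+1) :: ws], (ht D n.+1 (vtx b n.+1) + L).
  by rewrite mulSn leq_add // ha // vtx_lt.
by rewrite windowD wsE tower_wordE.
Qed.

(** A word of length [L] lies in a concatenation of [M] tower words, at an offset below [c]; the
    offset and the [M] vertices determine it. *)
Lemma complexity_upper n L M a c :
  (forall w, w < dnum D n.+1 -> a <= ht D n.+1 w) ->
  (forall w, w < dnum D n.+1 -> ht D n.+1 w <= c) ->
  L + c <= M * a -> complexity Y L <= c * dnum D n.+1 ^ M.
Proof.
move=> ha hc LM; have [x0 _] := bottom_path_ex D.
pose e0 := path_edge x0 0.
pose f (p : 'I_c * M.-tuple 'I_(dnum D n.+1)) : L.-tuple A :=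
  [tuple nth e0 (flatten [seq tword n.+1 w | w : 'I_(dnum D n.+1) <- p.2]) (p.1 + i)
    | i < L].
rewrite -[in X in X ^ M](card_ord (dnum D n.+1)) -card_tuple -[in X in X * _](card_ord c).
rewrite -card_prod -cardsT.
apply: leq_trans (leq_imset_card f _); apply: subset_leq_card.
apply/fintype.subsetP => w; rewrite inE => /asboolP/occursP[x wx].
have [sx tx] := iter_V_back VE (leqnn (tau n.+1 x)).
set b := iterZ V _ x in sx tx; rewrite subnn in tx.
have xE : x = iter (tau n.+1 x) V b.
  by rewrite -iterZ_nat -iterZD subrr.
have [ws [L' hL wsE]] := tower_cover M tx ha.
have tc : tau n.+1 x < c.
  by apply: leq_trans (tau_lt n.+1 x) _; apply: hc; exact: vtx_lt.
apply/imsetP; exists (Ordinal tc, ws) => //; apply: eq_from_tnth => i.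
rewrite tnth_mktuple /= -wsE nth_window; last first.
  by have := ltn_ord i; lia.
by rewrite (tnth_nth e0) wx nth_window // {1}xE -iterD addnC.
Qed.

Lemma complexity_gt0 n : 0 < complexity Y n.
Proof.
have [x _] := bottom_path_ex D; apply/card_gt0P.
exists [tuple path_edge (iter i V x) 0 | i < n].
rewrite inE; apply/asboolP/occursP; exists x.
have e0 := path_edge x 0.
apply: (@eq_from_nth _ e0); first by rewrite size_tuple size_window.
move=> i; rewrite size_tuple => hi; rewrite nth_window //.
by rewrite -(tnth_nth e0 _ (Ordinal hi)) tnth_mktuple.
Qed.

Lemma complexityD m n : complexity Y (m + n) <= complexity Y m * complexity Y n.
Proof.
have [x0 _] := bottom_path_ex D; pose e0 := path_edge x0 0.
rewrite -cardsX.
pose f (p : m.-tuple A * n.-tuple A) : (m + n).-tuple A := [tuple of p.1 ++ p.2].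
apply: leq_trans (leq_imset_card f _); apply: subset_leq_card.
apply/fintype.subsetP => w; rewrite inE => /asboolP/occursP[x wx].
have s1 : size (window V x m) == m by rewrite size_window.
have s2 : size (window V (iter m V x) n) == n by rewrite size_window.
apply/imsetP; exists (Tuple s1, Tuple s2).
  rewrite !inE; apply/andP; split; apply/asboolP/occursP.
    by exists x.
  by exists (iter m V x).
by apply/val_inj; rewrite /= wx windowD.
Qed.

End Complexity.

(** * Simplicity, proper order and path counts *)

Section DiagramShape.
Variable D : directive.

Lemma dorder_simple : simple_diagram (dorder D).
Proof.
(* Every word contains every letter, so consecutive levels already have positive matrices. The
   difference is generalised because the type of the matrix depends on it. *)
exists id; split=> // i; move: (subSnn i); move: (i.+1 - i)%N => k -> v u.
rewrite /incidence_prod mulmx1 mxE card_gt0; apply/set0Pn.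
have uin : nat_of_ord (enum_val u) \in dword D i (enum_val v).
  by apply: dword_full; exact: ltn_ord.
have [|e [ev ep]] := @edge_ex D i (enum_val v)
  (index (nat_of_ord (enum_val u)) (dword D i (enum_val v))) (ltn_ord _).
  by rewrite index_mem.
exists e; rewrite inE; apply/andP; split; apply/eqP/val_inj.
  by rewrite [LHS]edge_src_nth ep ev nth_index.
by rewrite [LHS]ev.
Qed.

Lemma dorder_proper : properly_ordered (dorder D).
Proof.
split; first exact: dorder_simple.
- have [x px] := bottom_path_ex D; exists x; split.
    by move=> i; apply/minimal_edgeP; exact: px.
  move=> y my; apply: bottom_path_eq => // i; exact/minimal_edgeP/my.
- have mt (z : path_space (dorder D)) : maximal_path z <-> forall i, edge_top z i.
    split=> h i; first by have /maximal_edgeP := h i; rewrite vtx_rng => /eqP.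
    by apply/maximal_edgeP; rewrite vtx_rng; exact/eqP/(h i).
  have [x tx] := top_path_ex D; exists x; split; first exact/mt.
  by move=> y /mt ty; exact: top_path_eq.
Qed.

Lemma card_path_to n (v : 'I_(dnum D n)) :
  #|path_to (B := dorder D) (i := n) v| = ht D n v.
Proof.
elim: n v => [|n IHn] v; first by rewrite card_unit.
rewrite [LHS]card_tagged sumnE big_map big_enum /=.
under eq_bigr => e _ do rewrite IHn.
transitivity (\sum_(e : dedge D n | edge_rng e == v) ht D n (edge_src e))%N.
  rewrite [RHS](reindex_omap
    (val : {e : dedge D n | edge_rng e == v} -> dedge D n) insub); last first.
    by move=> e he; rewrite insubT.
  by apply: eq_bigl => -[e he]; rewrite /= insubT he eqxx.
transitivity (\sum_(w : 'I_(dnum D n.+1) | w == v)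
   \sum_(k < size (dword D n w)) ht D n (nth 0%N (dword D n w) k))%N.
  by rewrite sig_big_dep /=; apply: eq_bigl => e; rewrite andbT.
by rewrite big_pred1_eq /= [RHS](big_nth 0%N) big_mkord.
Qed.

(** The ratio is at most [c i / a i], hence at most 1 + 1/(i+1) by the bound on [c i - a i]; the
    bounds concern levels from 1 on, whence the shift. *)
Lemma dorder_pseudo_ERS (R : realType) (a c : nat -> nat) :
  (forall i w, (w < dnum D i.+1)%N -> (a i <= ht D i.+1 w <= c i)%N) ->
  (forall i, (0 < a i)%N) -> (forall i, (i.+1 * (c i - a i) <= a i)%N) ->
  pseudo_ERS (dorder D) R.
Proof.
move=> hac a0 ca; split; first exact: dorder_simple.
have hpath i (v : 'I_(dnum D i.+1)) :
    (a i <= #|path_to (B := dorder D) (i := i.+1) v| <= c i)%N.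
  by rewrite card_path_to hac.
have maxc i : (max_paths (dorder D) i.+1 <= c i)%N.
  by apply/bigmax_leqP => v _; have /andP[] := hpath i v.
have amax i : (a i <= max_paths (dorder D) i.+1)%N.
  pose v : 'I_(dnum D i.+1) := Ordinal (dnum_gt0 D i.+1).
  have /andP[h _] := hpath i v; apply: leq_trans h _.
  exact: (leq_bigmax (F := fun v : bvert (dorder D) i.+1 => #|path_to v|)).
have amin i : (a i <= min_paths (dorder D) i.+1)%N.
  apply: (big_ind (fun m => a i <= m)%N) => // [m m' hm hm'|v _].
    by rewrite leq_min hm.
  by have /andP[] := hpath i v.
have minmax i : (min_paths (dorder D) i.+1 <= max_paths (dorder D) i.+1)%N.
  rewrite /min_paths; elim/big_rec: _ => // v m _ hm.
  by rewrite geq_min hm orbT.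
suff h : (max_paths (dorder D) i.+1)%:R / (min_paths (dorder D) i.+1)%:R
    @[i --> \oo] --> (1 : R) by rewrite -cvg_shiftS.
apply: (@squeeze_cvgr _ _ _ _ (fun=> 1 : R) (fun i => 1 + i.+1%:R^-1)).
- apply: nearW => i.
  have m0 : (0 : R) < (min_paths (dorder D) i.+1)%:R.
    by rewrite ltr0n (leq_trans (a0 i)).
  have ap : (0 : R) < (a i)%:R by rewrite ltr0n.
  rewrite ler_pdivlMr // mul1r ler_nat minmax /=.
  apply: (@le_trans _ _ ((c i)%:R / (a i)%:R)).
    by apply: ler_pM; rewrite ?invr_ge0 ?ler0n ?ler_nat // lef_pV2 // ler_nat.
  rewrite ler_pdivrMr // mulrDl mul1r -lerBlDl.
  rewrite ler_pdivlMl ?ltr0n // -natrB; last first.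
    exact: leq_trans (amax i) (maxc i).
  by rewrite -natrM ler_nat.
- exact: cvg_cst.
- rewrite -[X in _ --> X]addr0; apply: cvgD; first exact: cvg_cst.
  exact: cvg_harmonic.
Qed.

End DiagramShape.

(** * Labels of the pieces of a tower *)

Module Labels.

Section ListFacts.
Local Open Scope nat_scope.

Lemma hermite t m : 0 < t -> \sum_(p < t) (m + p) %/ t = m.
Proof.
move=> t0; elim: m => [|m IHm].
  by rewrite big1 // => p _; rewrite add0n divn_small.
(* The sum over [p < t.+1], split at its first and at its last term, compares [m.+1] with [m]: they
   differ by [(m + t) %/ t - m %/ t], which is 1. *)
have := erefl (\sum_(0 <= p < t.+1) (m + p) %/ t).
rewrite {1}big_nat_recl // big_nat_recr //= !big_mkord IHm addn0.
under [in X in _ -> X]eq_bigr => p _ do rewrite addSnnS.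
rewrite divnDr ?dvdnn // divnn t0 /=; lia.
Qed.

Lemma size_flatten_const (A : Type) (f : nat -> seq A) n K :
  (forall b, b < n -> size (f b) = K) ->
  size (flatten [seq f b | b <- iota 0 n]) = n * K.
Proof.
elim: n => // n IHn hf; rewrite -[in iota _ _]addn1 iotaD map_cat flatten_cat /= cats0.
by rewrite size_cat IHn ?hf ?mulSn ?[K + _]addnC // => b hb; rewrite hf // ltnW.
Qed.

Lemma nth_flatten_const (A : Type) (d : A) (f : nat -> seq A) n K q :
  (forall b, b < n -> size (f b) = K) -> q < n * K ->
  nth d (flatten [seq f b | b <- iota 0 n]) q = nth d (f (q %/ K)) (q %% K).
Proof.
elim: n => // n IHn hf; rewrite -[in iota _ _]addn1 iotaD map_cat flatten_cat /= cats0.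
have hf' b : b < n -> size (f b) = K by move=> hb; rewrite hf // ltnW.
rewrite nth_cat (size_flatten_const hf') add0n => hq.
have [qn|nq] := ltnP q (n * K); first exact: IHn.
have e : q = n * K + (q - n * K) by rewrite subnKC.
have qK : q - n * K < K by move: hq; rewrite mulSn; lia.
have K0 : 0 < K by exact: leq_trans qK.
by rewrite e divnMDl // divn_small // addn0 modnMDl modn_small // -e.
Qed.

Lemma digits_inj B m x y : x < B ^ m -> y < B ^ m ->
  (forall b, b < m -> (x %/ B ^ b) %% B = (y %/ B ^ b) %% B) -> x = y.
Proof.
elim: m x y => [|m IHm] x y; first by rewrite expn0; lia.
rewrite expnSr => xB yB h.
have [B0|B0] := posnP B; first by rewrite B0 muln0 in xB.
rewrite (divn_eq x B) (divn_eq y B).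
have := h 0 isT; rewrite expn0 !divn1 => ->; congr (_ * B + _).
apply: IHm => [||b bm]; rewrite ?ltn_divLR //.
by have := h b.+1 bm; rewrite expnS !divnMA.
Qed.

Fixpoint bounded_seqs (B m : nat) : seq (seq nat) :=
  if m is m'.+1 then [seq x :: l | x <- iota 0 B, l <- bounded_seqs B m']
  else [:: [::]].

Lemma size_bounded_seqs B m : size (bounded_seqs B m) = B ^ m.
Proof. by elim: m => //= m IHm; rewrite size_allpairs size_iota IHm expnS. Qed.

Lemma mem_bounded_seqs B (l : seq nat) : all (fun x => x < B) l ->
  l \in bounded_seqs B (size l).
Proof.
elim: l => [|x l IHl] //= /andP[xB lB].
by apply/allpairsP; exists (x, l); rewrite mem_iota /= add0n xB IHl.
Qed.

End ListFacts.

Section Labels.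
Local Open Scope nat_scope.
Variables (r : nat -> nat) (h : nat -> nat -> nat) (s : nat -> nat -> seq nat).
Variables (N K : nat -> nat) (um uM : nat -> nat).

(** Rounding each visit count of a piece by at most one changes its height by at most the sum of the
    heights of level [i]. The extra one in [high] comes from the average height of the pieces, which
    lies between [N i] and [(N i).+1]. *)
Definition low i := N i - \sum_(u < r i) h i u.
Definition high i := N i + (\sum_(u < r i) h i u).+1.

(* [(r, h, s)]: numbers of towers, heights and itineraries of a refining sequence
   of tower partitions. [N i] is the target height of the pieces into which the
   towers of level [i.+1] are cut, [K i] the number of copies of each piece.
   [td_capacity] bounds the number of labels by the number of orders available
   for the [m] blocks of a word. *)
Record tower_data : Prop := TowerData {
  td_r0 : r 0 = 1;
  td_h0 : h 0 0 = 1;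
  td_r_gt0 : forall i, 0 < r i;
  td_h_gt0 : forall i u, u < r i -> 0 < h i u;
  td_letter : forall i v u, v < r i.+1 -> u \in s i v -> u < r i;
  td_sum : forall i v, v < r i.+1 -> \sum_(u <- s i v) h i u = h i.+1 v;
  td_count : forall i v u, v < r i.+1 -> u < r i ->
    h i.+1 v %/ N i <= count_mem u (s i v);
  td_large : forall i v, v < r i.+1 -> N i * N i * K i <= h i.+1 v;
  td_N : forall i, 1 < N i;
  td_K : forall i, 2 < K i;
  td_head : forall i v, v < r i.+1 -> head 0 (s i v) = um i;
  td_last : forall i v, v < r i.+1 -> last 0 (s i v) = uM i;
  td_um : forall i, um i < r i;
  td_uM : forall i, uM i < r i;
  td_low : forall i, 0 < low i;
  td_capacity : forall i m, low i.+1 <= m * (K i * high i) ->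
    (high i.+1).+1 ^ r i.+1 * K i.+1 <= (K i - 2)`! ^ m }.

Hypothesis TD : tower_data.

(** The number of pieces, about [h i.+1 v / N i], is made a multiple of [K i], so that the pieces
    fall into complete blocks of residues. *)
Definition chunks i v := h i.+1 v %/ (N i * K i).
Definition pieces i v := chunks i v * K i.
Definition visits i v u := count_mem u (s i v).
(* By Hermite's identity the quotients [(visits i v u + p) %/ pieces i v] add up to
   [visits i v u] over the pieces [p] of the tower [v]. *)
Definition label i v p : seq nat * nat :=
  ([seq (visits i v u + p) %/ pieces i v | u <- iota 0 (r i)], p %% K i).
Definition labels i : seq (seq nat * nat) :=
  undup (flatten [seq [seq label i v p | p <- iota 0 (pieces i v)]
    | v <- iota 0 (r i.+1)]).
Definition lab i v p : nat := index (label i v p) (labels i).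
Definition nlab i : nat := if i is i'.+1 then size (labels i') else 1.
Definition mult i w u : nat := nth 0 (nth ([::], 0) (labels i) w).1 u.
Definition copy i w : nat := (nth ([::], 0) (labels i) w).2.

Lemma K_gt0 i : 0 < K i. Proof. exact: ltn_trans (td_K TD i). Qed.
Lemma N_gt0 i : 0 < N i. Proof. exact: ltn_trans (td_N TD i). Qed.

Lemma chunks_ge i v : v < r i.+1 -> N i <= chunks i v.
Proof.
move=> hv; rewrite /chunks leq_divRL ?muln_gt0 ?K_gt0 ?N_gt0 //.
by rewrite mulnA; exact: td_large.
Qed.

Lemma chunks_gt1 i v : v < r i.+1 -> 1 < chunks i v.
Proof. by move=> hv; exact: leq_trans (td_N TD i) (chunks_ge hv). Qed.

Lemma pieces_gt0 i v : v < r i.+1 -> 0 < pieces i v.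
Proof. by move=> hv; rewrite muln_gt0 K_gt0 (ltnW (chunks_gt1 hv)). Qed.

Lemma pieces_lower i v : v < r i.+1 -> pieces i v * N i <= h i.+1 v.
Proof.
by move=> hv; rewrite /pieces -mulnA [K i * _]mulnC; exact: leq_trunc_div.
Qed.

(** The remainder of the division is below [N i * K i]. There are at least [N i] chunks, hence at
    least that many pieces, so the remainder costs each piece at most one. *)
Lemma pieces_upper i v : v < r i.+1 -> h i.+1 v <= pieces i v * (N i).+1.
Proof.
move=> hv; have := @ltn_ceil (h i.+1 v) (N i * K i).
rewrite muln_gt0 K_gt0 N_gt0 /= -/(chunks i v) => /(_ isT) /ltnW /leq_trans; apply.
have : N i * K i <= chunks i v * K i by rewrite leq_mul2r chunks_ge ?orbT.
rewrite /pieces; lia.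
Qed.

Lemma labelP i v p : v < r i.+1 -> p < pieces i v -> label i v p \in labels i.
Proof.
move=> hv hp; rewrite mem_undup; apply/flatten_mapP; exists v.
  by rewrite mem_iota.
by apply/mapP; exists p => //; rewrite mem_iota.
Qed.

Lemma lab_lt i v p : v < r i.+1 -> p < pieces i v -> lab i v p < nlab i.+1.
Proof. by move=> hv hp; rewrite index_mem labelP. Qed.

Lemma nth_lab i v p : v < r i.+1 -> p < pieces i v ->
  nth ([::], 0) (labels i) (lab i v p) = label i v p.
Proof. by move=> hv hp; rewrite nth_index // labelP. Qed.

Lemma mult_lab i v p u : v < r i.+1 -> p < pieces i v -> u < r i ->
  mult i (lab i v p) u = (visits i v u + p) %/ pieces i v.
Proof.
move=> hv hp hu; rewrite /mult nth_lab //= (nth_map 0) ?size_iota //.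
by rewrite nth_iota.
Qed.

Lemma copy_lab i v p : v < r i.+1 -> p < pieces i v ->
  copy i (lab i v p) = p %% K i.
Proof. by move=> hv hp; rewrite /copy nth_lab. Qed.

Lemma lab_ex i w : w < nlab i.+1 ->
  exists v p, [/\ v < r i.+1, p < pieces i v & w = lab i v p].
Proof.
move=> hw; have := mem_nth ([::], 0) hw; rewrite mem_undup.
case/flatten_mapP => v; rewrite mem_iota /= add0n => hv /mapP[p].
rewrite mem_iota /= add0n => hp e; exists v, p; split=> //.
by rewrite /lab -e index_uniq // undup_uniq.
Qed.

Definition piece_height i w := \sum_(u < r i) mult i w u * h i u.

Lemma visits_sum i v : v < r i.+1 -> \sum_(u < r i) visits i v u * h i u = h i.+1 v.
Proof.
move=> hv; rewrite -(td_sum TD hv).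
have : forall u, u \in s i v -> u < r i by move=> u; exact: (td_letter TD hv).
rewrite /visits; elim: (s i v) => [|a l IHl] hl.
  by rewrite big_nil big1 // => u _.
rewrite big_cons -IHl; last by move=> u ul; apply: hl; rewrite inE ul orbT.
have ha := hl a (mem_head _ _).
under eq_bigr => u _ do rewrite /= mulnDl.
rewrite big_split /=; congr (_ + _).
rewrite (bigD1 (Ordinal ha)) //= eqxx mul1n big1 ?addn0 // => u.
by rewrite -val_eqE /= eq_sym => /negbTE ->.
Qed.

Lemma piece_height_sum i v : v < r i.+1 ->
  \sum_(p < pieces i v) piece_height i (lab i v p) = h i.+1 v.
Proof.
move=> hv; rewrite exchange_big -[RHS]visits_sum //=; apply: eq_bigr => u _.
rewrite -big_distrl /= -[in RHS](hermite (visits i v u) (pieces_gt0 hv)).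
by congr (_ * _); apply: eq_bigr => p _; rewrite mult_lab.
Qed.

Lemma piece_height_bound i w : w < nlab i.+1 ->
  low i <= piece_height i w <= high i.
Proof.
case/lab_ex => v [p [hv hp ->]]; set t := pieces i v.
have t0 : 0 < t by exact: pieces_gt0.
rewrite /piece_height (eq_bigr (fun u : 'I_(r i) =>
  (visits i v u + p) %/ t * h i u)); last by move=> u _; rewrite mult_lab.
set H := \sum_(u < r i) _; set S := \sum_(u < r i) h i u.
have hi : H * t <= h i.+1 v + S * t.
  rewrite -(visits_sum hv) /H /S !big_distrl /= -big_split /=.
  apply: leq_sum => u _; rewrite mulnAC [h i u * t]mulnC -mulnDl.
  rewrite leq_mul2r; apply/orP; right; apply: leq_trans (leq_trunc_div _ _) _.
  by rewrite leq_add2l ltnW.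
have lo : h i.+1 v <= H * t + S * t.
  rewrite -(visits_sum hv) /H /S !big_distrl /= -big_split /=.
  apply: leq_sum => u _; rewrite mulnAC [h i u * t]mulnC -mulnDl.
  rewrite leq_mul2r; apply/orP; right; rewrite -[X in _ + X]mul1n -mulnDl addn1.
  apply: ltnW; apply: leq_ltn_trans (ltn_ceil (visits i v u + p) t0).
  exact: leq_addr.
have := pieces_lower hv; have := pieces_upper hv; rewrite -/t => hup hlo.
rewrite /low /high -/S -(leq_pmul2r t0) -[X in _ && X](leq_pmul2r t0) mulnBl.
rewrite leq_subLR; apply/andP; split; nia.
Qed.

(** Makes every visit count of every label positive, so that all letters occur in all words. *)
Lemma visits_ge i v u : v < r i.+1 -> u < r i -> pieces i v <= visits i v u.
Proof.
move=> hv hu; apply: leq_trans (td_count TD hv hu).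
by rewrite leq_divRL ?N_gt0 // pieces_lower.
Qed.

Lemma mult_gt0 i w u : w < nlab i.+1 -> u < r i -> 0 < mult i w u.
Proof.
case/lab_ex => v [p [hv hp ->]] hu; rewrite mult_lab // divn_gt0 ?pieces_gt0 //.
by apply: leq_trans (visits_ge hv hu) _; exact: leq_addr.
Qed.

Lemma nlab_gt0 i : 0 < nlab i.
Proof.
case: i => // i; have hv := td_r_gt0 TD i.+1.
exact: leq_ltn_trans (lab_lt hv (pieces_gt0 hv)).
Qed.

Lemma nlab_ge i : K i <= nlab i.+1.
Proof.
rewrite -[K i](size_iota 0) -(size_map (label i 0)).
have hv := td_r_gt0 TD i.+1.
apply: uniq_leq_size.
  rewrite map_inj_in_uniq ?iota_uniq // => j k; rewrite !mem_iota /= !add0n.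
  by move=> hj hk []; rewrite !modn_small.
move=> _ /mapP[j + ->]; rewrite mem_iota /= => hj; apply: labelP => //.
apply: leq_trans hj _; rewrite add0n leq_pmull //.
exact: ltnW (chunks_gt1 hv).
Qed.

(** Heights are positive, so no visit count exceeds the height of its piece, which is at most
    [high i]; the bound does not involve the tower heights of level [i.+1]. *)
Lemma nlab_le i : nlab i.+1 <= (high i).+1 ^ r i * K i.
Proof.
rewrite -size_bounded_seqs -[X in _ * X](size_iota 0).
rewrite -(size_allpairs (fun l j => (l, j))).
apply: uniq_leq_size; first exact: undup_uniq.
move=> x xL; have hw : index x (labels i) < nlab i.+1 by rewrite index_mem.
have /andP[_ hh] := piece_height_bound hw.
have [v [p [hv hp e]]] := lab_ex hw.
have xE : x = label i v p by rewrite -(nth_lab hv hp) -e nth_index.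
apply/allpairsP; exists x; split; last by case: (x).
- rewrite -[X in bounded_seqs _ X](_ : size x.1 = r i); last first.
    by rewrite xE size_map size_iota.
  apply: mem_bounded_seqs; apply/(all_nthP 0) => u; rewrite xE size_map size_iota.
  move=> hu; rewrite ltnS -xE; apply: leq_trans hh.
  have -> : nth 0 x.1 u = mult i (index x (labels i)) u by rewrite /mult nth_index.
  rewrite /piece_height (bigD1 (Ordinal hu)) //=; apply: leq_trans (leq_addr _ _).
  by rewrite leq_pmulr // td_h_gt0.
- by rewrite mem_iota xE /= add0n ltn_mod K_gt0.
Qed.

End Labels.

End Labels.
Import Labels.

(** * Words over the labels *)

Section Arrangements.
Local Open Scope nat_scope.
Variables (r : nat -> nat) (h : nat -> nat -> nat) (s : nat -> nat -> seq nat).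
Variables (N K : nat -> nat) (um uM : nat -> nat).
Hypothesis TD : tower_data r h s N K um uM.
Local Notation chunks := (chunks h N K).
Local Notation pieces := (pieces h N K).
Local Notation nlab := (nlab r h s N K).
Local Notation mult := (mult r h s N K).
Local Notation copy := (copy r h s N K).
Local Notation lab := (lab r h s N K).
Local Notation low := (low r h N).
Local Notation high := (high r h N).
Local Notation piece_height := (piece_height r h s N K).

(* [(u, l, a)]: the pieces number [a * K i], ..., [a * K i + K i - 1] of the [l]-th
   copy of the tower [u] in the label [w]. *)
Definition all_blocks i w : seq (nat * nat * nat) :=
  [seq (x, a) | x <- [seq (u, l) | u <- iota 0 (r i.+1),
                                   l <- iota 0 (mult i.+1 w u)],
                a <- iota 0 (chunks i x.1)].

(** Imposing the first and the last block makes all words of a level begin and end alike, as proper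
    ordering demands. When [um] and [uM] are the towers of the base point and of its predecessor,
    these two points become the minimal and the maximal path. *)
Definition block_first i : nat * nat * nat := (um i.+1, 0, 0).
Definition block_last i w : nat * nat * nat :=
  (uM i.+1, (mult i.+1 w (uM i.+1)).-1, (chunks i (uM i.+1)).-1).

Definition blocks i w : seq (nat * nat * nat) :=
  block_first i :: rcons [seq b <- all_blocks i w |
    (b != block_first i) && (b != block_last i w)] (block_last i w).

Definition nblocks i w := size (blocks i w).

Lemma mem_all_blocks i w u l a : ((u, l, a) \in all_blocks i w) =
  [&& u < r i.+1, l < mult i.+1 w u & a < chunks i u].
Proof.
apply/allpairsPdep/and3P => [[x [b [/allpairsPdep[u' [l' [hu hl ->]]] hb]]]|[hu hl ha]].
  by case=> -> -> ->; move: hu hl hb; rewrite !mem_iota.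
exists (u, l), a; split=> //; last by rewrite mem_iota.
by apply/allpairsPdep; exists u, l; rewrite !mem_iota.
Qed.

Lemma uniq_all_blocks i w : uniq (all_blocks i w).
Proof.
apply: allpairs_uniq_dep.
- apply: allpairs_uniq_dep => [|u _|]; rewrite ?iota_uniq //.
  by move=> [u l] [u' l'] _ _ /= [-> ->].
- by move=> x _; exact: iota_uniq.
- by move=> [x a] [x' a'] _ _ /= [-> ->].
Qed.

Section Word.
Variables (i w : nat).
Hypothesis hw : w < nlab i.+2.

Lemma block_first_mem : block_first i \in all_blocks i w.
Proof.
have hu := td_um TD i.+1.
rewrite mem_all_blocks hu (mult_gt0 TD hw hu) /=.
exact: ltnW (chunks_gt1 TD hu).
Qed.

Lemma block_last_mem : block_last i w \in all_blocks i w.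
Proof.
have hu := td_uM TD i.+1.
rewrite mem_all_blocks hu !ltn_predL (mult_gt0 TD hw hu) /=.
exact: ltnW (chunks_gt1 TD hu).
Qed.

Lemma block_first_last : block_first i != block_last i w.
Proof.
have hu := td_uM TD i.+1; apply/eqP => -[_ _].
by have := chunks_gt1 TD hu; case: (chunks i _) => // -[].
Qed.

Lemma perm_blocks : perm_eq (blocks i w) (all_blocks i w).
Proof.
apply: uniq_perm; last 1 first.
- move=> b; rewrite inE mem_rcons inE mem_filter.
  have [->|_] := eqVneq b (block_first i); first by rewrite block_first_mem.
  by have [->|_] := eqVneq b (block_last i w); first by rewrite block_last_mem.
- rewrite /= mem_rcons inE negb_or block_first_last mem_filter eqxx /=.
  by rewrite rcons_uniq mem_filter eqxx andbF /= filter_uniq // uniq_all_blocks.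
- exact: uniq_all_blocks.
Qed.

Lemma nblocks_gt1 : 1 < nblocks i w.
Proof. by rewrite /nblocks /= size_rcons. Qed.

(* The order in the block [b] is encoded by the [b]-th digit of [w] in base
   [(K i - 2)!]. *)
Definition free_order b : seq nat :=
  nth [::] (permutations (iota 1 (K i - 2))) ((w %/ (K i - 2)`! ^ b) %% (K i - 2)`!).

(** Residue 0 opens every block, and [(K i).-1] follows it in block 0 only: elsewhere a free residue
    does, which exists because [K i] exceeds 2. The last block, never block 0, ends with [(K i).-1],
    so no word ends with residue 0. *)
Definition block_order b : seq nat :=
  if b == 0 then [:: 0, (K i).-1 & free_order b]
  else 0 :: rcons (free_order b) (K i).-1.

Lemma perm_free_order b : perm_eq (free_order b) (iota 1 (K i - 2)).
Proof.
rewrite -mem_permutations; apply: mem_nth.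
by rewrite size_permutations ?iota_uniq // size_iota ltn_mod fact_gt0.
Qed.

Lemma iota_K : iota 0 (K i) = 0 :: rcons (iota 1 (K i - 2)) (K i).-1.
Proof.
have [k ->] : exists k, K i = k.+2.
  by exists (K i - 2); have := td_K TD i; lia.
by rewrite subn2 -[in LHS](addn1 k.+1) iotaD cats1.
Qed.

Lemma perm_block_order b : perm_eq (block_order b) (iota 0 (K i)).
Proof.
rewrite iota_K /block_order; case: eqP => _; rewrite perm_cons.
  rewrite perm_sym perm_rcons perm_cons perm_sym; exact: perm_free_order.
rewrite perm_rcons perm_sym perm_rcons perm_cons perm_sym.
exact: perm_free_order.
Qed.

Lemma size_block_order b : size (block_order b) = K i.
Proof. by rewrite (perm_size (perm_block_order b)) size_iota. Qed.

(** Triples are kept rather than labels, since several of them may carry the same label; [theta]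
    needs their distinct positions. *)
Definition arrangement : seq (nat * nat * nat) :=
  flatten [seq [seq ((nth (0, 0, 0) (blocks i w) b).1,
                     (nth (0, 0, 0) (blocks i w) b).2 * K i + j)
               | j <- block_order b] | b <- iota 0 (nblocks i w)].

Lemma perm_arrangement : perm_eq arrangement
  [seq (b.1, b.2 * K i + j) | b <- all_blocks i w, j <- iota 0 (K i)].
Proof.
apply: (@perm_trans _ (flatten [seq [seq (b.1, b.2 * K i + j) | j <- iota 0 (K i)]
  | b <- blocks i w])); last first.
  by apply: perm_flatten; apply: perm_map; exact: perm_blocks.
rewrite /arrangement -[X in perm_eq _ (flatten (map _ X))](mkseq_nth (0, 0, 0)).
rewrite /mkseq -map_comp -/(nblocks i w).
elim: (iota _ _) => //= b l IHl; apply: perm_cat => //.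
by apply: perm_map; exact: perm_block_order.
Qed.

Lemma mem_arrangement u l p : ((u, l, p) \in arrangement) =
  [&& u < r i.+1, l < mult i.+1 w u & p < pieces i u].
Proof.
have K0 := K_gt0 TD i; rewrite (perm_mem perm_arrangement).
apply/allpairsP/and3P => [[[[[u' l'] a] j] [/=]]|[hu hl hp]].
  rewrite mem_all_blocks mem_iota => /and3P[hu hl ha] /= hj [-> -> ->].
  split=> //; rewrite /Labels.pieces; apply: (@leq_trans (a.+1 * K i)).
    by rewrite mulSn addnC ltn_add2r.
  by rewrite leq_mul2r ha orbT.
exists ((u, l, p %/ K i), p %% K i); split=> /=; last by rewrite -divn_eq.
  by rewrite mem_all_blocks hu hl ltn_divLR.
by rewrite mem_iota /= add0n ltn_mod.
Qed.

Lemma uniq_arrangement : uniq arrangement.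
Proof.
rewrite (perm_uniq perm_arrangement); apply: allpairs_uniq.
- exact: uniq_all_blocks.
- exact: iota_uniq.
- have K0 := K_gt0 TD i.
  have hj (y : nat * nat * nat * nat) :
      y \in [seq (b, j) | b <- all_blocks i w, j <- iota 0 (K i)] -> y.2 < K i.
    by case/allpairsP => q [_ + ->]; rewrite mem_iota.
  move=> [[x a] j] [[x' a'] j'] /hj /= hk /hj /= hk' [-> e].
  have aa' : a = a'.
    have := congr1 (fun m => m %/ K i) e.
    by rewrite /= !divnMDl // !divn_small // !addn0.
  by rewrite aa' in e *; rewrite (addnI e).
Qed.

Lemma size_arrangement : size arrangement = nblocks i w * K i.
Proof.
by apply: size_flatten_const => b _; rewrite size_map size_block_order.
Qed.

Lemma nth_arrangement d q : q < nblocks i w * K i ->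
  nth d arrangement q =
    ((nth (0, 0, 0) (blocks i w) (q %/ K i)).1,
     (nth (0, 0, 0) (blocks i w) (q %/ K i)).2 * K i +
       nth 0 (block_order (q %/ K i)) (q %% K i)).
Proof.
move=> hq; rewrite /arrangement (@nth_flatten_const _ _ _ _ (K i)) //; last first.
  by move=> b _; rewrite size_map size_block_order.
by rewrite (nth_map 0) // size_block_order ltn_mod (K_gt0 TD).
Qed.

Lemma nblocksK_gt0 : 0 < nblocks i w * K i.
Proof. by rewrite muln_gt0 (K_gt0 TD) (ltnW nblocks_gt1). Qed.

Lemma arrangement_head d : nth d arrangement 0 = (um i.+1, 0, 0).
Proof. by rewrite nth_arrangement ?nblocksK_gt0 // div0n mod0n. Qed.

Lemma arrangement_last d : last d arrangement =
  (uM i.+1, (mult i.+1 w (uM i.+1)).-1, (pieces i (uM i.+1)).-1).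
Proof.
have K0 := K_gt0 TD i; have nb1 := nblocks_gt1.
rewrite -nth_last size_arrangement nth_arrangement; last first.
  by rewrite ltn_predL nblocksK_gt0.
have -> : (nblocks i w * K i).-1 = (nblocks i w).-1 * K i + (K i).-1.
  by rewrite -(prednK (ltnW nb1)) mulSn; case: (K i) K0 => // k _; lia.
have K1 : (K i).-1 < K i by rewrite ltn_predL.
rewrite divnMDl // divn_small // addn0 modnMDl modn_small //.
have -> : nth (0, 0, 0) (blocks i w) (nblocks i w).-1 = block_last i w.
  by rewrite nth_last /= last_rcons.
have bn0 : ((nblocks i w).-1 == 0) = false by lia.
have := nth_last 0 (block_order (nblocks i w).-1); rewrite size_block_order => ->.
rewrite /block_order bn0 /= last_rcons; congr (_, _).
have := ltnW (chunks_gt1 TD (td_uM TD i.+1)).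
rewrite /Labels.pieces; case: (chunks i _) => // c _.
by rewrite mulSn; case: (K i) K0 => // k _; rewrite /= addnC.
Qed.

Definition label_word : seq nat := [seq lab i y.1.1 y.2 | y <- arrangement].

Lemma size_label_word : size label_word = nblocks i w * K i.
Proof. by rewrite size_map size_arrangement. Qed.

Lemma label_word_lt x : x \in label_word -> x < nlab i.+1.
Proof.
case/mapP => -[[u l] p]; rewrite mem_arrangement => /and3P[hu _ hp] -> /=.
exact: Labels.lab_lt.
Qed.

Lemma label_word_full x : x < nlab i.+1 -> x \in label_word.
Proof.
case/lab_ex => v [p [hv hp ->]]; apply/mapP; exists (v, 0, p) => //.
by rewrite mem_arrangement hv hp andbT (mult_gt0 TD).
Qed.

Lemma label_word_head : head 0 label_word = lab i (um i.+1) 0.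
Proof.
rewrite -nth0 (nth_map (0, 0, 0)) ?size_arrangement ?nblocksK_gt0 //.
Qed.

Lemma label_word_last :
  last 0 label_word = lab i (uM i.+1) (pieces i (uM i.+1)).-1.
Proof.
have sz := nblocksK_gt0; rewrite -nth_last size_label_word.
rewrite (nth_map (0, 0, 0)) ?size_arrangement ?ltn_predL //.
by rewrite -size_arrangement nth_last arrangement_last.
Qed.

Lemma copy_label_word q : q < nblocks i w * K i ->
  copy i (nth 0 label_word q) = nth 0 (block_order (q %/ K i)) (q %% K i).
Proof.
move=> hq; rewrite (nth_map (0, 0, 0)) ?size_arrangement //.
have := mem_nth (0, 0, 0) (s := arrangement) (n := q).
rewrite size_arrangement => /(_ hq); rewrite nth_arrangement //=.
case: (nth _ (blocks i w) _) => [[u l] a] /=.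
rewrite mem_arrangement => /and3P[hu hl hp].
rewrite copy_lab // modnMDl modn_small //.
have : nth 0 (block_order (q %/ K i)) (q %% K i) \in block_order (q %/ K i).
  by apply: mem_nth; rewrite size_block_order ltn_mod (K_gt0 TD).
by rewrite (perm_mem (perm_block_order _)) mem_iota.
Qed.

Lemma label_word_start q : q.+1 < nblocks i w * K i ->
  (copy i (nth 0 label_word q) == 0) &&
  (copy i (nth 0 label_word q.+1) == (K i).-1) = (q == 0).
Proof.
move=> hq; have K2 := td_K TD i; have K0 := K_gt0 TD i.
rewrite (copy_label_word hq) (copy_label_word (ltnW hq)).
have -> : (nth 0 (block_order (q %/ K i)) (q %% K i) == 0) = (q %% K i == 0).
  have bo0 : nth 0 (block_order (q %/ K i)) 0 = 0.
    by rewrite /block_order; case: eqP.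
  rewrite -[X in (_ == X) = _]bo0 nth_uniq ?size_block_order ?ltn_mod //.
  by rewrite (perm_uniq (perm_block_order _)) iota_uniq.
have [q0|] := eqVneq (q %% K i) 0; last first.
  by move=> qn; apply/esym; apply: contraNF qn => /eqP ->; rewrite mod0n.
have qE : q = q %/ K i * K i by rewrite {1}(divn_eq q (K i)) q0 addn0.
have K1 : 1 < K i by exact: ltnW.
have -> : q.+1 %/ K i = q %/ K i.
  by rewrite {1}qE -addn1 divnMDl // (divn_small K1) addn0.
have -> : q.+1 %% K i = 1 by rewrite {1}qE -addn1 modnMDl modn_small.
have -> : (q == 0) = (q %/ K i == 0).
  by rewrite {1}qE muln_eq0 [K i == 0]gtn_eqF // orbF.
rewrite /block_order; case: (q %/ K i == 0) => /=; first by rewrite eqxx.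
have sf : size (free_order (q %/ K i)) = K i - 2.
  by rewrite (perm_size (perm_free_order _)) size_iota.
have sf0 : 0 < size (free_order (q %/ K i)) by rewrite sf subn_gt0.
rewrite nth_rcons sf0; apply/negbTE => /=.
have := mem_nth 0 sf0; rewrite (perm_mem (perm_free_order _)) mem_iota.
by move: K2 => /=; lia.
Qed.

Lemma label_word_last_copy : copy i (last 0 label_word) != 0.
Proof.
have hu := td_uM TD i.+1; have K2 := td_K TD i; have K0 := K_gt0 TD i.
have p0 := pieces_gt0 TD hu; rewrite label_word_last copy_lab ?ltn_predL //.
have := chunks_gt1 TD hu; rewrite /Labels.pieces.
case: (chunks i _) => // c _; rewrite mulSn.
have -> : (K i + c * K i).-1 = c * K i + (K i).-1 by lia.
by rewrite modnMDl modn_small ?ltn_predL //; lia.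
Qed.

(** Each copy of a tower [u] contributes all its pieces, whose heights add up to [h i.+1 u] by
    Hermite's identity. *)
Lemma label_word_height :
  \sum_(x <- label_word) piece_height i x = piece_height i.+1 w.
Proof.
rewrite big_map.
pose l3 := [seq (x, p) | x <- [seq (u, l) | u <- iota 0 (r i.+1),
    l <- iota 0 (mult i.+1 w u)], p <- iota 0 (pieces i x.1)].
have pl : perm_eq arrangement l3.
  apply: uniq_perm; first exact: uniq_arrangement.
    apply: allpairs_uniq_dep => [|x _|]; rewrite ?iota_uniq //.
      apply: allpairs_uniq_dep => [|u _|]; rewrite ?iota_uniq //.
      by move=> [u l] [u' l'] _ _ /= [-> ->].
    by move=> [x a] [x' a'] _ _ /= [-> ->].
  move=> [[u l] p]; rewrite mem_arrangement.
  apply/and3P/allpairsPdep => [[hu hl hp]|].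
    exists (u, l), p; split=> //; last by rewrite mem_iota.
    by apply/allpairsPdep; exists u, l; rewrite !mem_iota.
  case=> x [b [/allpairsPdep[u' [l' [hu hl ->]]] hb]].
  by case=> -> -> ->; move: hu hl hb; rewrite !mem_iota.
rewrite (perm_big _ pl) /= big_allpairs_dep /= big_allpairs_dep /=.
rewrite /Labels.piece_height -[RHS](big_mkord xpredT (fun u => mult i.+1 w u * h i.+1 u)).
rewrite {1}/index_iota subn0 big_seq [RHS]big_seq; apply: eq_bigr => u.
rewrite mem_iota /= add0n => hu.
rewrite -/(Labels.piece_height r h s N K i _).
transitivity (\sum_(l <- iota 0 (mult i.+1 w u)) h i.+1 u).
  apply: eq_bigr => l _; rewrite -(piece_height_sum TD hu) /=.
  by rewrite -(big_mkord xpredT (fun p => piece_height i (lab i u p))) /index_iota subn0.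
by rewrite big_const_seq count_predT size_iota iter_addn_0 mulnC.
Qed.

Lemma nblocks_ge : low i.+1 <= nblocks i w * (K i * high i).
Proof.
have /andP[lo _] := piece_height_bound TD hw; apply: leq_trans lo _.
rewrite -label_word_height mulnA -size_label_word.
rewrite -sum1_size big_distrl /= big_seq [leqRHS]big_seq.
apply: leq_sum => x /label_word_lt hx; rewrite mul1n.
by have /andP[] := piece_height_bound TD hx.
Qed.

Lemma nlab_capacity : nlab i.+2 <= (K i - 2)`! ^ nblocks i w.
Proof.
apply: leq_trans (nlab_le TD i.+1) _; apply: (td_capacity TD).
exact: nblocks_ge.
Qed.

End Word.

(** The length of the word gives the number of blocks, and the residues along it give their orders,
    that is, the digits of [w]; by [nlab_capacity] there are enough digits to determine [w]. *)
Lemma label_word_inj i w w' : w < nlab i.+2 -> w' < nlab i.+2 ->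
  label_word i w = label_word i w' -> w = w'.
Proof.
move=> hw hw' e; have K0 := K_gt0 TD i.
have nE : nblocks i w = nblocks i w'.
  have /eqP := congr1 size e; rewrite !size_label_word // eqn_pmul2r //.
  by move/eqP.
have bE b : b < nblocks i w -> block_order i w b = block_order i w' b.
  move=> hb; apply: (@eq_from_nth _ 0); rewrite !size_block_order // => j hj.
  have hq : b * K i + j < nblocks i w * K i.
    by apply: (@leq_trans (b.+1 * K i)); rewrite ?leq_mul2r ?hb ?orbT // mulSn addnC ltn_add2r.
  have := copy_label_word hw hq; rewrite e copy_label_word -?nE //.
  by rewrite divnMDl // divn_small // addn0 modnMDl modn_small // => ->.
have fE b : b < nblocks i w -> free_order i w b = free_order i w' b.
  move=> /bE; rewrite /block_order; case: eqP => _ [] //.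
  by move/rcons_inj => [].
apply: (@digits_inj (K i - 2)`! (nblocks i w)).
- exact: leq_trans hw (nlab_capacity hw).
- by apply: (leq_trans hw'); rewrite nE; exact: nlab_capacity hw'.
- move=> b /fE /eqP; rewrite /free_order nth_uniq ?permutations_uniq //.
  + by move/eqP.
  + by rewrite size_permutations ?iota_uniq // size_iota ltn_mod fact_gt0.
  + by rewrite size_permutations ?iota_uniq // size_iota ltn_mod fact_gt0.
Qed.

(** Level 0 has a single letter, so its words are powers and carry no marker; recognition starts
    from the edges of level 0 instead. *)
Definition diagram_word i w : seq nat :=
  if i is i'.+1 then label_word i' w else nseq (mult 0 w 0) 0.

Lemma mult0_gt0 w : w < nlab 1 -> 0 < mult 0 w 0.
Proof. by move=> hw; apply: (mult_gt0 TD hw); rewrite (td_r0 TD). Qed.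

Lemma diagram_word_letter i w u :
  w < nlab i.+1 -> u \in diagram_word i w -> u < nlab i.
Proof.
case: i => [|i] hw; last exact: label_word_lt.
by rewrite /= mem_nseq => /andP[_ /eqP ->].
Qed.

Lemma diagram_word_full i w u :
  w < nlab i.+1 -> u < nlab i -> u \in diagram_word i w.
Proof.
case: i => [|i] hw; last exact: label_word_full.
by rewrite /= mem_nseq mult0_gt0 // ltnS leqn0.
Qed.

Lemma diagram_word_head i w w' : w < nlab i.+1 -> w' < nlab i.+1 ->
  head 0 (diagram_word i w) = head 0 (diagram_word i w').
Proof.
case: i => [|i] hw hw'.
  by rewrite -!nth0 !nth_nseq !mult0_gt0.
exact: etrans (label_word_head hw) (esym (label_word_head hw')).
Qed.

Lemma diagram_word_last i w w' : w < nlab i.+1 -> w' < nlab i.+1 ->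
  last 0 (diagram_word i w) = last 0 (diagram_word i w').
Proof.
case: i => [|i] hw hw'.
  by rewrite -!nth_last !nth_nseq !if_same.
exact: etrans (label_word_last hw) (esym (label_word_last hw')).
Qed.

Definition label_directive : directive :=
  @Directive nlab diagram_word erefl (nlab_gt0 TD) diagram_word_letter
    diagram_word_full diagram_word_head diagram_word_last.

Lemma label_directive_marked : marked_words label_directive
  (fun i x => copy i x == 0) (fun i x => copy i x == (K i).-1).
Proof.
split.
- move=> n w hw.
  rewrite (size_label_word hw : size (dword label_directive n.+1 w) = _).
  have := nblocks_gt1 n w; have := K_gt0 TD n.
  by case: (nblocks n w) => // -[|b] // K0 _; rewrite mulSn; lia.
- move=> n w q hw.
  rewrite (size_label_word hw : size (dword label_directive n.+1 w) = _).
  exact: label_word_start.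
- by move=> n w hw; exact: label_word_last_copy.
- by move=> n w w' hw hw'; exact: label_word_inj.
Qed.

Lemma label_directive_ht i w : w < nlab i.+1 ->
  ht label_directive i.+1 w = piece_height i w.
Proof.
elim: i w => [|i IHi] w hw.
  rewrite /= /Labels.piece_height (td_r0 TD) big_ord1 (td_h0 TD) muln1.
  by rewrite big_const_seq count_predT size_nseq iter_addn_0 mul1n.
rewrite -label_word_height // [LHS]/=; rewrite big_seq [RHS]big_seq.
by apply: eq_bigr => u /(label_word_lt hw) /IHi.
Qed.

End Arrangements.

(** * Growth estimates and choice of parameters *)

Section Growth.
Variable R : realType.

Lemma expR1_le4 : expR 1 <= 4 :> R.
Proof.
have h : (2 : R)^-1 <= expR (- 2^-1).
  by apply: le_trans (expR_ge1Dx _); lra.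
have e : expR 1 * (expR (- 2^-1) * expR (- 2^-1)) = 1 :> R.
  by rewrite -!expRD -[RHS]expR0; congr expR; lra.
have h2 : (4 : R)^-1 <= expR (- 2^-1) * expR (- 2^-1).
  rewrite (_ : (4 : R)^-1 = 2^-1 * 2^-1); last by rewrite -invfM -natrM.
  by apply: ler_pM => //; rewrite invr_ge0.
have := ler_wpM2l (expR_ge0 (1 : R)) h2; rewrite e; lra.
Qed.

(** From K^K / K! <= e^K <= 4^K and K >= 8 Q one gets K! >= (2 Q)^K; the factor 2^K >= K^2 pays for
    passing to (K - 2)!. *)
Lemma fact_lower (K : nat) (Q : R) : (4 <= K)%N -> 1 <= Q -> 8 * Q <= K%:R ->
  Q ^+ K <= ((K - 2)`!)%:R.
Proof.
move=> K4 Q1 QK; have K0 : (0 : R) <= K%:R by rewrite ler0n.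
have h1 : (K%:R : R) ^+ K <= K`!%:R * 4 ^+ K.
  have := @expR_ge1Dxn R K%:R K.-1 K0; rewrite prednK ?(leq_trans _ K4) // => h.
  have f0 : (0 : R) < K`!%:R by rewrite ltr0n fact_gt0.
  have {h} h : (K%:R : R) ^+ K / K`!%:R <= 4 ^+ K.
    apply: le_trans (le_trans _ (_ : expR (K%:R : R) <= _)).
    + exact: lexx.
    + by apply: le_trans h; rewrite lerDr.
    + rewrite -[X in expR X]mulr1 expRM_natl lerXn2r ?nnegrE ?expR_ge0 //.
      exact: expR1_le4.
  by rewrite mulrC -ler_pdivrMr.
have h2 : (8 * Q) ^+ K <= K`!%:R * 4 ^+ K.
  apply: le_trans h1; rewrite lerXn2r ?nnegrE //; nra.
have h3 : (2 : R) ^+ K * Q ^+ K <= K`!%:R.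
  have f4 : (0 : R) < 4 ^+ K by rewrite exprn_gt0.
  by rewrite -(ler_pM2r f4) mulrAC -!exprMn (_ : 2 * 4 * Q = 8 * Q) //; lra.
have h4 : (K ^ 2 <= 2 ^ K)%N.
  elim: {h1 h2 h3 QK K0} K K4 => // K IHK; rewrite leq_eqVlt => /orP[/eqP <- //|].
  rewrite ltnS => K4; have := IHK K4; rewrite [(2 ^ K.+1)%N]expnS -!mulnn.
  by move: (2 ^ K)%N => m; nia.
have h5 : (K`! <= K ^ 2 * (K - 2)`!)%N.
  have [k ->] : exists k, K = k.+2 by exists (K - 2)%N; lia.
  rewrite subn2 /= !factS -mulnn mulnA leq_mul2r; apply/orP; right; nia.
have q0 : 0 <= Q ^+ K by rewrite exprn_ge0 //; lra.
have k0 : (0 : R) < (K ^ 2)%N%:R by rewrite ltr0n expn_gt0 (leq_trans _ K4).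
rewrite -(ler_pM2l k0) -natrM; apply: le_trans (_ : K`!%:R <= _); last by rewrite ler_nat.
apply: le_trans h3; apply: ler_wpM2r => //.
by rewrite -natrX ler_nat.
Qed.

Lemma poly_le_exp (C delta : R) (c d : nat) : 0 < delta ->
  exists N0, forall N, (N0 <= N)%N -> C * (N + c)%:R ^+ d <= expR (delta * N%:R).
Proof.
(* Once [c <= N], [N + c] is at most [2 * N]; beyond [A] the term of degree [d.+1] of the
   exponential series dominates. *)
move=> d0; pose A := `|C| * 2 ^+ d * d.+1`!%:R / delta ^+ d.+1.
exists (maxn c (Num.truncn A).+1) => N; rewrite geq_max => /andP[cN AN].
have N0 : (0 : R) <= N%:R by rewrite ler0n.
have A0 : 0 <= A.
  by rewrite divr_ge0 ?mulr_ge0 ?ler0n ?exprn_ge0 //; exact: ltW.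
have AleN : A <= N%:R.
  have /andP[_ /ltW h] := Num.Theory.truncn_itv A0; apply: le_trans h _.
  by rewrite ler_nat.
have dN0 : 0 <= delta * N%:R by rewrite mulr_ge0 // ltW.
have h := @expR_ge1Dxn R _ d dN0.
apply: le_trans (_ : (delta * N%:R) ^+ d.+1 / d.+1`!%:R <= _); last first.
  by apply: le_trans h; rewrite lerDr.
have f0 : (0 : R) < d.+1`!%:R by rewrite ltr0n fact_gt0.
have dd0 : 0 < delta ^+ d.+1 by rewrite exprn_gt0.
rewrite ler_pdivlMr //.
apply: le_trans (_ : `|C| * (2 * N%:R) ^+ d * d.+1`!%:R <= _).
  apply: ler_wpM2r; first by rewrite ltW.
  apply: le_trans (_ : `|C| * (N + c)%:R ^+ d <= _).
    by apply: ler_wpM2r; [rewrite exprn_ge0|exact: ler_norm].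
  apply: ler_wpM2l => //; rewrite lerXn2r ?nnegrE ?ler0n ?mulr_ge0 // natrD mulr_natl mulr2n.
  by rewrite lerD2l ler_nat.
rewrite !exprMn exprS [X in _ <= _ * X]exprS.
have := AleN; rewrite /A ler_pdivrMr // => hA.
have nd0 : 0 <= (N%:R : R) ^+ d by rewrite exprn_ge0.
have := ler_wpM2r nd0 hA; rewrite exprS; nra.
Qed.

Lemma parameters_arith (N0 G l0 S i : nat) :
  exists N : nat, [/\ (1 < N)%N, (G <= N)%N, (0 < N - S)%N,
    (i.+1 * ((N + S.+1) - (N - S)) <= N - S)%N & [/\ (N0 <= N)%N,
    (l0 <= N - S)%N & (N = (N - S) + S)%N]].
Proof.
exists (N0 + G + l0 + S + 2 + i.+1 * (2 * S).+1)%N.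
set m := (i.+1 * (2 * S).+1)%N.
have -> : (N0 + G + l0 + S + 2 + m - S = N0 + G + l0 + 2 + m)%N by lia.
have -> : (N0 + G + l0 + S + 2 + m + S.+1 - (N0 + G + l0 + 2 + m) = (2 * S).+1)%N by lia.
by rewrite -/m; split; [lia|lia|lia|lia|split; lia].
Qed.

(** [K] is just above 8 (i+1) (n'+1) exp(b n') with b = a + 1/(i+2). The exponential gives the
    factorial bound, the factors i + 1 and n' + 1 beat [g] and the pigeonhole loss, and b < b' = a +
    1/(i+1) leaves room for the polynomial factor in the number of labels. *)
Lemma parameters_ex (a : R) (g : nat -> R) (i S r G : nat) : 0 <= a ->
  (forall n, 0 < g n) -> ln (g n) / n%:R @[n --> \oo] --> a ->
  exists N K : nat, let n := (N - S)%N in let n' := (N + S.+1)%N in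
  [/\ [/\ (1 < N)%N, (G <= N)%N, (2 < K)%N, (0 < n)%N & (i.+1 * (n' - n) <= n)%N],
    expR ((a + i.+2%:R^-1) * (n' * K)%:R) <= ((K - 2)`!)%:R,
    ((n'.+1 ^ r * K)%N)%:R <= expR ((a + i.+1%:R^-1) * n%:R) &
    forall l, (n <= l <= n')%N -> i.+1%:R * n'.+1%:R * g l <= K%:R /\
      n'.+1%:R * expR (a * l%:R) <= K%:R].
Proof.
move=> a0 g0 glim; pose b := a + i.+2%:R^-1; pose b' := a + i.+1%:R^-1.
have i2 : (0 : R) < i.+2%:R^-1 by rewrite invr_gt0.
have bb' : b < b' by rewrite ltrD2l ltf_pV2 ?posrE // ltr_nat.
have b0 : 0 < b by rewrite ltr_pwDr.
have [l0 _ gl0] : \forall l \near \oo, g l <= expR (b * l%:R).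
  have : \forall l \near \oo, ln (g l) / l%:R < b.
    by apply: (cvgr_lt a glim); rewrite ltrDl.
  have : \forall l \near \oo, (0 < l)%N by exists 1%N.
  apply: filterS2 => l lgt0 h; have l0 : (0 : R) < l%:R by rewrite ltr0n.
  rewrite -[g l]lnK ?posrE // ler_expR; apply: ltW.
  by rewrite -ltr_pdivrMr.
(* [K] is at most 9/8 of [x], whose constant is 8, which gives 9; 18 leaves a factor 2. The
   exponentials account for n' = N + S + 1 and n = N - S. *)
pose C := 18 * i.+1%:R * expR (b * S.+1%:R + b' * S%:R).
have d0 : 0 < b' - b by rewrite subr_gt0.
have [N0 hN0] := poly_le_exp C S.+2 r.+1 d0.
have [N [N1 GN n0 spread [NN0 l0n NE]]] := parameters_arith N0 G l0 S i.
pose n := (N - S)%N; pose n' := (N + S.+1)%N.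
pose Q := expR (b * n'%:R).
have Q1 : 1 <= Q by rewrite -[1]expR0 ler_expR mulr_ge0 // ltW.
pose x := 8 * i.+1%:R * n'.+1%:R * Q.
have i1 : (1 : R) <= i.+1%:R by rewrite ler1n.
have n1 : (1 : R) <= n'.+1%:R by rewrite ler1n.
have iS1 : 1 <= i.+1%:R * n'.+1%:R :> R.
  by rewrite mulr_ege1.
have xQ : 8 * Q <= x.
  by rewrite /x -[_ * n'.+1%:R]mulrA ler_pM2r ?expR_gt0 // ler_peMr.
have x8 : 8 <= x by apply: le_trans xQ; lra.
have /andP[trx xtr] : (Num.truncn x)%:R <= x < (Num.truncn x).+1%:R.
  by apply: Num.Theory.truncn_itv; lra.
pose K := (Num.truncn x).+1.
have xK : x <= K%:R by exact: ltW.
have Kx : K%:R <= 9 / 8 * x by rewrite /K -natr1; lra.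
have K8 : (8 <= K)%N by rewrite -(ler_nat R); exact: le_trans xK.
exists N, K; split.
- by split=> //; exact: leq_trans K8.
- rewrite -/n' natrM mulrA expRM_natr; apply: fact_lower => //.
    exact: leq_trans K8.
  exact: le_trans xK.
- rewrite -/n -/n' natrM natrX.
  apply: le_trans (_ : n'.+1%:R ^+ r * (9 / 8 * x) <= _).
    by apply: ler_wpM2l => //; rewrite exprn_ge0.
  have := hN0 N NN0.
  have -> : (N + S.+2)%N = n'.+1 by rewrite /n' addnS.
  have NE' : N%:R = n%:R + S%:R :> R by rewrite -natrD -NE.
  have n'E : (n' = N + S.+1)%N by [].
  have e1 : expR (b' * n%:R) = expR ((b' - b) * N%:R) * expR (b * N%:R) / expR (b' * S%:R).
    rewrite -expRD -expRN -expRD; congr expR.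
    by rewrite -mulrDl subrK -mulrBr NE' addrK.
  have e2 : Q = expR (b * N%:R) * expR (b * S.+1%:R).
    by rewrite /Q n'E natrD mulrDr expRD.
  rewrite -/b' e1 ler_pdivlMr ?expR_gt0 // /x e2 /C expRD exprSr.
  set A := n'.+1%:R; set Ar := A ^+ r; set u := expR (b * S.+1%:R).
  set v := expR (b' * S%:R); set w := expR (b * N%:R) => h.
  have w0 : 0 <= w by exact: expR_ge0.
  have := ler_wpM2r w0 h.
  set z := expR _; set t := i.+1%:R => h'.
  apply: le_trans (le_trans _ h') _; last by [].
  suff -> : Ar * (9 / 8 * (8 * t * A * (w * u))) * v = 9 * (t * (u * v) * (Ar * A) * w).
    have : 0 <= t * (u * v) * (Ar * A) * w.
      by rewrite !mulr_ge0 ?exprn_ge0 ?expR_ge0.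
    rewrite (_ : 18 * t * (u * v) * (Ar * A) * w = 18 * (t * (u * v) * (Ar * A) * w)).
      by move: (_ * w) => y; lra.
    by rewrite -!mulrA.
  have aux (q1 q2 q3 q4 q5 q6 : R) : q1 * (9 / 8 * (8 * q2 * q3 * (q4 * q5))) * q6 =
      9 * (q2 * (q5 * q6) * (q1 * q3) * q4) by lra.
  exact: aux.
- move=> l /andP[nl ln']; have Q0 : 0 <= Q by exact: expR_ge0.
  have iQ : i.+1%:R * n'.+1%:R * Q <= K%:R.
    apply: le_trans xK; rewrite /x.
    have : 0 <= i.+1%:R * n'.+1%:R * Q by rewrite !mulr_ge0.
    lra.
  have lQ : expR (b * l%:R) <= Q by rewrite ler_expR ler_pM2l // ler_nat.
  split.
    apply: le_trans iQ; apply: ler_wpM2l; first by rewrite mulr_ge0.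
    apply: le_trans lQ; apply: gl0 => /=; exact: leq_trans nl.
  apply: le_trans iQ; rewrite -mulrA; apply: le_trans (_ : n'.+1%:R * Q <= _).
    apply: ler_wpM2l => //; apply: le_trans lQ; rewrite ler_expR.
    by apply: ler_wpM2r => //; rewrite lerDl ltW.
  by rewrite ler_peMl // mulr_ge0.
Qed.

Lemma limn_einf_eq0 (u : nat -> R) : (forall n, 0 <= u n) ->
  (forall i, exists2 l, (i <= l)%N & u l <= i.+1%:R^-1) ->
  limn_einf (fun n => (u n)%:E) = 0%E.
Proof.
move=> u0 ul; rewrite limn_einf_lim.
have -> : limn (einfs (fun n => (u n)%:E)) = ereal_sup (range (einfs (fun n => (u n)%:E))).
  by apply/cvg_lim => //; exact/cvg_einfs_sup.
apply/eqP; rewrite eq_le; apply/andP; split; last first.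
  apply: le_trans (ereal_sup_ubound _); last by exists 0%N.
  by apply: le_ereal_inf_tmp => _ [m _ <-]; rewrite lee_fin.
apply: ge_ereal_sup => _ [n _ <-].
apply/lee_addgt0Pr => e e0; rewrite add0e.
have [l nl le] := ul (maxn n (Num.truncn e^-1)).
apply: ereal_inf_le => /=; exists (u l)%:E.
  by exists l => //=; apply: leq_trans nl; exact: leq_maxl.
rewrite lee_fin; apply: le_trans le _; rewrite -[leRHS]invrK lef_pV2 ?posrE ?invr_gt0 //.
have /andP[_ /ltW h] : (Num.truncn e^-1)%:R <= e^-1 < (Num.truncn e^-1).+1%:R.
  by apply: Num.Theory.truncn_itv; rewrite invr_ge0 ltW.
by apply: le_trans h _; rewrite ler_nat ltnS leq_maxr.
Qed.

(** The upper bound is [pup]. The lower bound, known for arbitrarily large [l], spreads to every [n]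
    by Fekete's argument: a deficit at [n] would be repeated about [l / n] times at [l]. *)
Lemma submultiplicative_cvg (p : nat -> nat) (a : R) : 0 <= a ->
  (forall n, (0 < p n)%N) -> (forall m n, (p (m + n) <= p m * p n)%N) ->
  (forall i, exists2 l, (i <= l)%N & expR (a * l%:R) <= (p l)%:R) ->
  (forall e, 0 < e -> exists C, forall l, (p l)%:R <= expR ((a + e) * l%:R + C)) ->
  ln ((p n)%:R : R) / n%:R @[n --> \oo] --> a.
Proof.
move=> a0 p0 pD plow pup.
have lnp0 n : 0 <= ln ((p n)%:R : R) by rewrite ln_ge0 // ler1n.
have low n : (0 < n)%N -> a * n%:R <= ln ((p n)%:R : R).
  move=> n0; rewrite leNgt; apply/negP => lt.
  pose d := a * n%:R - ln ((p n)%:R : R).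
  have d0 : 0 < d by rewrite subr_gt0.
  pose B := (\prod_(r < n) p r)%N.
  have pB r : (r < n)%N -> (p r <= B)%N.
    move=> rn; rewrite /B (bigD1 (Ordinal rn)) //= leq_pmulr //.
    by apply: prodn_gt0 => j; exact: p0.
  have pq q r : (p (q * n + r) <= p n ^ q * p r)%N.
    elim: q => [|q IHq]; first by rewrite mul0n add0n expn0 mul1n.
    rewrite mulSn -addnA; apply: leq_trans (pD _ _) _.
    by rewrite expnS -mulnA leq_mul2l IHq orbT.
  have lnB : 0 <= ln (B%:R : R).
    by rewrite ln_ge0 // ler1n prodn_gt0.
  (* After [q0] repetitions the deficit [d] outweighs the bound [B] for the incomplete last
     period. *)
  pose q0 := (Num.truncn (ln (B%:R : R) / d)).+1.
  have hq0 : ln (B%:R : R) < q0%:R * d.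
    have /andP[_] := Num.Theory.truncn_itv (divr_ge0 lnB (ltW d0)).
    by rewrite ltr_pdivrMr.
  have [l hl el] := plow (q0 * n)%N.
  have rn : (l %% n < n)%N by rewrite ltn_mod.
  have qq : (q0 <= l %/ n)%N by rewrite leq_divRL.
  have h1 : expR (a * l%:R) <= (p n)%:R ^+ (l %/ n) * B%:R :> R.
    apply: le_trans el _; rewrite -natrX -natrM ler_nat {1}(divn_eq l n).
    apply: leq_trans (pq _ _) _; rewrite leq_mul2l pB ?orbT //.
  have pn0 : (0 : R) < (p n)%:R by rewrite ltr0n.
  have B0 : (0 : R) < B%:R by rewrite ltr0n prodn_gt0.
  have h2 : a * l%:R <= ln ((p n)%:R : R) * (l %/ n)%:R + ln (B%:R : R).
    by rewrite -ler_expR expRD [X in _ <= X * _]expRM_natr (lnK pn0) (lnK B0).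
  have h3 : a * ((l %/ n)%:R * n%:R) <= a * l%:R.
    by apply: ler_wpM2l => //; rewrite -natrM ler_nat leq_trunc_div.
  have h4 : q0%:R * d <= (l %/ n)%:R * d by rewrite ler_pM2r // ler_nat.
  move: h2 h3 h4 hq0; rewrite /d; set q := (l %/ n)%:R; set Ln := ln (p n)%:R.
  set m := (n%:R : R); set LB := ln _; set Q0 := q0%:R; set L := l%:R.
  nra.
apply/cvgrPdist_le => e e0; have e2 : 0 < e / 2 by lra.
have [C hC] := pup _ e2.
near=> n.
have n0 : (0 < n)%N by near: n; exists 1%N.
have nR : (0 : R) < n%:R by rewrite ltr0n.
have nC : C <= e / 2 * n%:R.
  rewrite -ler_pdivrMl // mulrC; near: n.
  exact: nbhs_infty_ger.
have up : ln ((p n)%:R : R) <= (a + e / 2) * n%:R + C.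
  by rewrite -ler_expR lnK ?posrE ?ltr0n.
have l1 : a <= ln ((p n)%:R : R) / n%:R by rewrite ler_pdivlMr // low.
have l2 : ln ((p n)%:R : R) / n%:R <= a + e.
  by rewrite ler_pdivrMr //; apply: le_trans up _; lra.
rewrite distrC ger0_norm; lra.
Unshelve. all: by end_near. Qed.

End Growth.

(** * The homeomorphism onto the path space of labels *)

Lemma count_take_inj (s : seq nat) u q q' : (q < size s)%N -> (q' < size s)%N ->
  nth 0%N s q = u -> nth 0%N s q' = u ->
  count_mem u (take q s) = count_mem u (take q' s) -> q = q'.
Proof.
have aux a b : (a < b)%N -> (b < size s)%N -> nth 0%N s a = u ->
    (count_mem u (take a s) < count_mem u (take b s))%N.
  move=> ab bs ua; rewrite -(cat_take_drop a.+1 (take b s)) count_cat take_takel //.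
  rewrite (take_nth 0%N) ?(ltn_trans ab) // -cats1 count_cat /= ua eqxx; lia.
move=> qs q's uq uq' e; have [lt|lt|//] := ltngtP q q'.
- by have := aux _ _ lt q's uq; rewrite e ltnn.
- by have := aux _ _ lt qs uq'; rewrite e ltnn.
Qed.

Section Theta.
Local Open Scope nat_scope.
Variables (X : topologicalType) (T : homeomorphism X X).
Variable hX : homeomorphism X cantor_space.
Variable x0 : X.
Local Notation TV := (homeo_inv T).
Variables (pt : nat -> towers X) (H : nat -> nat).
Hypothesis pt0 : pt 0 = trivial_towers X.
Hypothesis tpt : forall i, tower_partition T x0 (pt i).
Hypothesis rpt : forall i, refines T hX x0 i (H i) (pt i) (pt i.+1).
Variables (N K : nat -> nat).
Local Notation tix := (tix pt).
Local Notation tblock := (tblock T pt).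
Local Notation titin := (titin tpt).
Hypothesis TD : tower_data (tnum pt) (tht pt) titin N K
  (fun i => tix i x0) (fun i => tix i (TV x0)).
Local Notation D := (label_directive TD).
Local Notation P := (path_space (dorder D)).
Local Notation lab := (lab (tnum pt) (tht pt) titin N K).
Local Notation mult := (mult (tnum pt) (tht pt) titin N K).
Local Notation pieces := (pieces (tht pt) N K).
Local Notation visits := (visits titin).
Local Notation arrangement :=
  (arrangement (tnum pt) (tht pt) titin N K (fun i => tix i x0) (fun i => tix i (TV x0))).

(** The visits of [v] to [u], in order of time, are dealt out to the pieces in batches of these
    sizes; [reshape_index] is the piece that receives a visit, and [reshape_offset] its place
    there. *)
Definition piece_shape i v u : seq nat :=
  [seq (visits i v u + p) %/ pieces i v | p <- iota 0 (pieces i v)].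

Definition occurrence i x : nat :=
  count_mem (tix i x) (take (tblock i x) (titin i (tix i.+1 x))).
Definition piece i x : nat :=
  reshape_index (piece_shape i (tix i.+1 x) (tix i x)) (occurrence i x).
Definition piece_pos i x : nat :=
  reshape_offset (piece_shape i (tix i.+1 x) (tix i x)) (occurrence i x).

Lemma size_piece_shape i v u : size (piece_shape i v u) = pieces i v.
Proof. by rewrite size_map size_iota. Qed.

Lemma sumn_piece_shape i v u : v < tnum pt i.+1 ->
  sumn (piece_shape i v u) = visits i v u.
Proof.
move=> hv; rewrite sumnE big_map -[RHS](hermite (visits i v u) (pieces_gt0 TD hv)).
by rewrite -(big_mkord xpredT (fun p => (visits i v u + p) %/ pieces i v)) /index_iota subn0.
Qed.

Lemma nth_piece_shape i v u p : v < tnum pt i.+1 -> u < tnum pt i ->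
  p < pieces i v -> nth 0 (piece_shape i v u) p = mult i (lab i v p) u.
Proof.
by move=> hv hu hp; rewrite mult_lab // (nth_map 0) ?size_iota // nth_iota.
Qed.

Lemma occurrence_lt i x : occurrence i x < visits i (tix i.+1 x) (tix i x).
Proof.
rewrite /occurrence /Labels.visits -[in ltnRHS](cat_take_drop (tblock i x) (titin i (tix i.+1 x))).
rewrite count_cat (drop_nth 0 (tblock_lt tpt rpt i x)) /= (nth_titin tpt rpt) eqxx; lia.
Qed.

Lemma occurrence_lt_sumn i x :
  occurrence i x < sumn (piece_shape i (tix i.+1 x) (tix i x)).
Proof. by rewrite sumn_piece_shape ?occurrence_lt // (tix_lt tpt). Qed.

Lemma piece_lt i x : piece i x < pieces i (tix i.+1 x).
Proof. by rewrite -(size_piece_shape i _ (tix i x)) reshape_indexP // occurrence_lt_sumn. Qed.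

Definition wvtx i x : nat := if i is i'.+1 then lab i' (tix i x) (piece i' x) else 0.

Lemma piece_pos_lt i x : piece_pos i x < mult i (wvtx i.+1 x) (tix i x).
Proof.
rewrite -nth_piece_shape ?(tix_lt tpt) ?piece_lt //.
exact: reshape_offsetP (occurrence_lt_sumn i x).
Qed.

(** Tower and piece determine the source label; the place within the piece above tells apart the
    copies of the tower in the upper label. *)
Definition wtriple i x : nat * nat * nat := (tix i.+1 x, piece_pos i.+1 x, piece i x).

Definition wpos i x : nat :=
  if i is i'.+1 then index (wtriple i' x) (arrangement i' (wvtx i.+1 x))
  else piece_pos 0 x.

Lemma wvtx_lt i x : wvtx i.+1 x < dnum D i.+1.
Proof. by apply: Labels.lab_lt; [exact: (tix_lt tpt)|exact: piece_lt]. Qed.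

Lemma wtriple_mem i x : wtriple i x \in arrangement i (wvtx i.+2 x).
Proof.
rewrite (mem_arrangement TD (wvtx_lt i.+1 x)).
by rewrite (tix_lt tpt) piece_pos_lt piece_lt.
Qed.

Lemma wpath x : exists z : P, (forall n, vtx z n = wvtx n x) /\ (forall n, pos z n = wpos n x).
Proof.
apply: path_ex => [n|[|n]|[|n]]; first exact: wvtx_lt.
- rewrite /= size_nseq -[X in mult _ _ X](tix0 pt0 x); exact: piece_pos_lt.
- have -> : size (dword D n.+1 (wvtx n.+2 x)) = size (arrangement n (wvtx n.+2 x)).
    by rewrite /= size_map.
  by rewrite index_mem wtriple_mem.
- by rewrite /= nth_nseq if_same.
- rewrite [wvtx n.+1 x]/= -[lab n _ _]/((fun y => lab n y.1.1 y.2) (wtriple n x)).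
  rewrite -[X in _ X = _](nth_index (0, 0, 0) (wtriple_mem n x)).
  rewrite -(nth_map _ 0 (fun y => lab n y.1.1 y.2)) //.
  by rewrite index_mem wtriple_mem.
Qed.

Definition theta x : P := projT1 (cid (wpath x)).

Lemma vtx_theta n x : vtx (theta x) n = wvtx n x.
Proof. by rewrite /theta; case: cid => z [/= h _]. Qed.

Lemma pos_theta n x : pos (theta x) n = wpos n x.
Proof. by rewrite /theta; case: cid => z [/= _ h]. Qed.

Lemma piece_inj i x y : tix i.+1 x = tix i.+1 y -> tix i x = tix i y ->
  piece i x = piece i y -> piece_pos i x = piece_pos i y -> tblock i x = tblock i y.
Proof.
move=> e1 e0 ep el.
have oE : occurrence i x = occurrence i y.
  rewrite -(reshape_indexK (piece_shape i (tix i.+1 x) (tix i x)) (occurrence i x)).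
  rewrite -/(piece i x) -/(piece_pos i x) ep el e1 e0.
  exact: reshape_indexK.
apply: (@count_take_inj (titin i (tix i.+1 x)) (tix i x)).
- exact: tblock_lt tpt rpt i x.
- by rewrite e1; exact: tblock_lt tpt rpt i y.
- exact: nth_titin tpt rpt i x.
- by rewrite e1 e0; exact: nth_titin tpt rpt i y.
- by move: oE; rewrite /occurrence -e1 -e0.
Qed.

Lemma piece_eq i x y : tix i.+1 x = tix i.+1 y -> tblock i x = tblock i y ->
  [/\ tix i x = tix i y, piece i x = piece i y & piece_pos i x = piece_pos i y].
Proof.
move=> e1 eb; have e0 : tix i x = tix i y.
  by rewrite -(nth_titin tpt rpt i x) -(nth_titin tpt rpt i y) e1 eb.
by split; rewrite // /piece /piece_pos /occurrence e1 e0 eb.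
Qed.

(** One level is lost because the edge [i.+1] of [theta x] involves the piece at level [i]. *)
Lemma theta_same n x y : same_later T pt n x y -> same_tail n.+1 (theta x) (theta y).
Proof.
move=> xy [//|i] ni; rewrite !vtx_theta !pos_theta.
have hi j : n <= j -> [/\ tix j x = tix j y, piece j x = piece j y &
    piece_pos j x = piece_pos j y].
  by move=> nj; have [e1 e2] := xy j nj; exact: piece_eq.
have [_ p1 l1] := hi i.+1 (leqW ni); have [_ p0 _] := hi i ni.
have [e2 _] := xy i.+1 (leqW ni); have [e1 _] := xy i ni.
have wE : wvtx i.+2 x = wvtx i.+2 y by rewrite /= e2 p1.
by split=> //; rewrite /wpos wE /wtriple e1 l1 p0.
Qed.

Lemma wtriple_eq i x y : vtx (theta x) i.+2 = vtx (theta y) i.+2 ->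
  pos (theta x) i.+1 = pos (theta y) i.+1 -> wtriple i x = wtriple i y.
Proof.
rewrite !vtx_theta !pos_theta => ev; rewrite /wpos -ev => ep.
rewrite -(nth_index (0, 0, 0) (wtriple_mem i x)) ep.
by rewrite nth_index // ev wtriple_mem.
Qed.

Lemma same_theta n x y : same_tail n.+1 (theta x) (theta y) ->
  same_later T pt n.+1 x y.
Proof.
move=> xy; have tr i : n <= i -> wtriple i x = wtriple i y.
  by move=> ni; have [ev ep] := xy i.+1 ni; exact: wtriple_eq.
move=> [//|i] ni; have [e2 _ p1] := tr i.+1 (leqW ni); have [e1 l1 _] := tr i ni.
by split=> //; exact: piece_inj.
Qed.

Lemma theta_inj x y : theta x = theta y -> x = y.
Proof.
move=> e; have tr i : wtriple i x = wtriple i y by apply: wtriple_eq; rewrite e.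
apply: (same_later_eq tpt rpt (n := 0)); last by rewrite !(tpos0 pt0).
move=> [|i] _; last first.
  have [e2 _ p1] := tr i.+1; have [e1 l1 _] := tr i.
  by split=> //; exact: piece_inj.
have [e1 _ p0] := tr 0; split=> //; apply: piece_inj => //.
  by rewrite !(tix0 pt0).
by have := pos_theta 0 x; rewrite e pos_theta.
Qed.

(** Decoding: the triple of each edge gives tower, piece and place; piece and place give the number
    of the visit, hence the block, and [tower_path_ex] realises the resulting path of towers. *)
Lemma theta_surj z : exists x, theta x = z.
Proof.
pose tr j := nth (0, 0, 0) (arrangement j (vtx z j.+2)) (pos z j.+1).
pose v i := if i is j.+1 then (tr j).1.1 else 0.
pose l i := if i is j.+1 then (tr j).1.2 else pos z 0.
pose c j := (tr j).2.
have trm j : tr j \in arrangement j (vtx z j.+2).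
  by apply: mem_nth; have := pos_lt z j.+1; rewrite /= size_map.
have trP j : [/\ v j.+1 < tnum pt j.+1, l j.+1 < mult j.+1 (vtx z j.+2) (v j.+1) &
    c j < pieces j (v j.+1)].
  have := trm j; rewrite /v /l /c; case: (tr j) => [[a b] d].
  by rewrite (mem_arrangement TD (vtx_lt z j.+2)) => /and3P.
have vzE j : vtx z j.+1 = lab j (v j.+1) (c j).
  rewrite vtxE [dword D j.+1 _]/= (nth_map (0, 0, 0)) //.
  by have := pos_lt z j.+1; rewrite /= size_map.
have vlt i : v i < tnum pt i.
  by case: i => [|i]; [exact: (td_r_gt0 TD)|case: (trP i)].
have llt i : l i < mult i (vtx z i.+1) (v i).
  by case: i => [|i]; [have := pos_lt z 0; rewrite /= size_nseq|case: (trP i)].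
have clt i : c i < pieces i (v i.+1) by case: (trP i).
pose sh i := piece_shape i (v i.+1) (v i).
have lsh i : l i < nth 0 (sh i) (c i) by rewrite nth_piece_shape // -vzE.
pose o i := flatten_index (sh i) (c i) (l i).
have olt i : o i < visits i (v i.+1) (v i).
  by rewrite -sumn_piece_shape //; exact: flatten_indexP.
have /choice[k kP] : forall i, exists k, [/\ k < size (titin i (v i.+1)),
    nth 0 (titin i (v i.+1)) k = v i &
    count_mem (v i) (take k (titin i (v i.+1))) = o i].
  move=> i; have := olt i; rewrite /Labels.visits -size_filter => /(@filter_index _ 0)[k].
  by case=> h1 /eqP h2 h3; exists k.
have [i|i|i|x xP] := @tower_path_ex _ _ _ _ _ _ tpt rpt v k.
- exact: vlt.
- by case: (kP i).
- by case: (kP i).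
exists x; have xv i : tix i x = v i.
  by rewrite -(nth_titin tpt rpt i x) (xP i).1 (xP i).2; case: (kP i).
have xo i : occurrence i x = o i.
  by rewrite /occurrence !xv (xP i).2; case: (kP i).
have xp i : piece i x = c i by rewrite /piece xo !xv flatten_indexKl.
have xl i : piece_pos i x = l i by rewrite /piece_pos xo !xv flatten_indexKr.
have xw i : wvtx i.+1 x = vtx z i.+1 by rewrite /= xv xp -vzE.
apply: path_eq => n; rewrite ?vtx_theta ?pos_theta ?xw //.
case: n => [|n]; first exact: xl.
rewrite /wpos xw /wtriple xv xl xp.
have -> : (v n.+1, l n.+1, c n) = tr n by rewrite /v /l /c; case: (tr n) => [[]].
rewrite /tr index_uniq //; first by have := pos_lt z n.+1; rewrite /= size_map.
exact: (uniq_arrangement TD (vtx_lt z n.+2)).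
Qed.

Lemma loc_const_wvtx i : loc_const (wvtx i) /\ loc_const (piece_pos i).
Proof.
have lpair j : loc_const (fun x => (tix j.+1 x, tix j x, occurrence j x)).
  have h := loc_const2 (fun a b => (a, b))
    (loc_const2 (fun a b => (a, b)) (loc_const_tix tpt j.+1) (loc_const_tix tpt j))
    (loc_const_tblock tpt j).
  exact: (loc_const_comp (fun q : nat * nat * nat => (q.1.1, q.1.2,
    count_mem q.1.2 (take q.2 (titin j q.1.1)))) h).
split; last first.
  exact: (loc_const_comp (fun q : nat * nat * nat =>
    reshape_offset (piece_shape i q.1.1 q.1.2) q.2) (lpair i)).
case: i => [|i]; first exact: loc_const_cst.
exact: (loc_const_comp (fun q : nat * nat * nat => lab i q.1.1
    (reshape_index (piece_shape i q.1.1 q.1.2) q.2)) (lpair i)).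
Qed.

Lemma loc_const_piece i : loc_const (piece i).
Proof.
have h := loc_const2 (fun a b => (a, b))
    (loc_const2 (fun a b => (a, b)) (loc_const_tix tpt i.+1) (loc_const_tix tpt i))
    (loc_const_tblock tpt i).
exact: (loc_const_comp (fun q : nat * nat * nat =>
  reshape_index (piece_shape i q.1.1 q.1.2)
    (count_mem q.1.2 (take q.2 (titin i q.1.1)))) h).
Qed.

Lemma loc_const_wpos i : loc_const (wpos i).
Proof.
case: i => [|i]; first exact: (loc_const_wvtx 0).2.
apply: (loc_const2 (fun t w => index t (arrangement i w))); last exact: (loc_const_wvtx i.+2).1.
apply: (loc_const2 (fun a b => (a, b))); last exact: loc_const_piece.
apply: (loc_const2 (fun a b => (a, b))); last exact: (loc_const_wvtx i.+1).2.
exact: (loc_const_tix tpt).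
Qed.

Lemma theta_continuous : continuous theta.
Proof.
apply: (@continuous_comp_initial _ X _ set_val theta).
apply: continuous_coords => i x.
move: ((loc_const_wvtx i.+1).1 x) (@loc_const_wpos i x).
by apply: filterS2 => y ev ep; apply: path_edge_eq; rewrite ?vtx_theta ?pos_theta.
Qed.

Lemma theta_x0 i : pos (theta x0) i = 0.
Proof.
have o0 j : occurrence j x0 = 0 by rewrite /occurrence (tblock_x0 tpt) take0.
have sh0 j : 0 < nth 0 (piece_shape j (tix j.+1 x0) (tix j x0)) 0.
  rewrite nth_piece_shape ?(tix_lt tpt) ?(pieces_gt0 TD) ?(tix_lt tpt) //.
  apply: (mult_gt0 TD); rewrite ?(tix_lt tpt) //.
  by apply: Labels.lab_lt; rewrite ?(pieces_gt0 TD) ?(tix_lt tpt).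
have f0 j : 0 = flatten_index (piece_shape j (tix j.+1 x0) (tix j x0)) 0 0.
  by rewrite /flatten_index take0.
have p0 j : piece j x0 = 0 by rewrite /piece o0 [X in reshape_index _ X](f0 j) flatten_indexKl.
have l0 j : piece_pos j x0 = 0.
  by rewrite /piece_pos o0 [X in reshape_offset _ X](f0 j) flatten_indexKr.
rewrite pos_theta; case: i => [|i]; first exact: l0.
have hw := wvtx_lt i.+1 x0.
rewrite /wpos /wtriple l0 p0 -(arrangement_head TD hw (0, 0, 0)).
by rewrite index_uniq ?(uniq_arrangement TD hw) // (size_arrangement TD hw).
Qed.

(** The predecessor of [x0] is in the last block of every tower, hence in the last place of the last
    piece, and every arrangement ends with exactly this triple. *)
Lemma theta_top i : edge_top (theta (TV x0)) i.
Proof.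
set y := TV x0.
have oE j : (occurrence j y).+1 = visits j (tix j.+1 y) (tix j y).
  have sz := tblock_top tpt rpt j; rewrite -/y in sz.
  have hq := tblock_lt tpt rpt j y.
  rewrite /occurrence /Labels.visits -[in RHS](cat_take_drop (tblock j y) (titin j (tix j.+1 y))).
  rewrite count_cat (drop_nth 0 hq) (nth_titin tpt rpt) drop_oversize ?sz //=.
  by rewrite eqxx addn1.
have t0 j : 0 < pieces j (tix j.+1 y) by rewrite (pieces_gt0 TD) ?(tix_lt tpt).
pose t j := (pieces j (tix j.+1 y)).-1.
have tlt j : t j < pieces j (tix j.+1 y) by rewrite ltn_predL.
pose sh j := piece_shape j (tix j.+1 y) (tix j y).
have shE j : nth 0 (sh j) (t j) = mult j (lab j (tix j.+1 y) (t j)) (tix j y).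
  by rewrite nth_piece_shape ?(tix_lt tpt).
have sh0 j : 0 < nth 0 (sh j) (t j).
  rewrite shE; apply: (mult_gt0 TD); rewrite ?(tix_lt tpt) //.
  by apply: Labels.lab_lt; rewrite ?(tix_lt tpt).
have fE j : occurrence j y = flatten_index (sh j) (t j) (nth 0 (sh j) (t j)).-1.
  apply: succn_inj; rewrite oE -sumn_piece_shape ?(tix_lt tpt) // -/(sh j).
  rewrite /flatten_index -addnS prednK //.
  have szt : t j < size (sh j) by rewrite size_piece_shape.
  rewrite -[in LHS](take_size (sh j)) size_piece_shape -[in LHS](prednK (t0 j)).
  by rewrite (take_nth 0) // -cats1 sumn_cat /= addn0.
have lt_ j : (nth 0 (sh j) (t j)).-1 < nth 0 (sh j) (t j) by rewrite ltn_predL.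
have p0 j : piece j y = t j by rewrite /piece fE flatten_indexKl.
have l0 j : piece_pos j y = (nth 0 (sh j) (t j)).-1.
  by rewrite /piece_pos fE flatten_indexKr.
rewrite /edge_top pos_theta vtx_theta; case: i => [|i].
  rewrite /wpos l0 prednK // shE /= size_nseq p0 (tix0 pt0).
  by [].
have hw := wvtx_lt i.+1 y.
have -> : size (dword D i.+1 (wvtx i.+2 y)) = size (arrangement i (wvtx i.+2 y)).
  by rewrite /= size_map.
have -> : wpos i.+1 y = (size (arrangement i (wvtx i.+2 y))).-1.
  have := arrangement_last TD hw (0, 0, 0).
  have -> : (tix i.+1 (TV x0), (mult i.+1 (wvtx i.+2 y) (tix i.+1 (TV x0))).-1,
      (pieces i (tix i.+1 (TV x0))).-1) = wtriple i y.
    by rewrite /wtriple l0 shE p0 /= p0.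
  by rewrite -nth_last /wpos => <-; rewrite index_uniq ?(uniq_arrangement TD hw).
by rewrite prednK // (size_arrangement TD hw) (nblocksK_gt0 TD).
Qed.

End Theta.

(** * Transport along conjugacy and orbit equivalence *)

Lemma strong_orbit_equivalent_conj (X Y Z : topologicalType)
    (T : homeomorphism X X) (V : homeomorphism Y Y) (S : homeomorphism Z Z)
    (psi : homeomorphism Y Z) : (forall y, psi (V y) = S (psi y)) ->
  strong_orbit_equivalent T V -> strong_orbit_equivalent T S.
Proof.
move=> psiV [phi [orb [n1 [n2 [n1E n2E c1 c2]]]]].
exists (homeo_comp phi psi); split.
  move=> x; rewrite -(orbit_conj psiV) -orb.
  rewrite eqEsubset; split.
    by move=> _ [y oy <-]; exists (phi y) => //; exists y.
  by move=> _ [_ [y oy <-] <-]; exists y.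
exists n1, n2; split => // x /=.
  by rewrite n1E (iterZ_conj psiV).
by rewrite n2E psiV.
Qed.

(** Minimality of the subshift comes from [T], as density of orbits passes through the
    orbit-preserving homeomorphism. *)
Lemma soe_minimal (X Y : topologicalType) (T : homeomorphism X X)
    (S : homeomorphism Y Y) : minimal_cantor_system T ->
  strong_orbit_equivalent T S -> minimal_cantor_system S.
Proof.
move=> [[hX] minT] [phi [orb _]]; split.
  exact: (inhabits (homeo_comp (homeo_sym phi) hX)).
move=> y O [z Oz] oO; have [||w [/= Ow ow]] := minT (homeo_inv phi y) (phi @^-1` O).
- by exists (homeo_inv phi z); rewrite /= homeo_invK.
- by apply: open_comp => // x _; exact: homeo_fun_continuous.
- exists (phi w); split => //; rewrite -(homeo_invK phi y) -orb.
  by exists w.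
Qed.

(** * Complexity and entropy of the label subshift *)

Section LabelSubshift.
Local Open Scope nat_scope.
Variables (r : nat -> nat) (h : nat -> nat -> nat) (s : nat -> nat -> seq nat).
Variables (N K : nat -> nat) (um uM : nat -> nat).
Hypothesis TD : tower_data r h s N K um uM.
Local Notation D := (label_directive TD).
Local Notation P := (path_space (dorder D)).
Local Notation low := (low r h N).
Local Notation high := (high r h N).
Variable V : homeomorphism P P.
Hypothesis VE : forall x, V x = vmap x.
Hypothesis cP : compact [set: P].
Local Notation Y := (code_subshift V cP).

Lemma label_ht_bound i w : w < dnum D i.+1 -> low i <= ht D i.+1 w <= high i.
Proof.
by move=> hw; rewrite label_directive_ht //; exact: (piece_height_bound TD hw).
Qed.

(** There are at least [K i] labels, and their heights are at most [high i], so some height is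
    shared by a fraction [1 / (high i).+1] of them. *)
Lemma complexity_pigeonhole i : exists l, [/\ low i <= l, l <= high i &
  K i <= (high i).+1 * complexity Y l].
Proof.
apply: contrapT => nl.
have small (l : 'I_(high i).+1) :
    (high i).+1 * #|[set w : 'I_(dnum D i.+1) | ht D i.+1 w == l]%SET| < K i.
  have [ll|ll] := leqP (low i) l; last first.
    rewrite (_ : [set w : 'I_(dnum D i.+1) | ht D i.+1 w == l]%SET = finset.set0).
      by rewrite cards0 muln0 (K_gt0 TD).
    apply/setP => w; rewrite !inE; apply/negbTE; apply: contraL ll => /eqP <-.
    by rewrite -leqNgt; have /andP[] := label_ht_bound (ltn_ord w).
  rewrite ltnNge; apply/negP => hK; apply: nl; exists l; split=> //.
    by rewrite -ltnS.
  apply: leq_trans hK _; rewrite leq_mul2l; apply/orP; right.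
  exact: (complexity_lower (label_directive_marked TD) VE cP i l).
have : (high i).+1 * dnum D i.+1 < (high i).+1 * K i.
  rewrite -[X in _ * X < _](card_ord (dnum D i.+1)) -sum1_card.
  rewrite (partition_big (fun w : 'I_(dnum D i.+1) =>
    (inord (ht D i.+1 w) : 'I_(high i).+1)) xpredT) //= big_distrr /=.
  have -> : (high i).+1 * K i = \sum_(l < (high i).+1) K i.
    by rewrite sum_nat_const card_ord.
  apply: leq_ltn_trans (_ : \sum_(l < (high i).+1)
     (high i).+1 * #|[set w : 'I_(dnum D i.+1) | ht D i.+1 w == l]%SET| < _).
    apply: leq_sum => l _; rewrite leq_mul2l -sum1_card; apply/orP; right.
    apply/eq_leq/eq_bigl => w; rewrite inE -val_eqE /= inordK //.
    by rewrite ltnS; have /andP[] := label_ht_bound (ltn_ord w).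
  rewrite !big_ord_recl -addSn; apply: leq_add; first exact: small.
  by apply: leq_sum => l _; exact: ltnW (small _).
by rewrite ltn_pmul2l // ltnNge (nlab_ge TD).
Qed.

Section Growth.
Variables (R : realType) (a : R) (g : nat -> R).
Hypothesis a0 : (0 <= a)%R.
Hypothesis g0 : forall n, (0 < g n)%R.
Hypothesis spread : forall i, i.+1 * (high i - low i) <= low i.
Hypothesis few : forall i, ((((high i).+1 ^ r i * K i)%N)%:R <=
  expR ((a + i.+1%:R^-1) * (low i)%:R))%R.
Hypothesis many : forall i l, low i <= l <= high i ->
  (i.+1%:R * (high i).+1%:R * g l <= (K i)%:R)%R /\
  ((high i).+1%:R * expR (a * l%:R) <= (K i)%:R)%R.

Lemma low_ge i : i < low i.
Proof.
by have := spread i; rewrite /Labels.low /Labels.high; have := td_low TD i; rewrite /Labels.low; nia.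
Qed.

Lemma label_complexity_liminf :
  limn_einf (fun n => (g n / (complexity Y n)%:R)%:E) = 0%E.
Proof.
apply: limn_einf_eq0 => [n|i].
  by rewrite divr_ge0 // ltW.
have [l [ll lh hK]] := complexity_pigeonhole i; exists l.
  by apply: leq_trans ll; exact: ltnW (low_ge i).
have [gK _] := many (introT andP (conj ll lh)).
have p0 : (0 < (complexity Y l)%:R :> R)%R by rewrite ltr0n complexity_gt0.
have i0 : (0 < i.+1%:R :> R)%R by rewrite ltr0n.
have h0 : (0 < (high i).+1%:R :> R)%R by rewrite ltr0n.
rewrite ler_pdivrMr // ler_pdivlMl // -(ler_pM2l h0) mulrA [X in (X * _)%R]mulrC.
by apply: le_trans gK _; rewrite -natrM ler_nat.
Qed.

Lemma label_complexity_entropy : has_entropy Y a.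
Proof.
apply: submultiplicative_cvg => //.
- by move=> n; exact: complexity_gt0.
- by move=> m n; exact: complexityD.
- move=> i; have [l [ll lh hK]] := complexity_pigeonhole i; exists l.
    by apply: leq_trans ll; exact: ltnW (low_ge i).
  have [_ gK] := many (introT andP (conj ll lh)).
  have h0 : (0 < (high i).+1%:R :> R)%R by rewrite ltr0n.
  rewrite -(ler_pM2l h0); apply: le_trans gK _.
  by rewrite -natrM ler_nat.
- move=> e e0; pose i := Num.truncn (e^-1)%R; pose b := (a + i.+1%:R^-1)%R.
  have be : (b <= a + e)%R.
    rewrite lerD2l -[leRHS]invrK lef_pV2 ?posrE ?invr_gt0 //.
    have /andP[_ /ltW //] : ((Num.truncn e^-1)%:R <= e^-1 < (Num.truncn e^-1).+1%:R)%R.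
    by apply: Num.Theory.truncn_itv; rewrite invr_ge0 ltW.
  have b0 : (0 <= b)%R by rewrite addr_ge0.
  exists (ln (high i)%:R + b * (high i + low i)%:R)%R => l.
  have l0 := td_low TD i.
  (* Enough towers, each of height at least [low i], to cover a word of length [l] at any offset up
     to [high i]. The level [i] stays fixed while [l] grows. *)
  pose M := ((l + high i) %/ low i).+1.
  have lM : l + high i <= M * low i by exact: ltnW (ltn_ceil _ l0).
  have Ml : M * low i <= l + high i + low i.
    by rewrite mulSn addnC leq_add2r leq_trunc_div.
  have := complexity_upper VE cP (n := i)
    (fun w hw => proj1 (andP (label_ht_bound hw)))
    (fun w hw => proj2 (andP (label_ht_bound hw))) lM.
  have h0 : (0 < (high i)%:R :> R)%R by rewrite ltr0n /Labels.high addnS.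
  have hn : ((dnum D i.+1)%:R <= expR (b * (low i)%:R) :> R)%R.
    by apply: le_trans (few i); rewrite ler_nat (nlab_le TD).
  rewrite -(ler_nat R) natrM natrX => hup; apply: le_trans hup _.
  apply: le_trans (_ : ((high i)%:R * expR (b * (low i)%:R) ^+ M <= _)%R).
    by apply: ler_wpM2l; rewrite ?ler0n // lerXn2r // nnegrE ?ler0n ?expR_ge0.
  rewrite -expRM_natr -{1}[(high i)%:R%R]lnK ?posrE // -expRD ler_expR.
  rewrite addrCA lerD2l -mulrA -natrM [low i * M]mulnC.
  apply: le_trans (_ : (b * (l + high i + low i)%:R <= _)%R).
    by apply: ler_wpM2l => //; rewrite ler_nat.
  rewrite -addnA natrD mulrDr lerD2r; apply: ler_wpM2r => //; exact: ler0n.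
Qed.

End Growth.
End LabelSubshift.

(** * Choice of the tower sequence and conclusion *)

Lemma iter_injective (X : topologicalType) (T : homeomorphism X X)
    (hX : homeomorphism X cantor_space) (x : X) :
  (forall y : X, dense (Defs.orbit T y)) -> injective (fun n => iter n T x).
Proof.
move=> minT m n; wlog mn : m n / (m <= n)%N => [W e|].
  by have [/W|/ltnW/W h] := leqP m n; [apply | apply/esym/h].
rewrite -(subnK mn) iterD; have [->//|] := posnP (n - m)%N.
by move=> nm e; have := aperiodic hX minT nm (esym e).
Qed.

(** The partition of level [i] fixes its number of towers, its sum of heights and its return bound
    [G]; these yield [N i] and [K i], which dictate the height [N i * N i * K i] of the next
    towers. *)
Lemma tower_data_ex (R : realType) (a : R) (g : nat -> R) (X : topologicalType)
    (T : homeomorphism X X) (hX : homeomorphism X cantor_space) (x0 : X) :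
  0 <= a -> (forall n, 0 < g n) -> ln (g n) / n%:R @[n --> \oo] --> a ->
  (forall x : X, dense (Defs.orbit T x)) ->
  exists (pt : nat -> towers X) (H N K : nat -> nat)
    (tpt : forall i, tower_partition T x0 (pt i)),
  let r := tnum pt in let h := tht pt in
  [/\ pt 0%N = trivial_towers X,
      forall i, refines T hX x0 i (H i) (pt i) (pt i.+1),
      tower_data r h (titin tpt) N K (fun i => tix pt i x0)
        (fun i => tix pt i (homeo_inv T x0)),
      (forall i, (i.+1 * (high r h N i - low r h N i) <= low r h N i)%N) &
      (forall i, (((high r h N i).+1 ^ r i * K i)%N)%:R <=
        expR ((a + i.+1%:R^-1) * (low r h N i)%:R)) /\
      (forall i l, (low r h N i <= l <= high r h N i)%N ->
        i.+1%:R * (high r h N i).+1%:R * g l <= (K i)%:R /\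
        (high r h N i).+1%:R * expR (a * l%:R) <= (K i)%:R)].
Proof.
move=> a0 g0 glim minT.
have /choice[G GP] : forall p : towers X, exists G, tower_partition T x0 p ->
    forall u x, (u < tw_num p)%N -> exists2 j, (j < G)%N &
    (tw_pos p (iter j T x) == 0%N) && (tw_ix p (iter j T x) == u).
  move=> p; have [tp|ntp] := pselect (tower_partition T x0 p); last by exists 0%N.
  by have [G hG] := tower_gap hX minT tp; exists G.
pose S (p : towers X) := (\sum_(u < tw_num p) tw_ht p u)%N.
have /choice[NK NKP] := fun ip : nat * towers X =>
  let: ex_intro N (ex_intro K h) :=
    parameters_ex ip.1 (S ip.2) (tw_num ip.2) (G ip.2) a0 g0 glim in
  ex_intro (fun NK : nat * nat => let n := (NK.1 - S ip.2)%N in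
    let n' := (NK.1 + (S ip.2).+1)%N in
    [/\ [/\ (1 < NK.1)%N, (G ip.2 <= NK.1)%N, (2 < NK.2)%N, (0 < n)%N &
        (ip.1.+1 * (n' - n) <= n)%N],
      expR ((a + ip.1.+2%:R^-1) * (n' * NK.2)%:R) <= ((NK.2 - 2)`!)%:R,
      ((n'.+1 ^ tw_num ip.2 * NK.2)%N)%:R <= expR ((a + ip.1.+1%:R^-1) * n%:R) &
      forall l, (n <= l <= n')%N -> ip.1.+1%:R * n'.+1%:R * g l <= NK.2%:R /\
        n'.+1%:R * expR (a * l%:R) <= NK.2%:R]) (N, K) h.
have [pt [pt0 tpt rpt]] := tower_sequence_ex hX minT x0
  (fun i p => ((NK (i, p)).1 * (NK (i, p)).1 * (NK (i, p)).2)%N).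
pose N i := (NK (i, pt i)).1; pose K i := (NK (i, pt i)).2.
exists pt, (fun i => N i * N i * K i)%N, N, K, tpt => r h.
have P i := NKP (i, pt i).
split => //; last 2 first.
- by move=> i; have [[]] := P i.
- split; first by move=> i; have [] := P i.
  by move=> i; have [_ _ _] := P i.
split.
- by rewrite /r /tnum pt0.
- by rewrite /h /tht pt0.
- by move=> i; exact: leq_ltn_trans (tix_lt tpt i x0).
- move=> i u hu; have [x [<- _]] := tp_base (tpt i) hu.
  exact: leq_ltn_trans (tp_pos_lt (tpt i) x).
- by move=> i v u hv hu; exact: (titin_lt rpt hv hu).
- by move=> i v; exact: (titin_sum tpt rpt).
- move=> i v u hv hu; have [[_ GN _ _ _] _ _ _] := P i.
  have hG := fun x => GP (pt i) (tpt i) u x hu.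
  have G0 : (0 < G (pt i))%N by have [j jG _] := hG x0; exact: leq_ltn_trans jG.
  apply: leq_trans (titin_count tpt rpt hv hG).
  exact: leq_div2l.
- by move=> i v hv; exact: (rf_large (rpt i)).
- by move=> i; have [[]] := P i.
- by move=> i; have [[]] := P i.
- by move=> i v; exact: (titin_head tpt rpt).
- by move=> i v; exact: (titin_last tpt rpt).
- by move=> i; exact: (tix_lt tpt).
- by move=> i; exact: (tix_lt tpt).
- by move=> i; have [[]] := P i.
(* The label bound at level [i + 1] and the factorial bound at level [i] share the rate a +
   1/(i+2). *)
- move=> i m hm; have [_ _ few _] := P i.+1; have [_ big _ _] := P i.
  rewrite -(ler_nat R); apply: le_trans few _.
  apply: le_trans (_ : expR ((a + i.+2%:R^-1) * (m * (K i * high r h N i))%N%:R) <= _).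
    rewrite ler_expR; apply: ler_wpM2l; first by rewrite addr_ge0.
    by rewrite ler_nat.
  rewrite natrX mulnC natrM mulrA expRM_natr [(K i * _)%N]mulnC.
  by apply: lerXn2r; rewrite ?nnegrE ?ler0n ?expR_ge0.
Qed.

Theorem theorem1p4 (R : realType) (X : topologicalType)
    (T : homeomorphism X X) (hT : minimal_cantor_system T)
    (alpha : R) (halpha : 1 <= alpha)
    (g : nat -> R) (hg : forall n, 0 < g n)
    (hlim : ln (g n) / n%:R @[n --> \oo] --> ln alpha) :
  exists (A : finType) (Y : subshift A),
    [/\ pseudo_Toeplitz R Y,
        strong_orbit_equivalent T (subshift_system Y),
        limn_einf (fun n => (g n / (complexity Y n)%:R)%:E) = 0%E &
        has_entropy Y (ln alpha)].
Proof.
have [[hX] minT] := hT.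
pose x0 := homeo_inv hX (fun=> false).
have a0 : 0 <= ln alpha by exact: ln_ge0.
have [pt [H [N [K [tpt [pt0 rpt TD spread [few many]]]]]]] :=
  tower_data_ex hX x0 a0 hg hlim minT.
have [th thE] := compact_bij_homeo (cantor_compact hX)
  (path_hausdorff (D := label_directive TD))
  (@theta_continuous _ _ _ _ _ _ pt0 _ rpt _ _ TD)
  (@theta_inj _ _ _ _ _ _ pt0 _ rpt _ _ TD) (@theta_surj _ _ _ _ _ _ pt0 _ rpt _ _ TD).
(* The path space is compact as a homeomorphic image of [X]. *)
have cP := homeo_compact th (cantor_compact hX).
have [V VE] := vmap_homeo cP.
have [psi psiE] := code_conj cP (fun x y (e : code V x = code V y) =>
  code_inj (label_directive_marked TD) VE (fun k => congr1 (@^~ k) e)).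
exists (dedge (label_directive TD) 0), (code_subshift V cP).
have soe : strong_orbit_equivalent T (subshift_system (code_subshift V cP)).
  apply: (strong_orbit_equivalent_conj psiE).
  apply: (@tail_strong_orbit_equivalent _ _ T V _ _ _ _ _ _ _ _ th
    (tower_tail_structure tpt rpt)
    (path_tail_structure VE (theta_top pt0 rpt TD))).
  - by move=> n x y; rewrite !thE; exact: theta_same.
  - by move=> n x y; rewrite !thE; exact: same_theta.
  - by move=> n x y; exact: same_tailW.
  - by rewrite thE.
  - rewrite homeo_invK thE VE; apply: bottom_path_eq => i.
      exact: theta_x0.
    by apply: vmap_top; exact: theta_top.
have sub_min := soe_minimal hT soe.
split => //; last 2 first.
- exact: (label_complexity_liminf VE cP a0 hg spread many).
- exact: (label_complexity_entropy VE cP a0 spread few many).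
split=> //; exists (dorder (label_directive TD)); split; last first.
  exact: (dorder_pseudo_ERS R (@label_ht_bound _ _ _ _ _ _ _ TD) (td_low TD) spread).
split; first exact: dorder_proper.
  (* The orbit of [x0] gives infinitely many paths, by aperiodicity. *)
  pose f n := th (iter n T x0).
  move=> finP; apply: infinite_nat; rewrite -(preimage_setT f).
  apply: finite_preimage finP => m n _ _ /(can_inj (homeo_funK th)) e.
  exact: (iter_injective hX minT e).
exists (@vmap (label_directive TD)); split; first exact: vmap_vershik.
by exists psi => x; rewrite -VE psiE.
Qed.
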